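(* Let $r\in\{0,\ldots,d-1\}$ and $\beta\in(0,1]$. Let $M\ge r+1$ and $\alpha\in(0,1)$ be fixed and choose $h\to0$ as $n\to\infty$ such that $\mathrm{BIAS}_0^\Sigma(h)\sim\varepsilon_{n,h}^2$ (for the null hypothesis $\mathcal H_0(I_{t,h},\beta,L,\underline\lambda_r)$), i.e. $$h\sim\max\Big(\big(\underline\lambda_r^{-1}L^2n\big)^{-1/(2\beta+2)},\,(Ln)^{-1/(\beta+2)}\Big).$$ Then the level-$\alpha$ tests $\varphi_{\alpha,0}=\mathbf 1(\lambda_{r+1}(\widehat C^{t,h})>\kappa_{\alpha,0})$ of the null hypothesis $\mathcal H_0(I_{t,h},\beta,L,\underline\lambda_r)$ satisfy for any sequence $R_n\to\infty$ $$\lim_{n\to\infty}\ \inf_{\Sigma\in\mathcal H_1(I_{t,h},R_nv_n)}\mathbb P_\Sigma(\varphi_{\alpha,0}=1)=1$$ with detection rate $$v_n=\min\Big((\underline\lambda_r^{-1}L^2)^{1/(\beta+1)}n^{-\beta/(\beta+1)},\ L^{2/(\beta+2)}n^{-\beta/(\beta+2)}\Big).$$ As $n\to\infty$ the parameters $\underline\lambda_r\ge0$ and $L>0$ may vary arbitrarily with $n$.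
   Context: Setting. Let $d\ge1$, $\eta>0$, $n\in\mathbb N$. $a_n\sim b_n$ means that $a_n\le Cb_n$ and $b_n\le Ca_n$ for some constant $C>0$ and all $n$. $\mathbb R^{d\times d}_{spd}$ denotes the symmetric positive semi-definite $d\times d$ matrices; $\lambda_1(S)\ge\cdots\ge\lambda_d(S)$ are the ordered eigenvalues of a symmetric matrix $S$; $\|\cdot\|$ is the spectral norm. Let $X(t)=X(0)+\int_0^t\sigma(s)\,dB(s)$, $t\in[0,1]$, with a given initial value $X(0)$, a $p$-dimensional standard Brownian motion $B$, deterministic $\sigma\in L^2([0,1];\mathbb R^{d\times p})$, and $\Sigma(t)=\sigma(t)\sigma(t)^\top$. One observes $dY(t)=X(t)\,dt+\eta n^{-1/2}\,dW(t)$, $t\in[0,1]$, with a $d$-dimensional standard Brownian motion $W$ independent of $X$. $\mathbb P_\Sigma$ denotes the law of the observations. For $t\in[0,1)$, $h\in(0,1-t]$ let $I_{t,h}=[t,t+h]$, and for $j\ge1$ let $\Phi_j(s)=\sqrt{2/h}\sin(j\pi(s-t)/h)$, $S_j=\int_{I_{t,h}}\Phi_j'(s)\,dY(s)\in\mathbb R^d$, $\varepsilon_{n,h}=\pi h^{-1}\eta n^{-1/2}$. For $M\ge1$ define $w_j=c_wM^{-1}(1+j^2/M^2)^{-2}$, $j\ge1$, with $c_w>0$ such that $\sum_{j\ge1}w_j=1$, and $\widehat C^{t,h}=\sum_{j\ge1}w_jS_jS_j^\top$. Put $\mathrm{BIAS}_0^\Sigma(h)=\min\big(2Lh^\beta,(r+4)L^2h^{2\beta}/\underline\lambda_r\big)$,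 $\mathcal W(x)=\max(x,\sqrt x)$ and $$\kappa_{\alpha,0}=\big(4\,\mathrm{BIAS}_0^\Sigma(h)+\varepsilon_{n,h}^2\tfrac{M^2}{2}\big)\Big(1+\log(4(d-r))\mathcal W\big(\tfrac{6d}{M}\big)+\tfrac{21\log(2\alpha^{-1})}{M}\Big).$$ Convention: $\underline\lambda_r^{-1}=+\infty$ if $\underline\lambda_r=0$, so that then only the second terms in the minimum for $v_n$ and in the maximum for $h$, and the first term in the bias, matter. Hypotheses. For an interval $I$, $C^\beta(I,L)=\{\Sigma:I\to\mathbb R^{d\times d}_{spd}\,:\,\|\Sigma(t)-\Sigma(s)\|\le L|t-s|^\beta\ \forall t,s\in I\}$; $$\mathcal H_0(I_{t,h},\beta,L,\underline\lambda_r)=\{\Sigma\in C^\beta(I_{t,h},L)\,:\,\mathrm{rank}(\Sigma(s))\le r,\ \lambda_r(\Sigma(s))\ge\underline\lambda_r\ \forall s\in I_{t,h}\}$$ (for $r=0$ the condition on $\lambda_r$ is void), and for $\underline\lambda_{r+1}>0$ $$\mathcal H_1(I_{t,h},\underline\lambda_{r+1})=\{\Sigma\in L^1([0,1];\mathbb R^{d\times d}_{spd})\,:\,\lambda_{r+1}(\Sigma(s))\ge\underline\lambda_{r+1}\ \forall s\in I_{t,h}\}.$$ The test $\varphi_{\alpha,0}$ has level $\alpha$ if $\mathbb P_\Sigma(\varphi_{\alpha,0}=1)\le\alpha$ for all $\Sigma\in\mathcal H_0(I_{t,h},\beta,L,\underline\lambda_r)$. *)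

(* Defs.v *)
From HB Require Import structures.
From mathcomp Require Import all_boot all_order all_algebra.
From mathcomp Require Import all_classical all_reals all_analysis.

Set Implicit Arguments.
Unset Strict Implicit.
Unset Printing Implicit Defensive.

Import Order.TTheory GRing.Theory Num.Theory.
Import numFieldTopology.Exports numFieldNormedType.Exports.

Local Open Scope classical_set_scope.
Local Open Scope ring_scope.

Definition spd {R : realType} {d : nat} (S : 'M[R]_d) : Prop :=
  S^T = S /\ forall x : 'rV[R]_d, 0 <= (x *m S *m x^T) 0 0.

(* The roots of the characteristic polynomial, with multiplicity and in
   nonincreasing order. The default [::] is never used for a symmetric S, whose
   characteristic polynomial splits over R. *)
Definition eigs {R : realType} {d : nat} (S : 'M[R]_d) : seq R :=
  xget [::] [set s : seq R | sorted >=%O s /\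
                             char_poly S = \prod_(x <- s) ('X - x%:P)].

(* lambda_k(S), counted from k = 1 *)
Definition eigval {R : realType} {d : nat} (k : nat) (S : 'M[R]_d) : R :=
  nth 0 (eigs S) k.-1.

(* Processes are indexed by R, but only the times in [0, 1] matter. The last
   clause says that the increments over consecutive disjoint intervals, in all
   coordinates, are mutually independent and N(0, v - u) distributed;
   the second parameter of [normal_prob] is the standard deviation. *)
Definition brownian_motion {R : realType} {disp : measure_display}
    {T : measurableType disp} (P : probability T R) {q : nat}
    (B : R -> T -> 'cV[R]_q) : Prop :=
  [/\ forall s k, 0 <= s <= 1 -> measurable_fun setT (fun w => B s w k 0),
      forall w, B 0 w = 0,
      forall w k, {within `[0, 1], continuous (fun s => B s w k 0)}
    & forall (m : nat) (u : nat -> R) (A : 'I_m -> 'I_q -> set R),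
        0 <= u 0%N -> (forall i, (i < m)%N -> u i < u i.+1) -> u m <= 1 ->
        (forall i k, measurable (A i k)) ->
        P [set w | forall i k, A i k (B (u i.+1) w k 0 - B (u i) w k 0)] =
        (\prod_(i < m) \prod_(k < q)
           normal_prob 0 (Num.sqrt (u i.+1 - u i)) (A i k))%E].

Definition sigma_process {R : realType} {disp : measure_display}
    {T : measurableType disp} {q : nat} (Z : R -> T -> 'cV[R]_q) :
    set (set T) :=
  <<s [set E : set T | exists s k (A : set R),
         [/\ 0 <= s <= 1, measurable A & E = [set w | A (Z s w k 0)]]] >>.

Definition indep_process {R : realType} {disp : measure_display}
    {T : measurableType disp} (P : probability T R) {q q' : nat}
    (Z : R -> T -> 'cV[R]_q) (Z' : R -> T -> 'cV[R]_q') : Prop :=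
  forall E E' : set T, sigma_process Z E -> sigma_process Z' E' ->
    P (E `&` E') = (P E * P E')%E.

(* A step function on [a, b] is a list of triples ((u, v), c), standing for
   the sum of the c 1_{]u, v]}. *)
Definition step_in {R : realType} (a b : R) (s : seq (R * R * R)) : bool :=
  all (fun q => [&& a <= q.1.1, q.1.1 <= q.1.2 & q.1.2 <= b]) s.

Definition step_fun {R : realType} (s : seq (R * R * R)) (x : R) : R :=
  \sum_(q <- s) q.2 * \1_(`]q.1.1, q.1.2]) x.

Definition step_int {R : realType} {T : Type} (Z : R -> T -> R)
    (s : seq (R * R * R)) (w : T) : R :=
  \sum_(q <- s) q.2 * (Z q.1.2 w - Z q.1.1 w).

Definition cvg_in_probability {R : realType} {disp : measure_display}
    {T : measurableType disp} (P : probability T R) (U : nat -> T -> R)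
    (V : T -> R) : Prop :=
  forall e : R, 0 < e -> P [set w | e <= `|U k w - V w|] @[k --> \oo] --> 0%E.

(* V is a version of the integral of f dZ over [a, b], for f in L^2: the limit
   in probability of integrals of step functions tending to f in L^2. *)
Definition stoch_integral {R : realType} {disp : measure_display}
    {T : measurableType disp} (P : probability T R) (Z : R -> T -> R)
    (a b : R) (f : R -> R) (V : T -> R) : Prop :=
  measurable_fun setT V /\
  exists s : nat -> seq (R * R * R),
    [/\ forall k, step_in a b (s k),
        (\int[lebesgue_measure]_(x in `[a, b])
            ((f x - step_fun (s k) x) ^+ 2)%:E)%E @[k --> \oo] --> 0%E
      & cvg_in_probability P (fun k => step_int Z (s k)) V].

(* L^1([0, 1]; spd matrices) *)
Definition L1_spd {R : realType} {d : nat} (Sig : R -> 'M[R]_d) : Prop :=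
  (forall s, 0 <= s <= 1 -> spd (Sig s)) /\
  (forall i j, lebesgue_measure.-integrable `[0, 1]
                 (fun s => (Sig s i j)%:E)).

Record experiment (R : realType) (d : nat) := Experiment {
  edisp : measure_display;
  Omega : measurableType edisp;
  Prob : probability Omega R;
  bdim : nat;
  sigma : R -> 'M[R]_(d, bdim);
  Bproc : R -> Omega -> 'cV[R]_bdim;
  Xproc : R -> Omega -> 'cV[R]_d;
  Wproc : R -> Omega -> 'cV[R]_d;
  Yproc : R -> Omega -> 'cV[R]_d
}.

Arguments Omega {R d} _.
Arguments Prob {R d} _.
Arguments sigma {R d} _ _.
Arguments Bproc {R d} _ _ _.
Arguments Xproc {R d} _ _ _.
Arguments Wproc {R d} _ _ _.
Arguments Yproc {R d} _ _ _.

(* X(0) is arbitrary, and only the increments of Y are specified. *)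
Definition observation_model {R : realType} {d : nat} (eta : R) (n : nat)
    (Sig : R -> 'M[R]_d) (E : experiment R d) : Prop :=
  let P := Prob E in
  [/\ 
      (forall i k, measurable_fun (`[0, 1] : set R) (fun s => sigma E s i k)) /\
      (forall i k, (\int[lebesgue_measure]_(s in `[0%R, 1%R])
                       ((sigma E s i k) ^+ 2)%:E < +oo)%E),
      forall s, 0 <= s <= 1 -> Sig s = sigma E s *m (sigma E s)^T,
      [/\ brownian_motion P (Bproc E), brownian_motion P (Wproc E)
        & indep_process P (Xproc E) (Wproc E)],
      (* X(s) = X(0) + int_0^s sigma dB *)
      [/\ forall s i, 0 <= s <= 1 ->
            measurable_fun setT (fun w => Xproc E s w i 0),
          forall w i, {within `[0, 1], continuous (fun s => Xproc E s w i 0)}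
        & forall s, 0 <= s <= 1 ->
            exists J : Omega E -> 'M[R]_(d, bdim E),
              (forall i k, stoch_integral P (fun u w => Bproc E u w k 0) 0 s
                 (fun u => sigma E u i k) (fun w => J w i k)) /\
              {ae P, forall w, Xproc E s w =
                Xproc E 0 w + \col_i \sum_k J w i k}]
    & (* dY = X dt + eta n^{-1/2} dW *)
      (forall s i, 0 <= s <= 1 ->
         measurable_fun setT (fun w => Yproc E s w i 0)) /\
      (forall s, 0 <= s <= 1 -> {ae P, forall w, forall i,
         Yproc E s w i 0 = Yproc E 0 w i 0 +
           \int[lebesgue_measure]_(u in `[0, s]) (Xproc E u w i 0) +
           eta / Num.sqrt n%:R * Wproc E s w i 0})].

Definition Phi {R : realType} (t h : R) (j : nat) (s : R) : R :=
  Num.sqrt (2 / h) * sin (j%:R * pi * (s - t) / h).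

Definition spectral_statistic {R : realType} {d : nat} (E : experiment R d)
    (t h : R) (j : nat) (S : Omega E -> 'cV[R]_d) : Prop :=
  forall i, stoch_integral (Prob E) (fun s w => Yproc E s w i 0) t (t + h)
    (derive1 (Phi t h j)) (fun w => S w i 0).

Definition weight {R : realType} (cw M : R) (j : nat) : R :=
  cw * M^-1 * ((1 + j%:R ^+ 2 / M ^+ 2) ^+ 2)^-1.

Definition Chat {R : realType} {d : nat} {T : Type} (cw M : R)
    (S : nat -> T -> 'cV[R]_d) (w : T) : 'M[R]_d :=
  \matrix_(i, k)
    limn (fun N => \sum_(1 <= j < N) weight cw M j * (S j w *m (S j w)^T) i k).

Definition eps {R : realType} (eta : R) (n : nat) (h : R) : R :=
  pi * h^-1 * eta / Num.sqrt n%:R.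

Definition bias0 {R : realType} (r : nat) (beta L lam h : R) : R :=
  if lam == 0 then 2 * L * h `^ beta
  else Num.min (2 * L * h `^ beta)
               ((r%:R + 4) * L ^+ 2 * h `^ (2 * beta) / lam).

Definition calW {R : realType} (x : R) : R := Num.max x (Num.sqrt x).

Definition kappa0 {R : realType} (d r : nat)
    (eta alpha beta M L lam h : R) (n : nat) : R :=
  (4 * bias0 r beta L lam h + eps eta n h ^+ 2 * (M ^+ 2 / 2)) *
  (1 + ln (4 * (d - r)%:R) * calW (6 * d%:R / M) +
   21 * ln (2 * alpha^-1) / M).

Definition phi0 {R : realType} {d : nat} {T : Type} (r : nat)
    (eta alpha beta cw M L lam h : R) (n : nat) (S : nat -> T -> 'cV[R]_d)
    (w : T) : bool :=
  kappa0 d r eta alpha beta M L lam h n < eigval r.+1 (Chat cw M S w).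

Definition H1 {R : realType} {d : nat} (r : nat) (t h lam1 : R) :
    set (R -> 'M[R]_d) :=
  [set Sig | L1_spd Sig /\
     forall s, t <= s <= t + h -> lam1 <= eigval r.+1 (Sig s)].

(* The order of magnitude of sequences indexed by n >= 1. *)
Definition same_order {R : realType} (a b : nat -> R) : Prop :=
  exists2 C : R, 0 < C &
    forall n, (0 < n)%N -> a n <= C * b n /\ b n <= C * a n.

Definition bandwidth {R : realType} (beta L lam : R) (n : nat) : R :=
  if lam == 0 then (L * n%:R) `^ (- (beta + 2)^-1)
  else Num.max ((lam^-1 * L ^+ 2 * n%:R) `^ (- (2 * beta + 2)^-1))
               ((L * n%:R) `^ (- (beta + 2)^-1)).

Definition rate {R : realType} (beta L lam : R) (n : nat) : R :=
  if lam == 0 then L `^ (2 / (beta + 2)) * n%:R `^ (- (beta / (beta + 2)))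
  else Num.min ((lam^-1 * L ^+ 2) `^ (beta + 1)^-1 *
                  n%:R `^ (- (beta / (beta + 1))))
               (L `^ (2 / (beta + 2)) * n%:R `^ (- (beta / (beta + 2)))).

(* Main.v *)
Require Import Defs.
From HB Require Import structures.
From mathcomp Require Import all_boot all_order all_algebra.
From mathcomp Require Import all_classical all_reals all_analysis.
From mathcomp Require Import measurable_realfun fingroup perm complex.
From mathcomp Require Import ring lra.

Set Implicit Arguments.
Unset Strict Implicit.
Unset Printing Implicit Defensive.

Import Order.TTheory GRing.Theory Num.Theory.
Import numFieldTopology.Exports numFieldNormedType.Exports.

Local Open Scope classical_set_scope.
Local Open Scope ring_scope.

(* The interval [t, t + h] is split into r + 1 blocks by smooth functions of
   cos (pi (s - t) / h). Each of them is approximated by a sine polynomial whose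
   coefficients are controlled in the norm dual to the weights w_j, so that by
   Cauchy-Schwarz the corresponding combinations Q_0, ..., Q_r of the S_j satisfy
   sum_l (v . Q_l)^2 <= K v Chat v^T. Hence lambda_(r+1)(Chat) <= kappa makes
   Q_0, ..., Q_r nearly linearly dependent. Up to an error that vanishes in
   probability, Q_l is a Gaussian vector built from the increments of B on the
   l-th block plus noise from W. Conditioning on W and on the other blocks, Q_l
   would have to be close to a subspace of dimension r; since lambda_(r+1)(Sigma) >=
   lambda, some direction orthogonal to that subspace carries variance at least
   c lambda, and the one-dimensional Gaussian density bound gives
   P (lambda_(r+1)(Chat) <= kappa) <= C sqrt (kappa / lambda).
   The balance of bias and noise makes kappa of the order of v_n, so the bound is
   of order R_n^(-1/2). *)

(** * Symmetric matrices *)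

Section spectral.
Variable R : realType.

(** Two features of the model shape the argument. X(0) is arbitrary, and Sigma(s) varies with time
    together with its eigenvectors. The test functions vanish at both ends of the interval, which
    cancels X(0). A fixed direction with enough variance is found by integrating the trace of Sigma
    over an orthonormal basis of the complement of the subspace: one of the d - r basis vectors must
    carry its share.

    The S_j are only versions of limits in probability, and [Chat] is a [limn] that might diverge.
    Estimates are therefore made for step functions, outside sets of small outer probability, and
    convergence of the series is proved separately.

    As w_j decays like j^-4, the dual norm of sum a_j sin(j x) is the sum of a_j^2 j^4, the L^2 norm
    of the second derivative. Approximation must thus keep second derivatives bounded whatever the
    degree. Bernstein polynomials of a C^{1,1} bump in (1 + cos x) / 2 do this, because their
    derivatives are governed by differences of the values at the nodes; the factor sin x makes them
    sine polynomials.

    The constants in the probability bound do not depend on Sigma or on n, so the bound passes to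
    the infimum over the alternative. *)

Definition nsq n (x : 'rV[R]_n) : R := (x *m x^T) 0 0.
Definition qform n (S : 'M[R]_n) (x : 'rV[R]_n) : R := (x *m S *m x^T) 0 0.

Lemma nsqE n (x : 'rV[R]_n) : nsq x = \sum_i x 0 i ^+ 2.
Proof. by rewrite /nsq mxE; apply: eq_bigr => i _; rewrite mxE expr2. Qed.

Lemma nsq_ge0 n (x : 'rV[R]_n) : 0 <= nsq x.
Proof. by rewrite nsqE; apply: sumr_ge0 => i _; exact: sqr_ge0. Qed.

Lemma nsq_eq0 n (x : 'rV[R]_n) : (nsq x == 0) = (x == 0).
Proof.
rewrite nsqE psumr_eq0; [|by move=> i _; exact: sqr_ge0].
apply/allP/eqP => [h|-> i _]; last by rewrite mxE expr0n /= eqxx.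
apply/rowP => i; have := h i (mem_index_enum i).
by rewrite mxE sqrf_eq0 => /eqP.
Qed.

Lemma nsq_gt0 n (x : 'rV[R]_n) : (0 < nsq x) = (x != 0).
Proof. by rewrite lt0r nsq_eq0 nsq_ge0 andbT. Qed.

Lemma nsqZ n a (x : 'rV[R]_n) : nsq (a *: x) = a ^+ 2 * nsq x.
Proof. by rewrite !nsqE mulr_sumr; apply: eq_bigr => i _; rewrite mxE exprMn. Qed.

Lemma nsq_orth m n (A : 'M[R]_(m, n)) x : A *m A^T = 1%:M -> nsq (x *m A) = nsq x.
Proof. by move=> AA; rewrite /nsq trmx_mul mulmxA -(mulmxA x) AA mulmx1. Qed.

Lemma qform_diag n (D x : 'rV[R]_n) : qform (diag_mx D) x = \sum_i D 0 i * x 0 i ^+ 2.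
Proof.
rewrite /qform mul_mx_diag mxE; apply: eq_bigr => i _; rewrite !mxE; ring.
Qed.

Lemma qform_conj m n (S : 'M[R]_n) (A : 'M[R]_(m, n)) x :
  qform (A *m S *m A^T) x = qform S (x *m A).
Proof. by rewrite /qform trmx_mul !mulmxA. Qed.

(** Over the complex numbers an eigenvector v exists. Evaluating v S v* from both sides, with S real
    and symmetric, gives a |v|^2 = conj(a) |v|^2, so a is real and is a root of the real
    characteristic polynomial. *)
Lemma symmetric_has_eigenvalue n (S : 'M[R]_n.+1) :
  S^T = S -> exists x, eigenvalue S x.
Proof.
move=> symS; pose f := real_complex R.
have [a /eigenvalueP[v vS v0]] := eigenvalue_closed (map_mx f S) (ltn0Sn n).
pose cj := @map_mx R[i] _ (@conjc R) 1 n.+1.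
have eqc (x : R) : conjc (f x) = f x by rewrite /= oppr0.
have vcS : cj v *m map_mx f S = conjc a *: cj v.
  rewrite -map_mxZ -vS map_mxM; congr (_ *m _).
  by apply/matrixP => i j; rewrite !mxE; exact: esym (eqc _).
have symfS : (map_mx f S)^T = map_mx f S by rewrite map_trmx symS.
pose nv := (v *m (cj v)^T) 0 0.
have mulcJ (z : R[i]) : z * conjc z = f (complex.Re z ^+ 2 + complex.Im z ^+ 2).
  by case: z => y z; apply/eqP; rewrite eq_complex /=; apply/andP; split; apply/eqP; ring.
have nv0 : nv != 0.
  rewrite /nv mxE psumr_eq0; last first.
    by move=> i _; rewrite !mxE; rewrite mulcJ lecR addr_ge0 // ?sqr_ge0.
  apply: contra v0 => /allP h; apply/eqP/rowP => i.
  have := h i (mem_index_enum i); rewrite !mxE mulcJ.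
  case: (v 0 i) => x y /=; rewrite eq_complex /= eqxx andbT.
  rewrite paddr_eq0 ?sqr_ge0 // !sqrf_eq0 => /andP[/eqP-> /eqP->].
  by [].
have ac : a = conjc a.
  apply: (mulIf nv0).
  have -> : a * nv = (v *m map_mx f S *m (cj v)^T) 0 0.
    by rewrite vS -scalemxAl mxE.
  by rewrite -mulmxA -{1}symfS -trmx_mul vcS linearZ -scalemxAr mxE.
exists (complex.Re a); rewrite eigenvalue_root_char.
rewrite -(fmorph_root f) map_char_poly -eigenvalue_root_char.
apply/eigenvalueP; exists v => //; rewrite vS; congr (_ *: _).
case: (a) ac => x y [] /= /eqP; rewrite -subr_eq0 opprK -mulr2n mulrn_eq0 /=.
by move=> /eqP ->.
Qed.

(** H is the Householder reflection along e - v, which exchanges v with the first basis vector e;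
    for v = e the identity serves. *)
Lemma orthogonal_first_row n (v : 'rV[R]_(1 + n)) : nsq v = 1 ->
  exists H : 'M[R]_(1 + n), [/\ H *m H^T = 1%:M, H^T = H & row 0 H = v].
Proof.
move=> nv; pose e : 'rV[R]_(1 + n) := delta_mx 0 0.
have [->|ve] := eqVneq v e.
  exists 1%:M; rewrite trmx1 mulmx1; split=> //.
  by apply/rowP => i; rewrite !mxE eq_sym.
pose w := e - v; pose k := 2 / nsq w.
have nw : nsq w != 0 by rewrite nsq_eq0 subr_eq0 eq_sym.
have kw : k * nsq w = 2 by rewrite divfK.
have nwE : nsq w = 2 - 2 * v 0 0.
  have : nsq w = nsq e - 2 * v 0 0 + nsq v.
    rewrite !nsqE.
    have -> : v 0 0 = \sum_i e 0 i * v 0 i.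
      rewrite (bigD1 0) //= big1 ?addr0; last first.
        by move=> i i0; rewrite mxE eqxx (negbTE i0) mul0r.
      by rewrite mxE !eqxx mul1r.
    rewrite mulr_sumr -sumrN -!big_split /=; apply: eq_bigr => i _.
    have -> : w 0 i = e 0 i - v 0 i by rewrite !mxE.
    ring.
  rewrite nv => ->; rewrite nsqE (bigD1 0) //= big1 ?addr0; last first.
    by move=> i i0; rewrite mxE eqxx (negbTE i0) expr0n.
  by rewrite [e _ _]mxE !eqxx /=; ring.
pose H := 1%:M - k *: (w^T *m w).
have HT : H^T = H.
  by rewrite /H linearB linearZ /= trmx_mul trmxK trmx1.
have wwww : w^T *m w *m (w^T *m w) = nsq w *: (w^T *m w).
  rewrite mulmxA -(mulmxA w^T w) (mx11_scalar (w *m w^T)) -/(nsq w).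
  by rewrite mul_mx_scalar -scalemxAl.
exists H; split=> //.
  rewrite HT /H mulmxBl mul1mx (mulmxBr (k *: _)) mulmx1 -scalemxAl -scalemxAr wwww.
  by rewrite !scalerA -(mulrA k) kw; apply/matrixP => i j; rewrite !mxE; ring.
apply/rowP => i.
have -> : row 0 H 0 i = (0 == i)%:R - k * (w 0 0 * w 0 i).
  by rewrite !mxE big_ord1 !mxE.
have -> : k * (w 0 0 * w 0 i) = w 0 i.
  rewrite mulrA [X in X * _](_ : _ = 1) ?mul1r //.
  have -> : w 0 0 = nsq w / 2 by rewrite nwE !mxE !eqxx /=; lra.
  by rewrite mulrA kw mulfV // pnatr_eq0.
by rewrite !mxE eqxx /= opprB [(0 == i)]eq_sym; ring.
Qed.

(** Deflation: conjugating by the reflection whose first row is a unit eigenvector splits off a 1 x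
    1 block, and the induction hypothesis treats the remaining symmetric block. *)
Lemma symmetric_diagonalization n (S : 'M[R]_n) : S^T = S ->
  exists (P : 'M[R]_n) (D : 'rV[R]_n), P *m P^T = 1%:M /\ S = P^T *m diag_mx D *m P.
Proof.
elim: n S => [|n IH] S symS.
  by exists 1%:M, 0; split; [rewrite trmx1 mulmx1 | apply/matrixP => -[]].
have [x /eigenvalueP[v0 v0S v00]] := symmetric_has_eigenvalue symS.
pose v : 'rV[R]_(1 + n) := (Num.sqrt (nsq v0))^-1 *: v0.
have nv : nsq v = 1.
  by rewrite nsqZ exprVn sqr_sqrtr ?nsq_ge0 // mulVf // nsq_eq0.
have vS : v *m S = x *: v.
  by rewrite -scalemxAl v0S !scalerA mulrC.
have [H [HH HT Hv]] := orthogonal_first_row nv.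
pose S1 : 'M[R]_(1 + n) := H *m S *m H.
have S1T : S1^T = S1 by rewrite !trmx_mul HT symS mulmxA.
have HHH : H *m H = 1%:M by rewrite -{2}HT.
have S1r : row 0 S1 = x *: delta_mx 0 0.
  rewrite !row_mul Hv vS -scalemxAl -Hv -row_mul HHH; congr (_ *: _).
  by apply/rowP => i; rewrite !mxE eq_sym eqxx.
have S1b : S1 = block_mx x%:M 0 0 (drsubmx S1).
  rewrite -[LHS]submxK; congr block_mx.
  - apply/matrixP => i j; rewrite !ord1 [LHS]mxE [LHS]mxE.
    have -> : S1 (lshift n 0) (lshift n 0) = row 0 S1 0 0.
      by rewrite [RHS]mxE; congr (S1 _ _); apply: val_inj.
    by rewrite S1r !mxE !eqxx mulr1.
  - apply/matrixP => i j; rewrite !ord1 [LHS]mxE [LHS]mxE.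
    have -> : S1 (lshift n 0) (rshift 1 j) = row 0 S1 0 (rshift 1 j).
      by rewrite [RHS]mxE; congr (S1 _ _); apply: val_inj.
    by rewrite S1r !mxE eqxx /= mulr0.
  - apply/matrixP => i j; rewrite !ord1 [LHS]mxE [LHS]mxE -S1T mxE.
    have -> : S1 (lshift n 0) (rshift 1 i) = row 0 S1 0 (rshift 1 i).
      by rewrite [RHS]mxE; congr (S1 _ _); apply: val_inj.
    by rewrite S1r !mxE eqxx /= mulr0.
have symd : (drsubmx S1)^T = drsubmx S1.
  by rewrite trmx_drsub S1T.
have [P' [D' [PP' SE]]] := IH _ symd.
pose Q : 'M[R]_(1 + n) := block_mx 1%:M 0 0 P'.
have QQ : Q *m Q^T = 1%:M.
  rewrite /Q tr_block_mx mulmx_block !trmx0 trmx1 !mulmx0 !mul0mx mulmx1.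
  by rewrite PP' !addr0 add0r scalar_mx_block.
exists (Q *m H), (row_mx x%:M D'); split.
  by rewrite trmx_mul mulmxA -(mulmxA Q) HH mulmx1.
rewrite trmx_mul HT.
have -> : S = H *m S1 *m H.
  by rewrite /S1 !mulmxA HHH mul1mx -mulmxA HHH mulmx1.
rewrite S1b !mulmxA; congr (_ *m _); rewrite -!mulmxA; congr (_ *m _).
have Dr : diag_mx (row_mx x%:M D') = block_mx x%:M 0 0 (diag_mx D').
  rewrite diag_mx_row; congr block_mx; apply/matrixP => i j.
  by rewrite !ord1 !mxE.
have E : block_mx x%:M 0 0 (drsubmx S1) =
    Q^T *m (diag_mx (row_mx x%:M D') *m Q) :> 'M[R]_(1 + n).
  rewrite Dr /Q tr_block_mx !trmx0 trmx1 !mulmx_block.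
  rewrite ?(mulmx0, mul0mx, mulmx1, mul1mx, addr0, add0r).
  by rewrite {1}SE mulmxA.
exact: E.
Qed.

End spectral.

Section cauchy_schwarz.
Variable R : realType.

(** Lagrange's identity: twice the difference of the two sides is the sum of the squares (a_i b_j -
    a_j b_i)^2. *)
Lemma sum_cauchy_schwarz (I : finType) (a b : I -> R) :
  (\sum_i a i * b i) ^+ 2 <= (\sum_i a i ^+ 2) * (\sum_i b i ^+ 2).
Proof.
have : 0 <= \sum_i \sum_j (a i * b j - a j * b i) ^+ 2.
  by apply: sumr_ge0 => i _; apply: sumr_ge0 => j _; exact: sqr_ge0.
have -> : \sum_i \sum_j (a i * b j - a j * b i) ^+ 2 =
    (\sum_i a i ^+ 2) * (\sum_i b i ^+ 2) * 2 - (\sum_i a i * b i) ^+ 2 * 2.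
  have -> (u v : R) : u * v * 2 = u * v + v * u by ring.
  rewrite expr2 !big_distrlr /= mulr_suml -sumrN -!big_split /=.
  apply: eq_bigr => i _; rewrite mulr_suml -sumrN -!big_split /=.
  by apply: eq_bigr => j _; ring.
by rewrite -mulrBl pmulr_lge0 // subr_ge0.
Qed.

Lemma nsq_dot n (x y : 'rV[R]_n) : (x *m y^T) 0 0 ^+ 2 <= nsq x * nsq y.
Proof.
rewrite mxE !nsqE; under eq_bigr do rewrite mxE.
exact: sum_cauchy_schwarz.
Qed.

Lemma nsqD_le n (x y : 'rV[R]_n) : nsq (x + y) <= 2 * nsq x + 2 * nsq y.
Proof.
rewrite !nsqE !mulr_sumr -big_split /=; apply: ler_sum => i _; rewrite mxE.
by have := sqr_ge0 (x 0 i - y 0 i); nra.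
Qed.

Lemma nsq_mulmx m n (c : 'rV[R]_m) (T : 'M[R]_(m, n)) :
  nsq (c *m T) <= nsq c * \sum_i nsq (row i T).
Proof.
rewrite nsqE; under [X in _ * X]eq_bigr do rewrite nsqE.
rewrite exchange_big mulr_sumr /=; apply: ler_sum => j _.
rewrite mxE nsqE; under [X in _ * X]eq_bigr do rewrite mxE.
exact: sum_cauchy_schwarz.
Qed.

End cauchy_schwarz.

Section eigenvalues.
Variable R : realType.

Lemma mulmx_left_kernel m n (B : 'M[R]_(m, n)) : (n < m)%N ->
  exists2 x : 'rV_m, x != 0 & x *m B = 0.
Proof.
move=> nm; have /rowV0Pn[x /sub_kermxP xB x0] : kermx B != 0.
  by rewrite -mxrank_eq0 mxrank_ker -lt0n subn_gt0 (leq_ltn_trans (rank_leq_col B)).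
by exists x.
Qed.

Lemma symmetric_sorted_diagonalization n (S : 'M[R]_n) : S^T = S ->
  exists (P : 'M[R]_n) (D : 'rV[R]_n), [/\ P *m P^T = 1%:M,
    S = P^T *m diag_mx D *m P & forall i j : 'I_n, (i <= j)%N -> D 0 j <= D 0 i].
Proof.
move=> /symmetric_diagonalization[P [D [PP SE]]].
pose t := [tuple D 0 i | i < n].
have /tuple_permP[p pE] : perm_eq (sort_tuple >=%O t) t by rewrite perm_sort.
have st : sorted >=%O (sort >=%O t) by exact: sort_sorted ge_total _.
exists (row_perm p P), (col_perm p D); split.
- rewrite row_permE trmx_mul mulmxA -(mulmxA (perm_mx p)) PP mulmx1.
  by rewrite tr_perm_mx -perm_mxM mulgV perm_mx1.
- rewrite SE; apply/matrixP => i j.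
  rewrite !mul_mx_diag !mxE (reindex_inj (@perm_inj _ p)) /=.
  by apply: eq_bigr => k _; rewrite !mxE.
- move=> i j ij; rewrite !mxE.
  have E (k : 'I_n) : D 0 (p k) = nth 0 (sort >=%O t) k.
    have -> : sort >=%O t = [tuple tnth t (p i) | i < n] by exact: pE.
    by rewrite -tnth_nth !tnth_mktuple.
  rewrite !E; apply: (sorted_leq_nth ge_trans ge_refl 0 st) => //.
  + by rewrite inE size_sort size_tuple.
  + by rewrite inE size_sort size_tuple.
Qed.

Lemma char_poly_orth_diag n (P : 'M[R]_n) (D : 'rV[R]_n) : P *m P^T = 1%:M ->
  char_poly (P^T *m diag_mx D *m P) = \prod_i ('X - (D 0 i)%:P).
Proof.
move=> PP; have PTP : P^T *m P = 1%:M by exact: mulmx1C.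
transitivity (char_poly (diag_mx D)); last first.
  rewrite char_poly_trig ?diag_mx_is_trig //.
  by apply: eq_bigr => i _; rewrite mxE eqxx.
have PTPp : map_mx polyC P^T *m map_mx polyC P = 1%:M.
  by rewrite -map_mxM PTP map_mx1.
rewrite /char_poly.
have -> : char_poly_mx (P^T *m diag_mx D *m P) =
    map_mx polyC P^T *m char_poly_mx (diag_mx D) *m map_mx polyC P.
  rewrite /char_poly_mx mulmxBr mulmxBl !map_mxM /= mul_mx_scalar -scalemxAl.
  by rewrite PTPp scalemx1.
rewrite !det_mulmx mulrC mulrA -det_mulmx -map_mxM PP map_mx1 det1 mul1r.
by [].
Qed.

(** [eigs] picks some sorted list of roots. A split polynomial determines its roots up to
    permutation, and sorting removes that freedom, so the choice is the diagonal D. *)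
Lemma eigval_sorted_diag n (S P : 'M[R]_n) (D : 'rV[R]_n) : P *m P^T = 1%:M ->
  S = P^T *m diag_mx D *m P ->
  (forall i j : 'I_n, (i <= j)%N -> D 0 j <= D 0 i) ->
  forall k : 'I_n, eigval k.+1 S = D 0 k.
Proof.
move=> PP SE Ds k; pose s := [seq D 0 i | i <- enum 'I_n].
have cS : char_poly S = \prod_(x <- s) ('X - x%:P).
  by rewrite SE char_poly_orth_diag // big_map enumT.
have ss : sorted >=%O s.
  rewrite sorted_map; apply: (@sub_sorted _ (fun i j : 'I_n => i <= j)%N).
    by move=> i j /=; exact: Ds.
  have := iota_sorted 0 n; rewrite -val_enum_ord sorted_map.
  by apply: sub_sorted => i j.
have : [set s : seq R | sorted >=%O s /\ char_poly S = \prod_(x <- s) ('X - x%:P)]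
   (eigs S) by apply: (xgetPex [::]); exists s.
move=> [se ce]; rewrite /eigval.
have -> : eigs S = s.
  apply: (sorted_eq ge_trans ge_anti se ss).
  by apply: prod_XsubC_eq; rewrite -ce.
by rewrite /= (nth_map k) ?size_enum_ord // nth_ord_enum.
Qed.

Lemma qform_orth_diag n (P : 'M[R]_n) (D x : 'rV[R]_n) :
  qform (P^T *m diag_mx D *m P) x = \sum_i D 0 i * (x *m P^T) 0 i ^+ 2.
Proof. by rewrite -[P in _ *m P]trmxK qform_conj qform_diag. Qed.

Lemma nsq_orth_tr n (P : 'M[R]_n) (x : 'rV[R]_n) : P *m P^T = 1%:M ->
  nsq (x *m P^T) = nsq x.
Proof. by move=> /mulmx1C PP; apply: nsq_orth; rewrite trmxK. Qed.

Lemma qform_orth_row n (P : 'M[R]_n) (D : 'rV[R]_n) i : P *m P^T = 1%:M ->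
  qform (P^T *m diag_mx D *m P) (row i P) = D 0 i.
Proof.
move=> PP; rewrite qform_orth_diag -row_mul PP (bigD1 i) //= big1 ?addr0.
  by rewrite !mxE eqxx expr1n mulr1.
by move=> j ji; rewrite !mxE eq_sym (negbTE ji) expr0n mulr0.
Qed.

Lemma rowsub_orth m n (P : 'M[R]_n) (f : 'I_m -> 'I_n) : injective f ->
  P *m P^T = 1%:M -> rowsub f P *m (rowsub f P)^T = 1%:M.
Proof.
move=> fI PP; apply/matrixP => i j.
have -> : (rowsub f P *m (rowsub f P)^T) i j = (P *m P^T) (f i) (f j).
  by rewrite !mxE; apply: eq_bigr => k _; rewrite !mxE.
by rewrite PP !mxE (inj_eq fI).
Qed.

Lemma rowsub_orth_coord m n (P : 'M[R]_n) (f : 'I_m -> 'I_n) (x : 'rV_m) i :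
  P *m P^T = 1%:M -> (x *m rowsub f P *m P^T) 0 i = \sum_j x 0 j * (f j == i)%:R.
Proof.
move=> PP; rewrite -mulmxA mxE; apply: eq_bigr => j _; congr (_ * _).
have -> : (rowsub f P *m P^T) j i = (P *m P^T) (f j) i.
  by rewrite !mxE; apply: eq_bigr => k _; rewrite !mxE.
by rewrite PP mxE.
Qed.

Lemma qform_ge_top n (P : 'M[R]_n) (D y : 'rV[R]_n) (k : 'I_n) :
  P *m P^T = 1%:M -> (forall i j : 'I_n, (i <= j)%N -> D 0 j <= D 0 i) ->
  (forall i : 'I_n, (k < i)%N -> (y *m P^T) 0 i = 0) ->
  D 0 k * nsq y <= qform (P^T *m diag_mx D *m P) y.
Proof.
move=> PP Ds y0; rewrite qform_orth_diag -(nsq_orth_tr y PP) nsqE mulr_sumr.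
apply: ler_sum => i _; have [ki|ik] := ltnP k i.
  by rewrite y0 // expr0n !mulr0.
by rewrite ler_wpM2r ?sqr_ge0 ?Ds.
Qed.

Lemma qform_le_bottom n (P : 'M[R]_n) (D y : 'rV[R]_n) (k : 'I_n) :
  P *m P^T = 1%:M -> (forall i j : 'I_n, (i <= j)%N -> D 0 j <= D 0 i) ->
  (forall i : 'I_n, (i < k)%N -> (y *m P^T) 0 i = 0) ->
  qform (P^T *m diag_mx D *m P) y <= D 0 k * nsq y.
Proof.
move=> PP Ds y0; rewrite qform_orth_diag -(nsq_orth_tr y PP) nsqE mulr_sumr.
apply: ler_sum => i _; have [ki|ik] := ltnP i k.
  by rewrite y0 // expr0n !mulr0.
by rewrite ler_wpM2r ?sqr_ge0 ?Ds.
Qed.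

(** Courant-Fischer with a margin [e], which makes the condition visibly stable under small changes
    of S; measurability rests on this form. For the converse, k + 1 dimensions contain a nonzero
    vector orthogonal to the k top eigenvectors, and there the form is at most lambda_(k+1). *)
Lemma lt_eigvalP n (S : 'M[R]_n) (k : 'I_n) (kap : R) : S^T = S ->
  kap < eigval k.+1 S <->
  exists2 e : R, 0 < e & exists2 A : 'M[R]_(k.+1, n), A *m A^T = 1%:M &
    forall x, (kap + e) * nsq x <= qform S (x *m A).
Proof.
move=> /symmetric_sorted_diagonalization[P [D [PP SE Ds]]].
rewrite (eigval_sorted_diag PP SE Ds); split=> [kD|[e e0 [A AA Ae]]].
  exists (D 0 k - kap); first by rewrite subr_gt0.
  pose f := widen_ord (ltn_ord k).
  have fI : injective f by move=> i j /(congr1 val) ij; exact: val_inj.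
  have AA := rowsub_orth fI PP.
  exists (rowsub f P) => // x; rewrite subrKC SE -(nsq_orth x AA).
  apply: qform_ge_top => // i ki; rewrite rowsub_orth_coord // big1 // => j _.
  rewrite (_ : (f j == i) = false) ?mulr0 //; apply: contraTF ki => /eqP <-.
  by rewrite -leqNgt -ltnS /= ltn_ord.
rewrite ltNge; apply/negP => Dk.
pose g : 'I_k -> 'I_n := widen_ord (ltnW (ltn_ord k)).
have [x x0 xB] := mulmx_left_kernel (colsub g (A *m P^T)) (ltnSn k).
have : qform S (x *m A) <= kap * nsq x.
  apply: (@le_trans _ _ (D 0 k * nsq x)); last by rewrite ler_wpM2r ?nsq_ge0.
  rewrite SE -(nsq_orth x AA); apply: qform_le_bottom => // i ik.
  rewrite -mulmxA; have /rowP/(_ (Ordinal ik)) := xB.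
  rewrite !mxE => {2}<-; apply: eq_bigr => j _; congr (_ * _).
  by rewrite [RHS]mxE; congr ((A *m P^T) _ _); apply: val_inj.
move=> /(le_trans (Ae x)); rewrite mulrDl gerDl leNgt mulr_gt0 //.
by rewrite nsq_gt0.
Qed.

(** The rows of V span at least n - r dimensions, hence meet the span of the r + 1 top eigenvectors,
    where the form is at least lam. By Cauchy-Schwarz the trace over the rows dominates the form at
    a unit vector of their span. The trace is used because its basis V can be kept fixed while S
    varies. *)
Lemma qform_trace_ge n m r (S : 'M[R]_n) (V : 'M[R]_(m, n)) (lam : R) :
  spd S -> (r < n)%N -> (n <= m + r)%N -> V *m V^T = 1%:M ->
  lam <= eigval r.+1 S -> lam <= \sum_i qform S (row i V).
Proof.
move=> [symS psdS] rn nmr VV.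
have [P [D [PP SE Ds]]] := symmetric_sorted_diagonalization symS.
pose k := Ordinal rn; rewrite (eigval_sorted_diag PP SE Ds k) => lamD.
have D0 i : 0 <= D 0 i.
  by rewrite -(qform_orth_row D i PP) -SE; exact: psdS.
have mn : (n - r.+1 + r.+1 = n)%N by rewrite subnK.
have gP (j : 'I_(n - r.+1)) : (r.+1 + j < n)%N by rewrite -ltn_subRL.
pose g j : 'I_n := Ordinal (gP j).
have nm : (n - r.+1 < m)%N by rewrite ltn_subLR // addSn ltnS addnC.
have [x x0 xB] := mulmx_left_kernel (colsub g (V *m P^T)) nm.
have h1 : lam * nsq x <= qform S (x *m V).
  apply: (@le_trans _ _ (D 0 k * nsq x)); first by rewrite ler_wpM2r ?nsq_ge0.
  rewrite SE -(nsq_orth x VV); apply: qform_ge_top => // i ki.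
  have iP : (i - r.+1 < n - r.+1)%N by rewrite ltn_sub2r // (leq_ltn_trans ki).
  rewrite -mulmxA; have /rowP/(_ (Ordinal iP)) := xB.
  rewrite !mxE => {2}<-; apply: eq_bigr => j _; congr (_ * _).
  rewrite [RHS]mxE; congr ((V *m P^T) _ _); apply: val_inj => /=.
  by rewrite subnKC.
have h2 : qform S (x *m V) <= nsq x * \sum_i qform S (row i V).
  rewrite SE qform_orth_diag; under [X in _ <= _ * X]eq_bigr do rewrite qform_orth_diag.
  rewrite exchange_big mulr_sumr /=; apply: ler_sum => j _.
  rewrite -mulr_sumr [leRHS]mulrCA; apply: ler_wpM2l => //; rewrite -mulmxA mxE nsqE.
  under [X in _ * X]eq_bigr do rewrite -row_mul mxE.
  exact: sum_cauchy_schwarz.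
move: (le_trans h1 h2); rewrite [leRHS]mulrC ler_pM2r //.
by rewrite nsq_gt0.
Qed.

(** V consists of the last n - r eigenvectors of U^T U, which has rank at most r and so vanishes on
    them. *)
Lemma orthonormal_complement r n (U : 'M[R]_(r, n)) : (r < n)%N ->
  exists2 V : 'M[R]_(n - r, n), V *m V^T = 1%:M & U *m V^T = 0.
Proof.
move=> rn; pose S := U^T *m U.
have symS : S^T = S by rewrite /S trmx_mul trmxK.
have qS x : qform S x = nsq (x *m U^T).
  by rewrite /qform /nsq /S trmx_mul trmxK !mulmxA.
have [P [D [PP SE Ds]]] := symmetric_sorted_diagonalization symS.
have D0 i : 0 <= D 0 i by rewrite -(qform_orth_row D i PP) -SE qS nsq_ge0.
pose k := Ordinal rn; have Dk : D 0 k = 0.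
  apply: le_anti; rewrite D0 andbT.
  pose f := widen_ord (ltn_ord k).
  have fI : injective f by move=> i j /(congr1 val) ij; exact: val_inj.
  have AA := rowsub_orth fI PP.
  have [x x0 xB] := mulmx_left_kernel (rowsub f P *m U^T) (ltnSn r).
  have : D 0 k * nsq (x *m rowsub f P) <= qform S (x *m rowsub f P).
    rewrite SE; apply: qform_ge_top => // i ki.
    rewrite rowsub_orth_coord // big1 // => j _.
    rewrite (_ : (f j == i) = false) ?mulr0 //; apply: contraTF ki => /eqP <-.
    by rewrite -leqNgt -ltnS /= ltn_ord.
  rewrite qS -mulmxA xB (nsq_orth _ AA) {2}/nsq mul0mx mxE pmulr_lle0 //.
  by rewrite nsq_gt0.
have gP (j : 'I_(n - r)) : (r + j < n)%N by rewrite -ltn_subRL.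
pose g j : 'I_n := Ordinal (gP j).
have gI : injective g by move=> i j /(congr1 val)/= /addnI/val_inj.
exists (rowsub g P); first exact: rowsub_orth.
apply/trmx_inj; rewrite trmx_mul trmxK trmx0; apply/row_matrixP => i.
apply/eqP; rewrite row0 row_mul -nsq_eq0 -qS row_rowsub SE qform_orth_row //.
apply/eqP/le_anti; rewrite D0 andbT -Dk Ds //=.
by rewrite leq_addr.
Qed.

Lemma eigval_scalar n (k : 'I_n) (c : R) : eigval k.+1 (c%:M : 'M[R]_n) = c.
Proof.
have E : c%:M = (1%:M)^T *m diag_mx (const_mx c) *m 1%:M :> 'M[R]_n.
  by rewrite trmx1 mul1mx mulmx1 diag_const_mx.
by rewrite (eigval_sorted_diag _ E) ?mxE ?trmx1 ?mulmx1 // => i j _; rewrite !mxE.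
Qed.

End eigenvalues.

(** * Approximate linear dependence of the rows of a matrix *)

Section near_degenerate.
Variable R : realType.

Definition nearly_dependent m n (T : 'M[R]_(m, n)) (K : R) : Prop :=
  exists2 c : 'rV[R]_m, c != 0 & nsq (c *m T) <= K * nsq c.

(** Rational coefficients turn the event into a countable union, so that it is measurable. *)
Definition row_near_span m n (l : 'I_m.+1) (T : 'M[R]_(m.+1, n)) (K : R) : Prop :=
  exists q : 'rV[rat]_m, nsq (row l T - map_mx ratr q *m row' l T) < K.

(** Choose c with c T orthogonal to the r top eigenvectors of S: r equations for r + 1 unknowns.
    Along every other eigenvector P_i the component of c T is the product of c with T P_i, and |T
    P_i|^2 <= K kap by hypothesis. The factor n counts the components. *)
Lemma eigval_nearly_dependent n r (S : 'M[R]_n) (T : 'M[R]_(r.+1, n)) (kap K : R) :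
  S^T = S -> (r < n)%N -> eigval r.+1 S <= kap -> 0 <= kap -> 0 <= K ->
  (forall v, nsq (v *m T^T) <= K * qform S v) ->
  nearly_dependent T (n%:R * (K * kap)).
Proof.
move=> symS rn Skap kap0 K0 hT.
have [P [D [PP SE Ds]]] := symmetric_sorted_diagonalization symS.
pose k := Ordinal rn; move: Skap; rewrite (eigval_sorted_diag PP SE Ds k) => Dk.
pose g : 'I_r -> 'I_n := widen_ord (ltnW rn).
have [c c0 cB] := mulmx_left_kernel (colsub g (T *m P^T)) (ltnSn r).
exists c => //; rewrite -(nsq_orth_tr _ PP) nsqE.
have -> : n%:R * (K * kap) * nsq c = \sum_(i < n) K * kap * nsq c.
  by rewrite sumr_const card_ord -[RHS]mulr_natl !mulrA.
apply: ler_sum => i _; have [ir|ri] := ltnP i r.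
  have -> : (c *m T *m P^T) 0 i = 0.
    rewrite -mulmxA; have /rowP/(_ (Ordinal ir)) := cB.
    rewrite !mxE => {2}<-; apply: eq_bigr => j _; congr (_ * _).
    by rewrite [RHS]mxE; congr ((T *m P^T) _ _); apply: val_inj.
  by rewrite expr0n !mulr_ge0 ?nsq_ge0.
have -> : (c *m T *m P^T) 0 i = (c *m (row i P *m T^T)^T) 0 0.
  rewrite trmx_mul trmxK -mulmxA mxE [RHS]mxE; apply: eq_bigr => j _.
  by congr (_ * _); rewrite mxE [RHS]mxE; apply: eq_bigr => l _; rewrite !mxE.
apply: (le_trans (nsq_dot _ _)); rewrite mulrC ler_wpM2r ?nsq_ge0 //.
apply: (le_trans (hT _)); rewrite ler_wpM2l // SE qform_orth_row //.
exact: le_trans (Ds k i ri) Dk.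
Qed.

Lemma nearly_dependent_perturb m n (T T' : 'M[R]_(m, n)) (K : R) :
  \sum_i nsq (row i (T - T')) <= K ->
  nearly_dependent T K -> nearly_dependent T' (4 * K).
Proof.
move=> hT [c c0 hc]; exists c => //.
have -> : c *m T' = c *m T + c *m (T' - T) by rewrite -mulmxDr addrC subrK.
apply: (le_trans (nsqD_le _ _)).
have : nsq (c *m (T' - T)) <= nsq c * K.
  rewrite -opprB mulmxN -scaleN1r nsqZ sqrrN expr1n mul1r.
  by apply: (le_trans (nsq_mulmx _ _)); rewrite ler_wpM2l ?nsq_ge0.
lra.
Qed.

Lemma rational_row_approx m (p : 'rV[R]_m) (e : R) : 0 < e ->
  exists q : 'rV[rat]_m, nsq (p - map_mx ratr q) <= e.
Proof.
move=> e0; pose s := e / m.+1%:R.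
have s0 : 0 < s by rewrite divr_gt0.
have h (k : 'I_m) : exists q : rat, (p 0 k - ratr q) ^+ 2 <= s.
  have sq0 : 0 < Num.sqrt s by rewrite sqrtr_gt0.
  have [q] : exists q : rat, ratr q \in `]p 0 k, (p 0 k + Num.sqrt s)[.
    by apply: rat_in_itvoo; rewrite ltrDl.
  rewrite in_itv /= => /andP[h1 h2].
  by exists q; rewrite -(sqr_sqrtr (ltW s0)); nra.
have /choice[q hq] := h.
exists (\row_k q k); rewrite nsqE.
apply: (@le_trans _ _ (\sum_(k < m) s)).
  by apply: ler_sum => k _; rewrite !mxE.
rewrite sumr_const card_ord -[leLHS]mulr_natl /s mulrA ler_pdivrMr //.
by rewrite mulrC ler_wpM2l ?ler_nat // ltW.
Qed.

(** Divide the relation by its largest coefficient c_l: since |c|^2 <= (m + 1) c_l^2, row l is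
    within (m + 1) K of the span of the others. Making the coefficients rational costs at most as
    much again, and [nsqD_le] doubles both. *)
Lemma nearly_dependent_row_near_span m n (T : 'M[R]_(m.+1, n)) (K : R) : 0 < K ->
  nearly_dependent T K -> exists l, row_near_span l T (4 * m.+1%:R * K).
Proof.
move=> K0 [c c0 hc].
have [l _ hl0] := @arg_maxP _ _ 'I_m.+1 ord0 predT (fun i => c 0 i ^+ 2) isT.
have hl i : c 0 i ^+ 2 <= c 0 l ^+ 2 by exact: hl0.
have cl0 : 0 < c 0 l ^+ 2.
  rewrite lt0r sqr_ge0 andbT; apply: contra c0 => /eqP cl0.
  apply/eqP/rowP => i; rewrite mxE; apply/eqP; rewrite -sqrf_eq0.
  by apply/eqP/le_anti; rewrite sqr_ge0 andbT -cl0 hl.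
have cl : c 0 l != 0 by rewrite -sqrf_eq0 gt_eqF.
have nc : nsq c <= m.+1%:R * c 0 l ^+ 2.
  rewrite nsqE; apply: (@le_trans _ _ (\sum_(i < m.+1) c 0 l ^+ 2)).
    by apply: ler_sum => i _; exact: hl.
  by rewrite sumr_const card_ord mulr_natl.
pose p : 'rV[R]_m := \row_k (- c 0 (lift l k) / c 0 l).
have pE : row l T - p *m row' l T = (c 0 l)^-1 *: (c *m T).
  apply/rowP => j; rewrite !mxE (bigD1_ord l) //= mulrDr mulrA mulVf // mul1r.
  congr (_ + _); rewrite -sumrN mulr_sumr; apply: eq_bigr => k _.
  by rewrite !mxE; ring.
pose Z := \sum_i nsq (row i (row' l T)).
have Z0 : 0 <= Z by apply: sumr_ge0 => i _; exact: nsq_ge0.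
have m0 : 0 < m.+1%:R * K :> R by rewrite mulr_gt0.
have [|q hq] := @rational_row_approx _ p (m.+1%:R * K / (Z + 1)).
  by rewrite divr_gt0 // ltr_wpDl.
exists l, q.
have -> : row l T - map_mx ratr q *m row' l T =
    (row l T - p *m row' l T) + (p - map_mx ratr q) *m row' l T.
  by rewrite mulmxBl addrA subrK.
apply: (le_lt_trans (nsqD_le _ _)).
have h1 : nsq (row l T - p *m row' l T) <= m.+1%:R * K.
  rewrite pE nsqZ exprVn mulrC ler_pdivrMr //.
  by apply: (le_trans hc); rewrite mulrC mulrAC -mulrA mulrCA -mulrA; nra.
have h2 : nsq ((p - map_mx ratr q) *m row' l T) < m.+1%:R * K.
  apply: (le_lt_trans (nsq_mulmx _ _)); rewrite -/Z.
  apply: (@le_lt_trans _ _ (m.+1%:R * K / (Z + 1) * Z)).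
    by rewrite ler_wpM2r.
  by rewrite mulrAC ltr_pdivrMr ?ltr_wpDl // ltr_pM2l // ltrDl.
lra.
Qed.

Lemma row_near_span_nearly_dependent m n (l : 'I_m.+1) (T : 'M[R]_(m.+1, n)) (K : R) :
  0 <= K -> row_near_span l T K -> nearly_dependent T K.
Proof.
move=> K0 [q hq].
pose c : 'rV[R]_m.+1 :=
  \row_i (if unlift l i is Some k then - ratr (q 0 k) else 1).
have cl : c 0 l = 1 by rewrite mxE unlift_none.
have cT : c *m T = row l T - map_mx ratr q *m row' l T.
  apply/rowP => j; rewrite !mxE (bigD1_ord l) //= cl mul1r; congr (_ + _).
  rewrite -sumrN; apply: eq_bigr => k _.
  by rewrite [c _ _]mxE liftK !mxE mulNr.
have nc : 1 <= nsq c.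
  rewrite nsqE (bigD1 l) //= cl expr1n lerDl; apply: sumr_ge0 => i _.
  exact: sqr_ge0.
exists c; first by rewrite -nsq_gt0 (lt_le_trans ltr01).
by rewrite cT (le_trans (ltW hq)) // ler_peMr.
Qed.

End near_degenerate.

(** * Measurability of limits and of eigenvalue events *)

Section measurability.
Variable R : realType.

Lemma cvgn_cauchyP (u : R^nat) : cvgn u <->
  forall k, exists N, forall m, `|u N - u (N + m)%N| < k.+1%:R^-1.
Proof.
split=> [/cvg_cauchy/cauchy_ballP cu k|cu].
  have k0 : 0 < k.+1%:R^-1 :> R by [].
  have [[A B] [[N1 _ h1] [N2 _ h2]] h] := cu _ k0.
  exists (maxn N1 N2) => m; apply: (h (_, _)); split => /=.
    by apply: h1; rewrite /= leq_maxl.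
  by apply: h2; rewrite /= (leq_trans (leq_maxr N1 N2)) ?leq_addr.
apply/cauchy_cvgP/cauchy_exP => e e0.
have [k] := ltr_add_invr e0; rewrite add0r => ke.
have [N hN] := cu k; exists (u N); exists N => // m /= Nm.
by apply: lt_trans ke; rewrite -(subnKC Nm).
Qed.

Lemma qformE n (S : 'M[R]_n) (y : 'rV[R]_n) :
  qform S y = \sum_i \sum_j y 0 j * S j i * y 0 i.
Proof.
rewrite /qform mxE; apply: eq_bigr => i _; rewrite !mxE mulr_suml.
by apply: eq_bigr => j _.
Qed.

Context d (T : measurableType d).

Lemma measurable_lt_cst (f : T -> R) (c : R) :
  measurable_fun setT f -> measurable [set w | f w < c].
Proof.
move=> mf; have -> : [set w | f w < c] = f @^-1` `]-oo, c[.
  by apply/seteqP; split=> w /=; rewrite in_itv.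
by rewrite -[X in measurable X]setTI; exact: mf.
Qed.

Lemma measurable_cvgn (f : nat -> T -> R) :
  (forall n, measurable_fun setT (f n)) -> measurable [set w | cvgn (f ^~ w)].
Proof.
move=> mf.
have -> : [set w | cvgn (f ^~ w)] = \bigcap_k \bigcup_N \bigcap_m
   [set w | `|f N w - f (N + m)%N w| < k.+1%:R^-1].
  apply/seteqP; split=> w /=.
    move=> /cvgn_cauchyP h k _; have [N hN] := h k.
    by exists N => // m _ /=.
  move=> h; apply/cvgn_cauchyP => k; have [N _ hN] := h k I.
  by exists N => m; exact: hN.
apply: bigcapT_measurable => k; apply: bigcupT_measurable => N.
apply: bigcapT_measurable => m.
apply: measurable_lt_cst.
by apply: measurableT_comp => //; exact: measurable_funB.
Qed.

(** Convergence is not assumed: where the sequence diverges, [limn] is the default [point], and the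
    set of convergence is measurable by the Cauchy criterion. *)
Lemma measurable_limn (f : nat -> T -> R) :
  (forall n, measurable_fun setT (f n)) ->
  measurable_fun setT (fun w => limn (f ^~ w)).
Proof.
move=> mf; have mC := measurable_cvgn mf; set C := [set w | _] in mC.
have -> : (fun w => limn (f ^~ w)) =
    (fun w => if w \in C then limn (f ^~ w) else point).
  apply/funext => w; case: ifPn => //; rewrite notin_setE /C /= => /dvgP ->.
  by [].
apply: measurable_fun_if => //.
- apply: (measurable_fun_bool true).
  rewrite setTI (_ : _ @^-1` _ = C) //.
  by apply/seteqP; split=> w; [move=> /set_mem | move=> Cw; exact: mem_set].
- rewrite setTI.
  have -> : (fun w => w \in C) @^-1` [set true] = C.
    by apply/seteqP; split=> w; [move=> /set_mem | move=> Cw; exact: mem_set].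
  apply: (@measurable_fun_cvg _ _ _ _ f) => // n; exact: measurable_funTS.
Qed.

(** An open set of matrices is the union of the countably many rational boxes contained in it. O
    itself may be any predicate, for instance an uncountable existential as in [lt_eigvalP]. *)
Lemma measurable_open_entries m n (F : T -> 'M[R]_(m, n)) (O : set 'M[R]_(m, n)) :
  (forall i j, measurable_fun setT (fun w => F w i j)) ->
  (forall A, O A -> exists2 e : R, 0 < e &
     forall B : 'M[R]_(m, n), (forall i j, `|B i j - A i j| < e) -> O B) ->
  measurable [set w | O (F w)].
Proof.
move=> mF oO.
pose Q (q : 'M[rat]_(m, n) * nat) (B : 'M[R]_(m, n)) :=
  forall i j, `|B i j - ratr (q.1 i j)| < q.2.+1%:R^-1.
pose G q : set T := [set w | Q q (F w) /\ Q q `<=` O].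
have -> : [set w | O (F w)] = \bigcup_q G q.
  apply/seteqP; split=> w /=; last by move=> [q _ [h1 h2]]; exact: h2.
  move=> /oO[e e0 he].
  have e20 : 0 < e / 2 by rewrite divr_gt0.
  have [k] := ltr_add_invr e20; rewrite add0r => ke.
  have h (ij : 'I_m * 'I_n) : exists q : rat, `|F w ij.1 ij.2 - ratr q| < k.+1%:R^-1.
    have [q] : exists q : rat, ratr q \in
        `](F w ij.1 ij.2), (F w ij.1 ij.2 + k.+1%:R^-1)[.
      by apply: rat_in_itvoo; rewrite ltrDl.
    rewrite in_itv /= => /andP[h1 h2]; exists q.
    by rewrite ltr0_norm ?subr_lt0 // opprB ltrBlDl.
  have /choice[q hq] := h.
  exists (\matrix_(i, j) q (i, j), k) => //; split=> [i j|B hB]; rewrite /= ?mxE.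
    exact: (hq (i, j)).
  apply: he => i j; have := hB i j; rewrite /= mxE => hBij.
  have := hq (i, j) => /=.
  rewrite distrC => hFij.
  apply: (le_lt_trans (ler_distD (ratr (q (i, j))) _ _)).
  by rewrite [ltRHS]splitr ltrD ?(lt_trans _ ke).
apply: countable_bigcupT_measurable; first exact: countableP.
move=> q; have [qO|qO] := pselect (Q q `<=` O); last first.
  rewrite (_ : G q = set0) //; apply/seteqP; split=> w //=.
  by move=> [].
have -> : G q = \bigcap_ij [set w | `|F w ij.1 ij.2 - ratr (q.1 ij.1 ij.2)| < q.2.+1%:R^-1].
  apply/seteqP; split=> w /=.
    by move=> [h _] [i j] _ /=; exact: h.
  by move=> h; split=> // i j; exact: (h (i, j) I).
apply: fin_bigcap_measurable => //.
move=> ij _; apply: measurable_lt_cst; apply: measurableT_comp => //.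
exact: measurable_funB.
Qed.

(** Half of the margin in [lt_eigvalP] absorbs an entrywise perturbation of size e / 2 divided by
    n^2 + 1, with the same subspace U. *)
Lemma measurable_lt_eigval n r (kap : R) (F : T -> 'M[R]_n) : (r < n)%N ->
  (forall i j, measurable_fun setT (fun w => F w i j)) ->
  (forall w, (F w)^T = F w) -> measurable [set w | kap < eigval r.+1 (F w)].
Proof.
move=> rn mF symF; pose k := Ordinal rn.
pose O (A : 'M[R]_n) := exists2 e : R, 0 < e & exists2 U : 'M[R]_(k.+1, n),
  U *m U^T = 1%:M & forall x, (kap + e) * nsq x <= qform A (x *m U).
have -> : [set w | kap < eigval r.+1 (F w)] = [set w | O (F w)].
  by apply/seteqP; split=> w /= /(lt_eigvalP k _ (symF w)).
apply: measurable_open_entries => // A [e e0 [U UU h]].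
pose c : R := (n * n).+1%:R.
have c0 : 0 < c by [].
exists (e / 2 / c); first by rewrite !divr_gt0.
move=> B hB; exists (e / 2); first by rewrite divr_gt0.
exists U => // x; set y := x *m U.
have yx : nsq y = nsq x by exact: nsq_orth.
have hd : qform A y - qform B y <= e / 2 * nsq y.
  have -> : qform A y - qform B y = \sum_i \sum_j y 0 j * (A j i - B j i) * y 0 i.
    rewrite !qformE -sumrB; apply: eq_bigr => i _; rewrite -sumrB.
    by apply: eq_bigr => j _; ring.
  apply: (@le_trans _ _ (\sum_(i < n) \sum_(j < n) (e / 2 / c * nsq y))).
    apply: ler_sum => i _; apply: ler_sum => j _.
    apply: (le_trans (ler_norm _)); rewrite !normrM mulrAC mulrC.
    apply: ler_pM; rewrite ?mulr_ge0 //; first by rewrite distrC ltW.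
    have yk (l : 'I_n) : y 0 l ^+ 2 <= nsq y.
      rewrite nsqE (bigD1 l) //= lerDl; apply: sumr_ge0 => *; exact: sqr_ge0.
    have := yk i; have := yk j; rewrite -(real_normK (num_real (y 0 i))).
    by rewrite -(real_normK (num_real (y 0 j))); nra.
  rewrite !sumr_const !card_ord -mulrnA -[leLHS]mulr_natl mulrA.
  apply: ler_wpM2r; first exact: nsq_ge0.
  rewrite mulrCA ger_pMr ?divr_gt0 // ler_pdivrMr // mul1r ler_nat.
  exact: leqW.
by have := h x; rewrite -/y -yx; lra.
Qed.

End measurability.

(** * Decoupling and Gaussian variables *)

Section decoupling.
Context d (T : measurableType d) (R : realType) (P : probability T R).
Local Open Scope ereal_scope.

Definition indep_families (G1 G2 : set (set T)) : Prop :=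
  forall A B, G1 A -> G2 B -> P (A `&` B) = P A * P B.

Lemma indep_familiesC G1 G2 : indep_families G1 G2 -> indep_families G2 G1.
Proof. by move=> h A B GA GB; rewrite setIC muleC h. Qed.

Lemma sub_sigma_measurable (G : set (set T)) :
  G `<=` measurable -> <<s G >> `<=` measurable.
Proof. by move=> Gm; apply: smallest_sub => //; exact: sigma_algebra_measurable. Qed.

(** For fixed B the measures A |-> P(A & B) and A |-> P(A) P(B) agree on the pi-system G1 and have
    the same finite total mass, hence agree on the generated sigma-algebra. *)
Lemma indep_sigma_left G1 G2 : setI_closed G1 -> G1 `<=` measurable ->
  G2 `<=` measurable -> indep_families G1 G2 -> indep_families <<s G1 >> G2.
Proof.
move=> G1I G1m G2m ind A B GA GB.
have mB := G2m _ GB.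
have PB0 : (0 <= fine (P B))%R by rewrite fine_ge0.
pose m1 := mrestr P mB; pose m2 := mscale (NngNum PB0) P.
have PBE : (fine (P B))%:E = P B by rewrite fineK // fin_num_measure.
suff : m1 A = m2 A by rewrite /m1 /m2 /mrestr /mscale /= PBE muleC.
have H : [set X | G1 X /\ X `<=` setT] = G1.
  by apply/seteqP; split=> X /= => [[]//|GX]; split.
apply: (@g_sigma_algebra_measure_unique_trace _ _ _ G1 setT) => //; rewrite ?H //.
- by rewrite -[LHS]/(P (setT `&` B)) -[RHS]/((fine (P B))%:E * P setT) setTI
    probability_setT mule1 PBE.
- move=> X GX.
  by rewrite -[LHS]/(P (X `&` B)) -[RHS]/((fine (P B))%:E * P X) PBE muleC ind.
- by rewrite -[ltLHS]/(P (setT `&` B)) setTI ltey_eq fin_num_measure.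
Qed.

Lemma indep_sigma G1 G2 : setI_closed G1 -> setI_closed G2 ->
  G1 `<=` measurable -> G2 `<=` measurable -> indep_families G1 G2 ->
  indep_families <<s G1 >> <<s G2 >>.
Proof.
move=> I1 I2 m1 m2 ind; apply: indep_sigma_left => //.
  exact: sub_sigma_measurable.
by apply/indep_familiesC/indep_sigma_left => //; exact: indep_familiesC.
Qed.

Section two_families.
Variables G1 G2 : set (set T).
Hypotheses (G1m : G1 `<=` measurable) (G2m : G2 `<=` measurable).
Hypothesis ind : indep_families <<s G1 >> <<s G2 >>.

Let T1 := g_sigma_algebraType G1.
Let T2 := g_sigma_algebraType G2.

Lemma measurable_id_sub (G : set (set T)) : G `<=` measurable ->
  measurable_fun setT (id : T -> g_sigma_algebraType G).
Proof.
move=> Gm _ A mA; rewrite setTI; exact: (sub_sigma_measurable Gm mA).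
Qed.

(** [T1] and [T2] are the same space T with the two sub-sigma-algebras. Independence says that the
    image of P under the diagonal map is the product of its restrictions; the rest is Tonelli. *)
Lemma decoupling (f : T1 * T2 -> \bar R) : measurable_fun setT f ->
  (forall z, 0 <= f z) ->
  \int[P]_w f (w, w) = \int[P]_w2 \int[P]_w1 f (w1, w2).
Proof.
move=> mf f0.
pose i1 : {mfun T >-> T1} := HB.pack (id : T -> T1)
  (isMeasurableFun.Build _ _ _ _ (id : T -> T1) (measurable_id_sub G1m)).
pose i2 : {mfun T >-> T2} := HB.pack (id : T -> T2)
  (isMeasurableFun.Build _ _ _ _ (id : T -> T2) (measurable_id_sub G2m)).
have mdg : measurable_fun setT (fun w : T => (w, w) : T1 * T2).
  by apply: measurable_fun_pair; exact: measurable_id_sub.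
pose dg : {mfun T >-> (T1 * T2)%type} := HB.pack (fun w : T => (w, w) : T1 * T2)
  (isMeasurableFun.Build _ _ _ _ _ mdg).
pose P1 := distribution P i1; pose P2 := distribution P i2.
have E : forall X : set (T1 * T2), measurable X -> (P1 \x P2) X = distribution P dg X.
  apply: product_measure_unique => A B mA mB.
  by rewrite /distribution /pushforward /= -ind.
transitivity (\int[distribution P dg]_z f z).
  by rewrite ge0_integral_distribution.
transitivity (\int[P1 \x P2]_z f z).
  by apply: eq_measure_integral => X mX _; exact: esym (E _ mX).
rewrite fubini_tonelli2 // /fubini_G ge0_integral_distribution //.
- apply: eq_integral => w2 _ /=; rewrite ge0_integral_distribution //.
  exact: measurableT_comp.
- exact: measurable_fun_fubini_tonelli_G.
- by move=> w2; exact: integral_ge0.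
Qed.

Lemma measurable_partial_integral (f : T1 * T2 -> \bar R) :
  measurable_fun setT f -> (forall z, 0 <= f z) ->
  measurable_fun setT (fun w2 : T2 => \int[P]_w1 f (w1, w2)).
Proof.
move=> mf f0.
pose i1 : {mfun T >-> T1} := HB.pack (id : T -> T1)
  (isMeasurableFun.Build _ _ _ _ (id : T -> T1) (measurable_id_sub G1m)).
have := @measurable_fun_fubini_tonelli_G _ _ T1 T2 R (distribution P i1) f mf f0.
congr measurable_fun; apply/funext => w2.
rewrite /fubini_G ge0_integral_distribution //.
exact: measurableT_comp.
Qed.

Lemma decoupling_le (f : T1 * T2 -> \bar R) (c : R) :
  measurable_fun setT f -> (forall z, 0 <= f z) ->
  (forall w2, \int[P]_w1 f (w1, w2) <= c%:E) -> \int[P]_w f (w, w) <= c%:E.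
Proof.
move=> mf f0 fc; rewrite decoupling //.
have -> : c%:E = \int[P]_w cst c%:E w.
  by rewrite integral_cst //= probability_setT mule1.
apply: ge0_le_integral => //.
- by move=> w _; exact: integral_ge0.
- have := measurable_partial_integral mf f0.
  move=> /measurableT_comp /(_ (measurable_id_sub G2m)).
  exact.
Qed.

(** This replaces conditioning: a bound that holds for every frozen value of the second argument
    holds on the diagonal. *)
Lemma decoupling_set_le (A : set (T1 * T2)) (c : R) : measurable A ->
  (forall w2, P [set w1 | A (w1, w2)] <= c%:E) -> P [set w | A (w, w)] <= c%:E.
Proof.
move=> mA h.
have mA2 w2 : measurable ([set w1 | A (w1, w2)] : set T).
  rewrite (_ : [set w1 | _] = ysection A w2).
    exact: (sub_sigma_measurable G1m (measurable_ysection w2 mA)).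
  by apply/seteqP; split=> w1; [move=> Aw; exact: mem_set | move=> /set_mem].
have mAd : measurable ([set w | A (w, w)] : set T).
  have mdg : measurable_fun setT (fun w : T => (w, w) : T1 * T2).
    by apply: measurable_fun_pair; exact: measurable_id_sub.
  by rewrite -[X in measurable X]setTI; exact: mdg.
have PE (B : set T) : measurable B -> P B = \int[P]_w (\1_B w)%:E.
  by move=> mB; rewrite integral_indic // setIT.
rewrite PE //; apply: (@decoupling_le (fun z => (\1_A z)%:E)) => //.
  exact/measurable_EFinP/measurable_indic.
by move=> w2; have := h w2; rewrite PE.
Qed.

End two_families.
End decoupling.

Section gaussian_integrals.
Variable R : realType.
Local Notation mu := (@lebesgue_measure R).

Lemma normal_pdf_expR (m s x : R) : s != 0 ->
  normal_pdf m s x = (Num.sqrt (2 * pi * s ^+ 2))^-1 * expR (- ((x - m) ^+ 2 / (2 * s ^+ 2))).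
Proof.
move=> s0; rewrite /normal_pdf (negbTE s0) /normal_peak /normal_fun.
congr ((Num.sqrt _)^-1 * expR _); first by rewrite -mulr_natl; ring.
by rewrite mulNr -[s ^+ 2 *+ 2]mulr_natl.
Qed.

Lemma ge0_integral_normal_prob (m s : R) (f : R -> \bar R) :
  measurable_fun setT f -> (forall x, 0 <= f x)%E ->
  (\int[normal_prob m s]_x f x = \int[mu]_x (f x * (normal_pdf m s x)%:E))%E.
Proof.
move=> mf f0; have dom := normal_prob_dominates m s.
rewrite -(Radon_Nikodym_SigmaFinite.change_of_variables dom) //.
have mRN := measurable_int _ (Radon_Nikodym_SigmaFinite.f_integrable dom).
have mpdf : measurable_fun setT (fun x => (normal_pdf m s x)%:E).
  by apply/measurable_EFinP; exact: measurable_normal_pdf.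
apply: ae_eq_integral => //.
- exact: emeasurable_funM.
- exact: emeasurable_funM.
have : ae_eq mu setT (Radon_Nikodym_SigmaFinite.f (normal_prob m s) mu)
    (fun x => (normal_pdf m s x)%:E).
  apply: integral_ae_eq => //.
  - exact: (Radon_Nikodym_SigmaFinite.f_integrable dom).
  - by move=> A _ mA; rewrite -(Radon_Nikodym_SigmaFinite.f_integral dom).
by apply: filterS => x /= h Tx; rewrite h.
Qed.

Lemma normal_pdf_convolution (b y t s : R) : t != 0 -> s != 0 ->
  (\int[normal_prob 0 s]_x (normal_pdf 0 t (b * x + y))%:E =
   (normal_pdf 0 (Num.sqrt (t ^+ 2 + (b * s) ^+ 2)) y)%:E)%E.
Proof.
move=> t0 s0; pose q := t ^+ 2 + (b * s) ^+ 2.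
have t20 : 0 < t ^+ 2 by rewrite exprn_even_gt0.
have s20 : 0 < s ^+ 2 by rewrite exprn_even_gt0.
have q0 : 0 < q by rewrite ltr_pwDl // sqr_ge0.
(* Completing the square in x: the product of the two densities is the density of N(m, s'^2) at x
   times that of N(0, q) at y, as for a Gaussian posterior. *)
pose s' := Num.sqrt (s ^+ 2 * t ^+ 2 / q).
have s'0 : s' != 0 by rewrite gt_eqF // sqrtr_gt0 divr_gt0 // mulr_gt0.
have s'2 : s' ^+ 2 = s ^+ 2 * t ^+ 2 / q.
  by rewrite sqr_sqrtr //; apply/ltW/divr_gt0 => //; exact: mulr_gt0.
have sq0 : Num.sqrt q != 0 by rewrite gt_eqF // sqrtr_gt0.
have sq2 : Num.sqrt q ^+ 2 = q by rewrite sqr_sqrtr // ltW.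
pose m := - (b * s ^+ 2 * y) / q.
have pu0 (u : R) : 0 < u -> 0 <= 2 * pi * u.
  by move=> u0; apply/ltW/mulr_gt0 => //; apply: mulr_gt0 => //; exact: pi_gt0.
rewrite ge0_integral_normal_prob; last 2 first.
- apply/measurable_EFinP; apply: (measurableT_comp (measurable_normal_pdf _ _)).
  by apply: measurable_funD => //; exact: measurable_funM.
- by move=> x; rewrite lee_fin normal_pdf_ge0.
transitivity (\int[mu]_x ((normal_pdf 0 (Num.sqrt q) y)%:E * (normal_pdf m s' x)%:E))%E.
  apply: eq_integral => x _; rewrite -!EFinM; congr EFin.
  rewrite !normal_pdf_expR // sq2 s'2 !subr0.
  rewrite mulrACA [RHS]mulrACA -!expRD -!invfM -!sqrtrM; last 2 first.
  - exact: pu0.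
  - exact: pu0.
  congr ((Num.sqrt _)^-1 * expR _).
    by field; rewrite gt_eqF.
  rewrite /m /q; field.
  by rewrite t0 s0 andbT /= -/q gt_eqF.
rewrite ge0_integralZl //.
- by rewrite integral_normal_pdf mule1.
- by apply/measurable_EFinP; exact: measurable_normal_pdf.
- by move=> x _; rewrite lee_fin normal_pdf_ge0.
- by rewrite lee_fin normal_pdf_ge0.
Qed.

End gaussian_integrals.

Section independent_normals.
Context d (T : measurableType d) (R : realType) (P : probability T R).
Variables (I : finType) (xi : I -> T -> R) (sd : I -> R).

Definition independent_normals : Prop :=
  forall A : I -> set R, (forall i, measurable (A i)) ->
  P [set w | forall i, A i (xi i w)] = (\prod_i normal_prob 0 (sd i) (A i))%E.

Hypothesis sd0 : forall i, 0 < sd i.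
Hypothesis mxi : forall i, measurable_fun setT (xi i).
Hypothesis ind : independent_normals.

(** Cylinder events that constrain only the coordinates in D. They form a pi-system, and disjoint D
    give independent families. *)
Definition coord_family (D : pred I) : set (set T) :=
  [set E | exists A : I -> set R, [/\ forall i, measurable (A i),
     forall i, ~~ D i -> A i = setT & E = [set w | forall i, A i (xi i w)]]].

Lemma coord_family_setI D : setI_closed (coord_family D).
Proof.
move=> _ _ [A [mA TA ->]] [B [mB TB ->]].
exists (fun i => A i `&` B i); split=> [i|i Di|].
- exact: measurableI.
- by rewrite TA // TB // setIT.
- by apply/seteqP; split=> w /=; [move=> [h1 h2] i | move=> h; split=> i; have [] := h i].
Qed.

Lemma coord_family_measurable D : coord_family D `<=` measurable.
Proof.
move=> _ [A [mA _ ->]].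
have -> : [set w | forall i, A i (xi i w)] = \bigcap_i (xi i @^-1` A i).
  by apply/seteqP; split=> w /= h i; [move=> _; exact: h | exact: h].
apply: fin_bigcap_measurable => // i _.
by rewrite -[X in measurable X]setTI; exact: mxi.
Qed.

Lemma coord_family_indep (D1 D2 : pred I) : (forall i, ~~ (D1 i && D2 i)) ->
  indep_families P (coord_family D1) (coord_family D2).
Proof.
move=> disj _ _ [A [mA TA ->]] [B [mB TB ->]].
rewrite !ind // -big_split /=.
have -> : [set w | forall i, A i (xi i w)] `&` [set w | forall i, B i (xi i w)] =
    [set w | forall i, (A i `&` B i) (xi i w)].
  by apply/seteqP; split=> w /=; [move=> [h1 h2] i | move=> h; split=> i; have [] := h i].
rewrite (ind (A := fun i => A i `&` B i)); last by move=> i; exact: measurableI.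
apply: eq_bigr => i _; have := disj i; rewrite negb_and => /orP[] Di.
  by rewrite TA // setTI probability_setT mul1e.
by rewrite TB // setIT probability_setT mule1.
Qed.

Lemma coord_sigma_indep (D1 D2 : pred I) : (forall i, ~~ (D1 i && D2 i)) ->
  indep_families P <<s coord_family D1 >> <<s coord_family D2 >>.
Proof.
move=> disj; apply: indep_sigma.
- exact: coord_family_setI.
- exact: coord_family_setI.
- exact: coord_family_measurable.
- exact: coord_family_measurable.
- exact: coord_family_indep.
Qed.

Lemma coord_sigma_measurable (D : pred I) i : D i ->
  measurable_fun setT (xi i : g_sigma_algebraType (coord_family D) -> R).
Proof.
move=> Di _ B mB; rewrite setTI; apply: sub_sigma_algebra.
exists (fun j => if j == i then B else setT); split=> [j|j Dj|].
- by case: ifP.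
- by case: eqVneq => // ji; rewrite -ji in Di; rewrite Di in Dj.
- apply/seteqP; split=> w /=; last by move=> /(_ i); rewrite eqxx.
  by move=> Bw j; case: eqVneq => // ->.
Qed.

Lemma measurable_sum_coord (D : pred I) (s : seq I) (b : I -> R) :
  (forall i, i \in s -> D i) ->
  measurable_fun setT (fun w : g_sigma_algebraType (coord_family D) =>
    \sum_(i <- s) b i * xi i w).
Proof.
elim: s => [|i s IH] h.
  by under eq_fun do rewrite big_nil; exact: measurable_cst.
under eq_fun do rewrite big_cons.
apply: measurable_funD.
  apply: measurable_funM => //; apply: coord_sigma_measurable.
  by apply: h; rewrite mem_head.
by apply: IH => j js; apply: h; rewrite in_cons js orbT.
Qed.

Lemma integral_coord i (f : R -> \bar R) : measurable_fun setT f ->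
  (forall x, 0 <= f x)%E ->
  (\int[P]_w f (xi i w) = \int[normal_prob 0 (sd i)]_x f x)%E.
Proof.
move=> mf f0.
pose X : {mfun T >-> measurableTypeR R} := HB.pack (xi i : T -> measurableTypeR R)
  (isMeasurableFun.Build _ _ _ _ (xi i : T -> measurableTypeR R) (mxi i)).
rewrite -(ge0_integral_distribution (X : {RV P >-> measurableTypeR R})) //.
apply: eq_measure_integral => A mA _; rewrite /distribution /pushforward /=.
have := ind (A := fun j => if j == i then A else setT).
have -> : [set w | forall j, (if j == i then A else setT) (xi j w)] = xi i @^-1` A.
  apply/seteqP; split=> w /=; first by move=> /(_ i); rewrite eqxx.
  by move=> Bw j; case: eqVneq => // ->.
move=> E; transitivity (P (xi i @^-1` A)) => //; rewrite E; last by move=> j; case: ifP.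
rewrite (bigD1 i) //= eqxx big1 ?mule1 // => j ji.
by rewrite (negbTE ji) probability_setT.
Qed.

(** Coordinates are integrated out one at a time: with the others frozen, the convolution identity
    adds (b i * sd i)^2 to the variance of the test density. Testing against normal densities lets
    this go through without computing the law of the sum. *)
Lemma expectation_normal_pdf_sum (s : seq I) (b : I -> R) (t c : R) : uniq s ->
  0 < t ->
  (\int[P]_w (normal_pdf 0 t (\sum_(i <- s) b i * xi i w + c))%:E =
  (normal_pdf 0 (Num.sqrt (t ^+ 2 + \sum_(i <- s) (b i * sd i) ^+ 2)) c)%:E)%E.
Proof.
elim: s t c => [|i s IH] t c us t0.
  under eq_integral do rewrite big_nil add0r.
  by rewrite integral_cst //= probability_setT mule1 big_nil addr0 sqrtr_sqr gtr0_norm.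
move: us => /= /andP[nis us].
pose D1 : pred I := pred1 i; pose D2 : pred I := mem s.
have disj j : ~~ (D1 j && D2 j).
  by apply/negP => /andP[/eqP->]; apply/negP.
pose f (z : g_sigma_algebraType (coord_family D1) * g_sigma_algebraType (coord_family D2))
  : \bar R := (normal_pdf 0 t (b i * xi i z.1 + (\sum_(j <- s) b j * xi j z.2 + c)))%:E.
transitivity (\int[P]_w f (w, w))%E.
  by apply: eq_integral => w _; rewrite /f /= big_cons addrA.
have mf : measurable_fun setT f.
  apply/measurable_EFinP; apply: (measurableT_comp (measurable_normal_pdf _ _)).
  apply: measurable_funD.
    apply: measurable_funM => //; apply: measurableT_comp => //.
    by apply: coord_sigma_measurable; exact: eqxx.
  apply: measurable_funD => //.
  by apply: (measurableT_comp (measurable_sum_coord b _)) => // j js; rewrite /D2 /= js.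
rewrite (decoupling _ _ (coord_sigma_indep disj) mf); last 3 first.
- exact: coord_family_measurable.
- exact: coord_family_measurable.
- by move=> z; rewrite lee_fin normal_pdf_ge0.
set t1 := Num.sqrt (t ^+ 2 + (b i * sd i) ^+ 2).
have q0 : 0 < t ^+ 2 + (b i * sd i) ^+ 2 by rewrite ltr_pwDl ?exprn_gt0 ?sqr_ge0.
transitivity (\int[P]_w (normal_pdf 0 t1 (\sum_(j <- s) b j * xi j w + c))%:E)%E.
  apply: eq_integral => w2 _; rewrite /f /=.
  rewrite (integral_coord i (f := fun x => (normal_pdf 0 t (b i * x + _))%:E)).
  - by rewrite normal_pdf_convolution ?gt_eqF.
  - apply/measurable_EFinP; apply: (measurableT_comp (measurable_normal_pdf _ _)).
    by apply: measurable_funD => //; exact: measurable_funM.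
  - by move=> x; rewrite lee_fin normal_pdf_ge0.
rewrite IH //; last by rewrite sqrtr_gt0.
by rewrite sqr_sqrtr ?big_cons ?addrA // ltW.
Qed.

End independent_normals.

Section gaussian_bounds.
Context d (T : measurableType d) (R : realType) (P : probability T R).

(* xi is centered Gaussian with variance v, expressed through the convolution
   of its law with normal densities. *)
Definition centered_gaussian (xi : T -> R) (v : R) : Prop :=
  [/\ measurable_fun setT xi, 0 <= v & forall t c : R, 0 < t ->
   (\int[P]_w (normal_pdf 0 t (xi w + c))%:E =
    (normal_pdf 0 (Num.sqrt (t ^+ 2 + v)) c)%:E)%E].

Lemma probability_integral_indic (A : set T) : measurable A ->
  P A = (\int[P]_w (\1_A w)%:E)%E.
Proof. by move=> mA; rewrite integral_indic // setIT. Qed.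

(** The integrand is a multiple of the normal density of variance 1 / (2 th), so the definition of
    [centered_gaussian] applies. *)
Lemma expectation_exp_sqr (xi : T -> R) (v c th : R) :
  centered_gaussian xi v -> 0 < th ->
  (\int[P]_w (expR (- (th * (xi w + c) ^+ 2)))%:E =
   (Num.sqrt (1 + 2 * th * v)^-1 * expR (- (c ^+ 2 * th / (1 + 2 * th * v))))%:E)%E.
Proof.
move=> [mxi v0 hxi] th0; pose t := Num.sqrt (2 * th)^-1.
have t0 : 0 < t by rewrite sqrtr_gt0 invr_gt0 mulr_gt0.
have t2 : t ^+ 2 = (2 * th)^-1 by rewrite sqr_sqrtr // invr_ge0 mulr_ge0 //; exact: ltW.
have q0 : 0 < 1 + 2 * th * v.
  by rewrite ltr_pwDl // !mulr_ge0 //; exact: ltW.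
have p0 (s : R) : 0 < s -> 0 < 2 * pi * s.
  by move=> s0; rewrite !mulr_gt0 ?pi_gt0.
have qt : t ^+ 2 + v = (1 + 2 * th * v) / (2 * th).
  by rewrite t2; field; rewrite gt_eqF.
pose C := Num.sqrt (2 * pi * t ^+ 2).
have C0 : C != 0 by rewrite gt_eqF // sqrtr_gt0 p0 // exprn_gt0.
transitivity (\int[P]_w (C%:E * (normal_pdf 0 t (xi w + c))%:E))%E.
  apply: eq_integral => w _; rewrite -EFinM; congr EFin.
  rewrite normal_pdf_expR ?gt_eqF // subr0 -/C [RHS]mulrA mulfV // mul1r t2.
  by congr (expR (- _)); field; rewrite gt_eqF.
rewrite ge0_integralZl //; last 3 first.
- apply/measurable_EFinP.
  by apply: (measurableT_comp (measurable_normal_pdf _ _)); exact: measurable_funD.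
- by move=> w _; rewrite lee_fin normal_pdf_ge0.
- by rewrite lee_fin sqrtr_ge0.
rewrite hxi // -EFinM; congr EFin.
have tv0 : 0 < t ^+ 2 + v by rewrite ltr_pwDl // exprn_gt0.
rewrite normal_pdf_expR ?gt_eqF ?sqrtr_gt0 // subr0 sqr_sqrtr; last exact: ltW.
rewrite mulrA /C -sqrtrV; last by rewrite ltW // p0.
rewrite -sqrtrM; last by rewrite ltW // p0 // exprn_gt0.
congr (Num.sqrt _ * expR (- _)).
- rewrite qt t2; move: (pi_gt0 R); generalize (pi : R) => p pp; field.
  by rewrite !gt_eqF.
- by rewrite qt; field; rewrite !gt_eqF.
Qed.

Lemma measurable_exp_sqr (xi : T -> R) (c th : R) : measurable_fun setT xi ->
  measurable_fun setT (fun w => expR (- (th * (xi w + c) ^+ 2))).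
Proof.
move=> mxi; apply: measurableT_comp => //; apply: measurableT_comp => //.
by apply: measurable_funM => //; apply: measurable_funX; exact: measurable_funD.
Qed.

Lemma expR_half_bounds : 1 / 2 <= expR (- (1 / 2) : R) <= 2 / 3.
Proof.
have h1 : 1 + 1 / 2 <= expR (1 / 2) :> R by exact: expR_ge1Dx.
have h2 : 1 + - (1 / 2) <= expR (- (1 / 2)) :> R by exact: expR_ge1Dx.
rewrite (le_trans _ h2) /=; last by lra.
rewrite expRN -[leRHS]invrK lef_pV2 ?posrE ?expR_gt0 ?invr_gt0 //.
by apply: le_trans h1; lra.
Qed.

Lemma measurable_sqr_le (xi : T -> R) (c K : R) : measurable_fun setT xi ->
  measurable [set w | (xi w + c) ^+ 2 <= K].
Proof.
move=> mxi; rewrite (_ : [set w | _] = ~` [set w | - (xi w + c) ^+ 2 < - K]).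
  apply: measurableC; apply: measurable_lt_cst; apply: measurableT_comp => //.
  by apply: measurable_funX; exact: measurable_funD.
by apply/seteqP; split=> w /=; rewrite ltrN2; [move=> h; apply/negP; rewrite -leNgt
  | move/negP; rewrite -leNgt].
Qed.

(** With th = 1 / (2K) the indicator is at most 2 exp(- th (xi + c)^2), as exp(-1/2) >= 1/2. The
    shift c only lowers the expectation, which is at most (1 + v / K)^(-1/2). *)
Lemma centered_gaussian_anticoncentration (xi : T -> R) (v c K : R) :
  centered_gaussian xi v -> 0 < v -> 0 < K ->
  (P [set w | ((xi w + c) ^+ 2 <= K)%R] <= (2 * Num.sqrt (K / v))%:E)%E.
Proof.
move=> gxi v0 K0; have [mxi _ _] := gxi; pose th := (2 * K)^-1.
have th0 : 0 < th by rewrite invr_gt0 mulr_gt0.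
rewrite probability_integral_indic; last exact: measurable_sqr_le.
apply: (@le_trans _ _ (\int[P]_w (2%:E * (expR (- (th * (xi w + c) ^+ 2)))%:E))%E).
  apply: ge0_le_integral => //.
  - by apply/measurable_EFinP/measurable_indic; exact: measurable_sqr_le.
  - by apply/measurable_EFinP/measurable_funM => //; exact: measurable_exp_sqr.
  - move=> w _; rewrite -EFinM lee_fin indicE; case: (boolP (w \in _)); last first.
      by move=> _; rewrite mulr_ge0 // expR_ge0.
    move=> /set_mem /= hw; have /andP[h1 _] := expR_half_bounds.
    have : expR (- (1 / 2)) <= expR (- (th * (xi w + c) ^+ 2)).
      rewrite ler_expR lerN2 /th mulrC ler_pdivrMr ?mulr_gt0 //; lra.
    lra.
rewrite ge0_integralZl //; last first.
  by apply/measurable_EFinP; exact: measurable_exp_sqr.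
rewrite (expectation_exp_sqr _ gxi) // -EFinM lee_fin ler_wpM2l //.
have q0 : 0 < 1 + 2 * th * v by rewrite ltr_pwDl // !mulr_ge0 //; exact: ltW.
apply: (@le_trans _ _ (Num.sqrt (1 + 2 * th * v)^-1)).
  rewrite ler_piMr ?sqrtr_ge0 // -[leRHS]expR0 ler_expR oppr_le0.
  by apply: divr_ge0; [apply: mulr_ge0; [exact: sqr_ge0 | exact: ltW] | exact: ltW].
have Kv0 : 0 < K / v by exact: divr_gt0.
apply: ler_wsqrtr; rewrite -[leRHS]invrK lef_pV2 ?posrE ?invr_gt0 //.
have -> : (K / v)^-1 = 2 * th * v by rewrite /th; field; rewrite !gt_eqF.
by rewrite lerDr.
Qed.

(** This bounded functional stands in for the second moment E xi^2 = v. The inequality is 1 -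
    q^(-1/2) <= 1 - 1/q <= q - 1 with q = 1 + 2 th v. *)
Lemma centered_gaussian_exp_moment (xi : T -> R) (v th : R) :
  centered_gaussian xi v -> 0 < th ->
  (\int[P]_w (1 - expR (- (th * xi w ^+ 2)))%:E <= (2 * th * v)%:E)%E.
Proof.
move=> gxi th0; have [mxi v0 _] := gxi.
have q0 : 0 < 1 + 2 * th * v by rewrite ltr_pwDl // !mulr_ge0 //; exact: ltW.
have E w : expR (- (th * xi w ^+ 2)) = expR (- (th * (xi w + 0) ^+ 2)) by rewrite addr0.
have mE : measurable_fun setT (fun w => expR (- (th * xi w ^+ 2))).
  by under eq_fun do rewrite E; exact: measurable_exp_sqr.
have I1 : (\int[P]_w (expR (- (th * xi w ^+ 2)))%:E = (Num.sqrt (1 + 2 * th * v)^-1)%:E)%E.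
  under eq_integral do rewrite E.
  by rewrite (expectation_exp_sqr _ gxi) // expr0n /= !mul0r oppr0 expR0 mulr1.
have e1 w : expR (- (th * xi w ^+ 2)) <= 1.
  by rewrite -[leRHS]expR0 ler_expR oppr_le0; apply: mulr_ge0; [exact: ltW | exact: sqr_ge0].
have int1 : P.-integrable setT (fun w => (expR (- (th * xi w ^+ 2)))%:E).
  apply/integrableP; split; first exact/measurable_EFinP.
  under eq_integral do rewrite /= ger0_norm ?expR_ge0 //.
  by rewrite I1 ltry.
under eq_integral do rewrite EFinB.
rewrite integralB //; last first.
  exact: finite_measure_integrable_cst.
rewrite I1 integral_cst //= probability_setT mule1 -EFinB lee_fin.
set q := 1 + _ in q0 *.
have qi : q^-1 <= Num.sqrt q^-1.
  have qi0 : 0 <= q^-1 by rewrite invr_ge0 ltW.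
  rewrite -[leLHS](sqr_sqrtr qi0) expr2 ler_piMr ?sqrtr_ge0 //.
  rewrite -[leRHS]sqrtr1; apply: ler_wsqrtr; rewrite invf_le1 // lerDl.
  by apply: mulr_ge0 => //; apply: mulr_ge0 => //; exact: ltW.
have : 1 - q^-1 <= 2 * th * v.
  have -> : 1 - q^-1 = 2 * th * v / q by rewrite /q; field; rewrite -/q gt_eqF.
  have tv0 : 0 <= 2 * th * v.
    by apply: mulr_ge0 => //; apply: mulr_ge0 => //; exact: ltW.
  by rewrite ler_piMr ?invf_le1 ?lerDl.
lra.
Qed.

(** Chebyshev through the previous bound with th = 1 / (2 x^2); the factor 3 comes from 1 -
    exp(-1/2) >= 1/3. *)
Lemma centered_gaussian_tail (xi : T -> R) (v x : R) :
  centered_gaussian xi v -> 0 < x ->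
  (P [set w | (x <= `|xi w|)%R] <= (3 * v / x ^+ 2)%:E)%E.
Proof.
move=> gxi x0; have [mxi v0 _] := gxi; pose th := (2 * x ^+ 2)^-1.
have x20 : 0 < x ^+ 2 by rewrite exprn_gt0.
have th0 : 0 < th by rewrite invr_gt0 mulr_gt0.
have mA : measurable [set w | x <= `|xi w|].
  rewrite (_ : [set w | _] = ~` [set w | `|xi w| < x]).
    by apply: measurableC; apply: measurable_lt_cst; exact: measurableT_comp.
  by apply/seteqP; split=> w /=; [move=> h; apply/negP; rewrite -leNgt
    | move/negP; rewrite -leNgt].
rewrite probability_integral_indic //.
apply: (@le_trans _ _ (\int[P]_w (3%:E * (1 - expR (- (th * xi w ^+ 2)))%:E))%E).
  apply: ge0_le_integral => //.
  - exact/measurable_EFinP/measurable_indic.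
  - apply/measurable_EFinP/measurable_funM => //; apply: measurable_funB => //.
    have := measurable_exp_sqr 0 th mxi.
    by apply: eq_measurable_fun => w _; rewrite addr0.
  - move=> w _; rewrite -EFinM lee_fin indicE.
    have hle : expR (- (th * xi w ^+ 2)) <= 1.
      by rewrite -[leRHS]expR0 ler_expR oppr_le0; apply: mulr_ge0; [exact: ltW | exact: sqr_ge0].
    case: (boolP (w \in _)); last by move=> _ /=; lra.
    move=> /set_mem /= hw; have /andP[_ h2] := expR_half_bounds.
    have : expR (- (th * xi w ^+ 2)) <= expR (- (1 / 2)).
      rewrite ler_expR lerN2 /th [leRHS]mulrC ler_pdivlMr ?mulr_gt0 //.
      have : x ^+ 2 <= xi w ^+ 2 by rewrite -(real_normK (num_real (xi w))) lerXn2r ?nnegrE //; exact: ltW.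
      lra.
    lra.
rewrite ge0_integralZl //; last 2 first.
- apply/measurable_EFinP; apply: measurable_funB => //.
  have := measurable_exp_sqr 0 th mxi.
  by apply: eq_measurable_fun => w _; rewrite addr0.
- move=> w _; rewrite lee_fin subr_ge0.
  by rewrite -[leRHS]expR0 ler_expR oppr_le0; apply: mulr_ge0; [exact: ltW | exact: sqr_ge0].
apply: (@le_trans _ _ (3%:E * (2 * th * v)%:E)%E).
  by apply: lee_wpmul2l => //; exact: centered_gaussian_exp_moment.
rewrite -EFinM lee_fin /th.
have -> : 3 * (2 * (2 * x ^+ 2)^-1 * v) = 3 * v / x ^+ 2 by field; rewrite gt_eqF.
by [].
Qed.

End gaussian_bounds.

(** * Step functions and integrals against Brownian motion *)

Section partitions.
Variable R : realType.

Definition subdivision (a b : R) (m : nat) (u : nat -> R) : Prop :=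
  [/\ u 0%N = a, u m = b & forall i, (i < m)%N -> u i < u i.+1].

Lemma subdivision_lt a b m u : subdivision a b m u ->
  forall i j, (i < j)%N -> (j <= m)%N -> u i < u j.
Proof.
move=> [_ _ inc] i; elim=> [//|j IH]; rewrite ltnS leq_eqVlt => /orP[/eqP-> jm|ij jm].
  exact: inc.
by apply: lt_trans (inc _ jm); apply: IH => //; exact: ltnW.
Qed.

Lemma subdivision_le a b m u : subdivision a b m u ->
  forall i j, (i <= j)%N -> (j <= m)%N -> u i <= u j.
Proof.
move=> su i j; rewrite leq_eqVlt => /orP[/eqP-> //|ij jm].
exact: ltW (subdivision_lt su ij jm).
Qed.

(** A fine uniform grid merged with the prescribed points, sorted without repetition. Prescribing
    nodes matters because jumps of step functions and edges of blocks must fall on them. *)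
Lemma subdivision_exists (a b e : R) (pts : seq R) : a < b -> 0 < e ->
  (forall x, x \in pts -> a <= x <= b) ->
  exists m u, [/\ subdivision a b m u, forall i, (i < m)%N -> u i.+1 - u i <= e
     & forall x, x \in pts -> exists2 i, (i <= m)%N & u i = x].
Proof.
move=> ab e0 hpts; have ba0 : 0 < b - a by rewrite subr_gt0.
have [N hN] : exists N, (b - a) / e < N.+1%:R.
  exists (Num.truncn ((b - a) / e)); have := truncn_itv (ltW (divr_gt0 ba0 e0)).
  by case/andP.
have N0 : 0 < N.+1%:R :> R by [].
pose g k : R := a + (b - a) * (k%:R / N.+1%:R).
pose pt := [seq g k | k <- iota 0 N.+2] ++ pts.
have gab k : (k <= N.+1)%N -> a <= g k <= b.
  move=> kN; have kN1 : k%:R / N.+1%:R <= 1 :> R by rewrite ler_pdivrMr // mul1r ler_nat.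
  have kN0 : 0 <= k%:R / N.+1%:R :> R by rewrite divr_ge0.
  move: kN1 kN0; rewrite /g; generalize (k%:R / N.+1%:R : R) => z z1 z0.
  by apply/andP; split; nra.
have ptab x : x \in pt -> a <= x <= b.
  rewrite mem_cat => /orP[/mapP[k]|/hpts //].
  by rewrite mem_iota add0n ltnS /= => kN ->; exact: gab.
pose s := sort <=%R (undup pt).
have ms x : (x \in s) = (x \in pt) by rewrite mem_sort mem_undup.
have ss : sorted <%R s.
  by rewrite lt_sorted_uniq_le sort_uniq undup_uniq; exact: sort_le_sorted.
have as_ : a \in s.
  rewrite ms mem_cat; apply/orP; left; apply/mapP; exists 0%N; first by rewrite mem_iota.
  by rewrite /g mul0r mulr0 addr0.
have bs : b \in s.
  rewrite ms mem_cat; apply/orP; left; apply/mapP; exists N.+1.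
    by rewrite mem_iota add0n /= ltnS.
  by rewrite /g divff ?gt_eqF // mulr1 subrKC.
have s0 : (0 < size s)%N by rewrite -has_predT; apply/hasP; exists a.
pose u i := nth 0 s i; pose m := (size s).-1.
have mE : size s = m.+1 by rewrite prednK.
have ult i j : (i < j)%N -> (j <= m)%N -> u i < u j.
  move=> ij jm; apply: (sorted_ltn_nth lt_trans 0 ss) => //; rewrite inE mE ltnS //.
  exact: leq_trans (ltnW ij) jm.
have ule i j : (i <= j)%N -> (j <= m)%N -> u i <= u j.
  by rewrite leq_eqVlt => /orP[/eqP-> //|ij] jm; exact/ltW/ult.
have us i : (i <= m)%N -> u i \in s by move=> im; rewrite mem_nth // mE ltnS.
have ix x : x \in s -> exists2 i, (i <= m)%N & u i = x.
  by move=> xs; exists (index x s); [rewrite -ltnS -mE index_mem | exact: nth_index].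
have uab i : (i <= m)%N -> a <= u i <= b by move=> im; apply: ptab; rewrite -ms us.
exists m, u; split.
- split=> [||i im].
  + have [i im ui] := ix _ as_; apply/le_anti.
    have /andP[-> _] := uab 0%N isT; rewrite andbT -ui; exact: ule.
  + have [i im ui] := ix _ bs; apply/le_anti.
    have /andP[_ ->] := uab m (leqnn m); rewrite -ui; exact: ule.
  + exact: ult.
- move=> i im; rewrite leNgt; apply/negP => big.
  have /andP[ai ib] := uab i (ltnW im).
  have /andP[_ i1b] := uab i.+1 im.
  (* [y] is the position of u i in units of the uniform grid. In a gap longer than e the next grid
     node would lie strictly inside, although it is one of the u j. *)
  pose y := (u i - a) * N.+1%:R / (b - a).
  have y0 : 0 <= y by rewrite /y divr_ge0 ?mulr_ge0 ?subr_ge0 //; exact: ltW.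
  have /andP[ky yk] := truncn_itv y0; set k := Num.truncn y in ky yk.
  pose c := (b - a) / N.+1%:R.
  have c0 : 0 < c by rewrite divr_gt0.
  have gE l : g l = a + l%:R * c by rewrite /g /c mulrCA mulrA.
  have ui : u i = a + y * c.
    by rewrite /y /c mulrA divfK ?mulfK ?subrKC // gt_eqF.
  have ce : c < e by rewrite /c ltr_pdivrMr // mulrC -ltr_pdivrMr.
  have cN : N.+1%:R * c = b - a by rewrite /c mulrC divfK // gt_eqF.
  have ugk : u i < g k.+1 by rewrite gE ui ltrD2l ltr_pM2r.
  have gku : g k.+1 < u i.+1.
    have : k%:R * c <= y * c by rewrite ler_wpM2r // ltW.
    by move: ui; rewrite gE -natr1 mulrDl mul1r; lra.
  have kN : (k.+1 <= N.+1)%N.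
    rewrite ltnNge; apply/negP => Nk.
    have h1 : N.+1%:R * c <= k%:R * c by rewrite ler_wpM2r ?ler_nat // ltW.
    have h2 : k%:R * c <= y * c by rewrite ler_wpM2r // ltW.
    by move: (ult i i.+1 (ltnSn i) im); lra.
  have [j jm uj] : exists2 j, (j <= m)%N & u j = g k.+1.
    apply: ix; rewrite ms mem_cat; apply/orP; left; apply/mapP; exists k.+1 => //.
    by rewrite mem_iota add0n ltnS.
  rewrite -uj in ugk gku.
  have [ji|ij] := leqP j i.
    by have := lt_le_trans ugk (ule _ _ ji (ltnW im)); rewrite ltxx.
  by have := lt_le_trans gku (ule _ _ ij jm); rewrite ltxx.
- by move=> x xp; apply: ix; rewrite ms mem_cat xp orbT.
Qed.

End partitions.

Section step_functions.
Variable R : realType.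
Local Notation mu := (@lebesgue_measure R).

Definition step_points (s : seq (R * R * R)) : seq R :=
  flatten [seq [:: q.1.1; q.1.2] | q <- s].

Definition adapted_to (m : nat) (u : nat -> R) (s : seq (R * R * R)) : Prop :=
  forall x, x \in step_points s -> exists2 i, (i <= m)%N & u i = x.

Lemma step_points_in (a b : R) s x : step_in a b s -> x \in step_points s -> a <= x <= b.
Proof.
move=> /allP hs /flattenP[_ /mapP[q qs ->]].
have /and3P[h1 h2 h3] := hs q qs.
rewrite !inE => /orP[] /eqP ->; first by rewrite h1 (le_trans h2).
by rewrite h3 andbT (le_trans h1).
Qed.

Lemma indic_itv_oc (a b x : R) : \1_(`]a, b]) x = (a < x <= b)%R%:R :> R.
Proof. by rewrite indicE mem_setE in_itv. Qed.

Lemma step_fun_cons q s (x : R) :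
  step_fun (q :: s) x = q.2 * (q.1.1 < x <= q.1.2)%R%:R + step_fun s x.
Proof. by rewrite /step_fun big_cons indic_itv_oc. Qed.

Lemma step_fun_cat s1 s2 (x : R) : step_fun (s1 ++ s2) x = step_fun s1 x + step_fun s2 x.
Proof. by rewrite /step_fun big_cat. Qed.

Lemma step_int_cat (T : Type) (Z : R -> T -> R) s1 s2 w :
  step_int Z (s1 ++ s2) w = step_int Z s1 w + step_int Z s2 w.
Proof. by rewrite /step_int big_cat. Qed.

Definition scale_steps (c : R) (s : seq (R * R * R)) := [seq (q.1, c * q.2) | q <- s].

Lemma step_fun_scale c s (x : R) : step_fun (scale_steps c s) x = c * step_fun s x.
Proof.
by rewrite /step_fun /scale_steps big_map mulr_sumr; apply: eq_bigr => q _; rewrite mulrA.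
Qed.

Lemma step_int_scale (T : Type) (Z : R -> T -> R) c s w :
  step_int Z (scale_steps c s) w = c * step_int Z s w.
Proof.
by rewrite /step_int /scale_steps big_map mulr_sumr; apply: eq_bigr => q _; rewrite mulrA.
Qed.

Lemma step_in_scale (a b c : R) s : step_in a b (scale_steps c s) = step_in a b s.
Proof. by rewrite /step_in /scale_steps all_map. Qed.

Lemma step_in_cat (a b : R) s1 s2 : step_in a b (s1 ++ s2) = step_in a b s1 && step_in a b s2.
Proof. by rewrite /step_in all_cat. Qed.

Lemma step_inS (a b a' b' : R) s : a' <= a -> b <= b' -> step_in a b s -> step_in a' b' s.
Proof.
move=> aa bb /allP hs; apply/allP => q /hs /and3P[h1 h2 h3].
by rewrite h2 (le_trans aa) // (le_trans h3).
Qed.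

Lemma step_fun_out (a b : R) s x : step_in a b s -> ~~ (a < x <= b) -> step_fun s x = 0.
Proof.
elim: s => [|q s IH]; first by rewrite /step_fun big_nil.
move=> /= /andP[/and3P[h1 h2 h3] hs] hx.
rewrite step_fun_cons IH // addr0 [X in _ * (nat_of_bool X)%:R](_ : _ = false) ?mulr0 //.
apply: contraNF hx => /andP[h4 h5].
by rewrite (le_lt_trans h1 h4) (le_trans h5 h3).
Qed.

Lemma measurable_step_fun s : measurable_fun setT (step_fun s : R -> R).
Proof.
elim: s => [|q s IH].
  rewrite (_ : step_fun _ = cst 0) //.
  by apply/funext => x; rewrite /step_fun big_nil.
rewrite (_ : step_fun _ = (fun x => q.2 * \1_(`]q.1.1, q.1.2]) x + step_fun s x)).
  by apply: measurable_funD => //; apply: measurable_funM.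
by apply/funext => x; rewrite /step_fun big_cons.
Qed.

Section subdivided.
Variables (a b : R) (m : nat) (u : nat -> R).
Hypothesis su : subdivision a b m u.

Lemma subdivision_ltE i j : (i <= m)%N -> (j <= m)%N -> (u i < u j) = (i < j)%N.
Proof.
move=> im jm; case: ltnP => [ij|ji]; first exact: (subdivision_lt su).
by apply/negbTE; rewrite -leNgt; exact: (subdivision_le su).
Qed.

Lemma subdivision_leE i j : (i <= m)%N -> (j <= m)%N -> (u i <= u j) = (i <= j)%N.
Proof. by move=> im jm; rewrite leNgt subdivision_ltE // -leqNgt. Qed.

Lemma sum_indic_increments (F : nat -> R) j k : (j <= k)%N -> (k <= m)%N ->
  \sum_(i < m) (u j < u i.+1 <= u k)%R%:R * (F i.+1 - F i) = F k - F j.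
Proof.
move=> jk km.
transitivity (\sum_(i < m | (j <= i < k)%N) (F i.+1 - F i)).
  rewrite [RHS]big_mkcond /=; apply: eq_bigr => i _.
  rewrite subdivision_ltE ?subdivision_leE ?ltnS //; last exact: leq_trans jk km.
  by case: ifP => _; rewrite ?mul1r ?mul0r.
rewrite -(telescope_sumr _ jk) big_geq_mkord (big_ord_widen_cond m (fun i => (j <= i)%N) (fun i => F i.+1 - F i)) //.
Qed.

(** Several step integrals become linear combinations of one common family of increments, to which
    independence applies. *)
Lemma step_int_subdivision (T : Type) (Z : R -> T -> R) s w :
  all (fun q : R * R * R => q.1.1 <= q.1.2) s -> adapted_to m u s ->
  step_int Z s w = \sum_(i < m) step_fun s (u i.+1) * (Z (u i.+1) w - Z (u i) w).
Proof.
elim: s => [|q s IH].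
  by move=> _ _; rewrite /step_int big_nil big1 // => i _; rewrite /step_fun big_nil mul0r.
move=> /= /andP[qle hs] ad.
have [j jm uj] := ad q.1.1 (mem_head _ _).
have [k km uk] : exists2 i, (i <= m)%N & u i = q.1.2.
  by apply: ad; rewrite /= inE mem_head orbT.
have jk : (j <= k)%N by rewrite -subdivision_leE // uj uk.
rewrite [LHS]/step_int big_cons -/(step_int Z s w) IH //; last first.
  by move=> x xs; apply: ad; rewrite /step_points /= !inE xs !orbT.
under [RHS]eq_bigr do rewrite step_fun_cons mulrDl -mulrA.
rewrite big_split /= -mulr_sumr; congr (_ * _ + _).
by rewrite -uj -uk (sum_indic_increments (fun i => Z (u i) w) jk km).
Qed.

Lemma step_fun_cell s x i : adapted_to m u s -> (i < m)%N -> u i < x <= u i.+1 ->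
  step_fun s x = step_fun s (u i.+1).
Proof.
move=> + im /andP[ux xu]; elim: s => [|q s IH] ad.
  by rewrite /step_fun !big_nil.
have [j jm uj] := ad q.1.1 (mem_head _ _).
have [k km uk] : exists2 i, (i <= m)%N & u i = q.1.2.
  by apply: ad; rewrite /= inE mem_head orbT.
rewrite !step_fun_cons IH; last first.
  by move=> y ys; apply: ad; rewrite /step_points /= !inE ys !orbT.
congr (_ * (_ && _)%:R + _); rewrite -?uj -?uk.
- rewrite subdivision_ltE // ltnS; apply/idP/idP => [h|ji].
    by rewrite -ltnS -subdivision_ltE // (lt_le_trans h).
  by apply: le_lt_trans ux; rewrite subdivision_leE // ltnW.
- rewrite subdivision_leE //; apply/idP/idP => [h|ik].
    by rewrite -(subdivision_ltE (ltnW im) km) (lt_le_trans ux).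
  by apply: (le_trans xu); rewrite subdivision_leE.
Qed.

Lemma integral_cell_constant (g : R -> R) : measurable_fun setT g ->
  (forall x, 0 <= g x) ->
  (forall i x, (i < m)%N -> u i < x <= u i.+1 -> g x = g (u i.+1)) ->
  (\int[mu]_(x in `[a, b]) (g x)%:E =
   (\sum_(i < m) g (u i.+1) * (u i.+1 - u i))%:E)%E.
Proof.
move=> mg g0 gc.
transitivity (\int[mu]_(x in `[a, b]) \sum_(i < m) ((g (u i.+1))%:E * (\1_(`]u i, u i.+1]) x)%:E))%E.
  under [RHS]eq_integral do
    (under eq_bigr do rewrite -EFinM; rewrite sumEFin).
  apply: eq_integral_itv_bounded.
  - exact: measurable_funTS.
  - apply: measurable_funTS; apply: measurable_sum => i.
    exact: measurable_funM.
  - move=> x; rewrite in_itv /= => /andP[ax xb].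
    have [i im /andP[ui iu]] : exists2 i, (i < m)%N & u i < x <= u i.+1.
      have [u0 um _] := su.
      have ex : exists i, (x <= u i) && (i <= m)%N by exists m; rewrite um ltW /=.
      case: (ex_minnP ex) => -[|i] /andP[xi im] hi.
        by move: xi; rewrite u0 leNgt ax.
      exists i => //; rewrite xi andbT ltNge; apply/negP => h.
      by have := hi i; rewrite h ltnW // ltnn => /(_ isT).
    rewrite (bigD1 (Ordinal im)) //= big1 ?addr0.
      by rewrite indic_itv_oc ui iu mulr1; apply: gc; rewrite ?ui.
    move=> j ji; rewrite indic_itv_oc [X in _ * (nat_of_bool X)%:R](_ : _ = false) ?mulr0 //.
    apply: contraNF ji => /andP[jx xj]; apply/eqP/val_inj => /=.
    have h1 : (j < i.+1)%N.
      by rewrite -(subdivision_ltE (ltnW (ltn_ord j)) im) (lt_le_trans jx iu).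
    have h2 : (i < j.+1)%N.
      by rewrite -(subdivision_ltE (ltnW im) (ltn_ord j)) (lt_le_trans ui xj).
    by apply/eqP; rewrite eqn_leq -ltnS h1 -ltnS h2.
rewrite ge0_integral_sum //; last 2 first.
- move=> i; apply/measurable_EFinP/measurable_funTS.
  exact: measurable_funM.
- by move=> i x _; rewrite -EFinM lee_fin mulr_ge0.
rewrite -sumEFin; apply: eq_bigr => i _.
rewrite ge0_integralZl //; last 2 first.
- exact/measurable_EFinP/measurable_funTS.
- by rewrite lee_fin.
rewrite integral_indic //= setIidl; last first.
  move=> x /=; rewrite !in_itv /= => /andP[h1 h2].
  have [u0 um _] := su; rewrite -u0 -um.
  by rewrite (le_trans (subdivision_le su (leq0n i) _) (ltW h1)) ?(le_trans h2) ?(subdivision_le su) // ltnW.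
by rewrite lebesgue_measure_itv /= lte_fin (subdivision_ltE (ltnW (ltn_ord i)) (ltn_ord i)) ltnSn.
Qed.

End subdivided.
End step_functions.

Section brownian.
Context d (T : measurableType d) (R : realType) (P : probability T R).
Variables (q : nat) (B : R -> T -> 'cV[R]_q).
Hypothesis bmB : brownian_motion P B.
Local Notation mu := (@lebesgue_measure R).

Definition multi_step_int (st : 'I_q -> seq (R * R * R)) (w : T) : R :=
  \sum_k step_int (fun s w => B s w k 0) (st k) w.

Section subdivided.
Variables (m : nat) (u : nat -> R).
Hypothesis su : subdivision 0 1 m u.

Definition increment (ik : 'I_m * 'I_q) (w : T) : R :=
  B (u ik.1.+1) w ik.2 0 - B (u ik.1) w ik.2 0.
Definition increment_sd (ik : 'I_m * 'I_q) : R := Num.sqrt (u ik.1.+1 - u ik.1).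

Lemma subdivision01 i : (i <= m)%N -> 0 <= u i <= 1.
Proof.
move=> im; have [u0 um _] := su.
by rewrite -{1}u0 -um !(subdivision_le su).
Qed.

Lemma increment_sd_gt0 ik : 0 < increment_sd ik.
Proof. by have [_ _ inc] := su; rewrite sqrtr_gt0 subr_gt0 inc. Qed.

Lemma increment_sd2 ik : increment_sd ik ^+ 2 = u ik.1.+1 - u ik.1.
Proof. by have [_ _ inc] := su; rewrite sqr_sqrtr // subr_ge0 ltW // inc. Qed.

Lemma measurable_increment ik : measurable_fun setT (increment ik).
Proof.
have [mB _ _ _] := bmB.
apply: measurable_funB; apply: mB; apply: subdivision01 => //.
exact: ltnW.
Qed.

Lemma increments_independent : independent_normals P increment increment_sd.
Proof.
move=> A mA; have [_ _ _ h] := bmB; have [u0 um inc] := su.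
have -> : [set w | forall ik, A ik (increment ik w)] =
  [set w | forall i k, A (i, k) (B (u i.+1) w k 0 - B (u i) w k 0)].
  by apply/seteqP; split=> w /= hw; [move=> i k; exact: (hw (i, k)) | move=> [i k]; exact: hw].
rewrite (h m u (fun i k => A (i, k))) ?u0 ?um //.
by rewrite pair_bigA /=; apply: eq_bigr => -[].
Qed.

Lemma increments_gaussian (b : 'I_m * 'I_q -> R) :
  centered_gaussian P (fun w => \sum_(ik : 'I_m * 'I_q) b ik * increment ik w)
    (\sum_(ik : 'I_m * 'I_q) b ik ^+ 2 * (u ik.1.+1 - u ik.1)).
Proof.
have E : \sum_(ik : 'I_m * 'I_q) b ik ^+ 2 * (u ik.1.+1 - u ik.1) = \sum_(ik : 'I_m * 'I_q) (b ik * increment_sd ik) ^+ 2.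
  by apply: eq_bigr => ik _; rewrite exprMn increment_sd2.
split=> [||t c t0].
- apply: measurable_sum => ik; apply: measurable_funM => //.
  exact: measurable_increment.
- by rewrite E; apply: sumr_ge0 => ik _; exact: sqr_ge0.
- rewrite E; apply: (expectation_normal_pdf_sum increment_sd_gt0) => //.
  + exact: measurable_increment.
  + exact: increments_independent.
  + exact: index_enum_uniq.
Qed.

Lemma step_in_ordered (a b : R) s : step_in a b s ->
  all (fun q : R * R * R => q.1.1 <= q.1.2) s.
Proof. by apply: sub_all => p /and3P[]. Qed.

Lemma multi_step_int_increments (st : 'I_q -> seq (R * R * R)) w :
  (forall k, step_in 0 1 (st k)) -> (forall k, adapted_to m u (st k)) ->
  multi_step_int st w = \sum_(ik : 'I_m * 'I_q) step_fun (st ik.2) (u ik.1.+1) * increment ik w.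
Proof.
move=> hst ad; rewrite /multi_step_int.
under eq_bigr do rewrite (step_int_subdivision su _ _ (step_in_ordered (hst _)) (ad _)).
rewrite exchange_big pair_bigA /=.
by apply: eq_bigr => -[].
Qed.

Lemma step_fun_integral_sqr (F : 'I_q -> R -> R) :
  (forall k, measurable_fun setT (F k)) ->
  (forall k i x, (i < m)%N -> u i < x <= u i.+1 -> F k x = F k (u i.+1)) ->
  (\sum_k \int[mu]_(x in `[0%R, 1%R]) (F k x ^+ 2)%:E =
  (\sum_(ik : 'I_m * 'I_q) F ik.2 (u ik.1.+1) ^+ 2 * (u ik.1.+1 - u ik.1))%:E)%E.
Proof.
move=> mF Fc.
have E k : (\int[mu]_(x in `[0%R, 1%R]) (F k x ^+ 2)%:E =
    (\sum_(i < m) F k (u i.+1) ^+ 2 * (u i.+1 - u i))%:E)%E.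
  rewrite (integral_cell_constant su (g := fun x => F k x ^+ 2)) //.
  - exact: measurable_funX.
  - by move=> x; exact: sqr_ge0.
  - by move=> i x im hx; rewrite (Fc k i x).
under eq_bigr do rewrite E.
by rewrite sumEFin exchange_big pair_bigA.
Qed.

End subdivided.

Lemma adapted_subdivision (L : seq (seq (R * R * R))) :
  (forall s, s \in L -> step_in 0 1 s) ->
  exists m u, subdivision 0 1 m u /\ forall s, s \in L -> adapted_to m u s.
Proof.
move=> hL; have [|m [u [su _ hu]]] :=
    @subdivision_exists R 0 1 1 (flatten (map (@step_points R) L)) ltr01 ltr01.
  move=> x /flattenP[_ /mapP[s sL ->]]; exact: step_points_in (hL s sL).
exists m, u; split=> // s sL x xs; apply: hu.
by apply/flattenP; exists (step_points s) => //; exact: map_f.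
Qed.

(** The Ito isometry for step integrands: on a common subdivision the integral is a combination of
    independent normal increments, and the variance is read off cell by cell. *)
Lemma multi_step_int_gaussian (st : 'I_q -> seq (R * R * R)) :
  (forall k, step_in 0 1 (st k)) ->
  exists2 v, centered_gaussian P (multi_step_int st) v &
    (v%:E = \sum_k \int[mu]_(x in `[0%R, 1%R]) (step_fun (st k) x ^+ 2)%:E)%E.
Proof.
move=> hst; have [|m [u [su ad]]] := @adapted_subdivision (codom st).
  by move=> s /codomP[k ->].
have adk k : adapted_to m u (st k) by apply: ad; exact: codom_f.
exists (\sum_(ik : 'I_m * 'I_q) step_fun (st ik.2) (u ik.1.+1) ^+ 2 * (u ik.1.+1 - u ik.1)).
  rewrite (_ : multi_step_int st = fun w => \sum_(ik : 'I_m * 'I_q) step_fun (st ik.2) (u ik.1.+1) * increment u ik w).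
    exact: (increments_gaussian su).
  by apply/funext => w; rewrite (multi_step_int_increments su).
rewrite (step_fun_integral_sqr su (F := fun k => step_fun (st k))) //.
- by move=> k; exact: measurable_step_fun.
- by move=> k i x im hx; exact: (step_fun_cell su).
Qed.

End brownian.

(** * Anticoncentration of one block given the others *)

Section block_anticoncentration.
Variable R : realType.
Local Notation mu := (@lebesgue_measure R).

Lemma measurable_row_near_span d (T : measurableType d) m n (l : 'I_m.+1)
    (M : T -> 'M[R]_(m.+1, n)) (K : R) :
  (forall i j, measurable_fun setT (fun w => M w i j)) ->
  measurable [set w | row_near_span l (M w) K].
Proof.
move=> mM.
have -> : [set w | row_near_span l (M w) K] = \bigcup_(q : 'rV[rat]_m)
    [set w | nsq (row l (M w) - map_mx ratr q *m row' l (M w)) < K].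
  by apply/seteqP; split=> w /= [q]; [exists q | move=> _; exists q].
apply: countable_bigcupT_measurable; first exact: countableP.
move=> q; apply: measurable_lt_cst.
under eq_fun do rewrite nsqE.
apply: measurable_sum => j; apply: measurable_funX.
rewrite (_ : (fun w => _) = (fun w => M w l j - \sum_k ratr (q 0 k) * M w (lift l k) j)).
  apply: measurable_funB => //; apply: measurable_sum => k.
  exact: measurable_funM.
apply/funext => w; rewrite !mxE; congr (_ - _).
by apply: eq_bigr => k _; rewrite !mxE.
Qed.

Context d (T : measurableType d) (P : probability T R).
Variables (q : nat) (B : R -> T -> 'cV[R]_q).
Hypothesis bmB : brownian_motion P B.
Variables (r n : nat) (st : 'I_r.+1 -> 'I_n -> 'I_q -> seq (R * R * R)).
Variables (lo hi : 'I_r.+1 -> R).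
Hypothesis lo0 : forall l, 0 <= lo l.
Hypothesis hi1 : forall l, hi l <= 1.
Hypothesis st_in : forall l j k, step_in (lo l) (hi l) (st l j k).
Hypothesis disj : forall l l' x, l != l' -> lo l < x <= hi l -> ~~ (lo l' < x <= hi l').

Definition step_matrix (w : T) : 'M[R]_(r.+1, n) :=
  \matrix_(l, j) multi_step_int B (st l j) w.

(** Freezing the increments outside block l fixes the other r rows. The hypothesis, applied to these
    rows as U, gives a unit vector x orthogonal to them; if row l is near their span then its
    product with x is small. That product is Gaussian of variance at least V0 plus a constant, and
    the one-dimensional bound applies. *)
Lemma block_anticoncentration (V0 K : R) (c : 'M[R]_(r.+1, n)) l :
  0 < V0 -> 0 < K ->
  (forall U : 'M[R]_(r, n), exists x : 'rV[R]_n, [/\ nsq x = 1, U *m x^T = 0 &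
    (V0%:E <= \sum_k \int[mu]_(s in `[0%R, 1%R])
       ((\sum_j x 0 j * step_fun (st l j k) s) ^+ 2)%:E)%E]) ->
  (P [set w | row_near_span l (step_matrix w + c) K] <= (2 * Num.sqrt (K / V0))%:E)%E.
Proof.
move=> V00 K0 hV.
have st01 l' j k : step_in 0 1 (st l' j k) by exact: step_inS (st_in l' j k).
have [|m [u [su ad]]] :=
    @adapted_subdivision R [seq st x.1.1 x.1.2 x.2 | x : 'I_r.+1 * 'I_n * 'I_q].
  by move=> s /codomP[x ->].
have adk l' j k : adapted_to m u (st l' j k).
  by apply: ad; apply/codomP; exists (l', j, k).
pose D l' (ik : 'I_m * 'I_q) := lo l' < u ik.1.+1 <= hi l'.
pose D1 : pred ('I_m * 'I_q) := D l; pose D2 : pred ('I_m * 'I_q) := predC (D l).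
have dD ik : ~~ (D1 ik && D2 ik) by rewrite /D2 /= andbN.
have mxi := measurable_increment bmB su.
have ind := increments_independent bmB su.
pose G1 := coord_family (increment B u) D1; pose G2 := coord_family (increment B u) D2.
have SE l' j w : multi_step_int B (st l' j) w =
    \sum_(ik <- [seq ik <- index_enum _ | D l' ik])
      step_fun (st l' j ik.2) (u ik.1.+1) * increment B u ik w.
  rewrite (multi_step_int_increments B su) // big_filter [RHS]big_mkcond /=.
  apply: eq_bigr => ik _; case: ifPn => // nD.
  by rewrite (step_fun_out (st_in _ _ _) nD) mul0r.
have m1 j : measurable_fun setT
    (fun w : g_sigma_algebraType G1 => multi_step_int B (st l j) w).
  have : measurable_fun setT (fun w : g_sigma_algebraType G1 =>
      \sum_(ik <- [seq ik <- index_enum _ | D l ik])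
        step_fun (st l j ik.2) (u ik.1.+1) * increment B u ik w).
    apply: measurable_sum_coord => ik.
    by rewrite mem_filter => /andP[].
  by apply: eq_measurable_fun => w _; rewrite SE.
have m2 l' j : l' != l -> measurable_fun setT
    (fun w : g_sigma_algebraType G2 => multi_step_int B (st l' j) w).
  move=> ll; have : measurable_fun setT (fun w : g_sigma_algebraType G2 =>
      \sum_(ik <- [seq ik <- index_enum _ | D l' ik])
        step_fun (st l' j ik.2) (u ik.1.+1) * increment B u ik w).
    apply: measurable_sum_coord => ik.
    by rewrite mem_filter => /andP[h _]; exact: disj h.
  by apply: eq_measurable_fun => w _; rewrite SE.
(* Row l is read from the first argument and all other rows from the second; on the diagonal the
   original matrix returns. *)
pose M (z : g_sigma_algebraType G1 * g_sigma_algebraType G2) : 'M[R]_(r.+1, n) :=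
  \matrix_(i, j) ((if i == l then multi_step_int B (st i j) z.1
                   else multi_step_int B (st i j) z.2) + c i j).
have mM i j : measurable_fun setT (fun z => M z i j).
  under eq_fun do rewrite mxE.
  apply: measurable_funD => //; case: eqVneq => [->|il].
    exact: (measurableT_comp (m1 j)).
  exact: (measurableT_comp (m2 i j il)).
have -> : [set w | row_near_span l (step_matrix w + c) K] =
    [set w | [set z | row_near_span l (M z) K] (w, w)].
  apply/seteqP; split=> w /=; have -> : M (w, w) = step_matrix w + c => //.
    by apply/matrixP => i j; rewrite !mxE /= if_same.
  by apply/matrixP => i j; rewrite !mxE /= if_same.
apply: (decoupling_set_le _ _ (coord_sigma_indep mxi ind dD)).
- exact: coord_family_measurable.
- exact: coord_family_measurable.
- exact: measurable_row_near_span.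
move=> w2; have [x [nx Ux hx]] := hV (row' l (step_matrix w2 + c)).
pose b (ik : 'I_m * 'I_q) := \sum_j x 0 j * step_fun (st l j ik.2) (u ik.1.+1).
pose v := \sum_(ik : 'I_m * 'I_q) b ik ^+ 2 * (u ik.1.+1 - u ik.1).
pose xi w := \sum_(ik : 'I_m * 'I_q) b ik * increment B u ik w.
have gxi : centered_gaussian P xi v := increments_gaussian bmB su b.
have V0v : V0 <= v.
  rewrite -lee_fin; apply: (le_trans hx).
  rewrite (step_fun_integral_sqr su
    (F := fun k s => \sum_j x 0 j * step_fun (st l j k) s)) //.
  - move=> k; apply: measurable_sum => j; apply: measurable_funM => //.
    exact: measurable_step_fun.
  - move=> k i s im hs; apply: eq_bigr => j _; congr (_ * _).
    exact: (step_fun_cell su).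
have v0 : 0 < v := lt_le_trans V00 V0v.
apply: (@le_trans _ _ (P [set w | ((xi w + (row l c *m x^T) 0 0) ^+ 2 <= K)%R])).
  have [mx _ _] := gxi.
  have xiE w : xi w = \sum_j x 0 j * multi_step_int B (st l j) w.
    rewrite /xi /b; under eq_bigr do rewrite mulr_suml.
    rewrite exchange_big /=; apply: eq_bigr => j _.
    rewrite (multi_step_int_increments B su) // mulr_sumr.
    by apply: eq_bigr => ik _; rewrite mulrA.
  apply: le_measure.
  - apply/mem_set; apply: (@measurable_row_near_span _ T _ _ l (fun w1 => M (w1, w2))).
    move=> i j; under eq_fun do rewrite mxE.
    apply: measurable_funD => //; case: eqVneq => [->|il] /=; last exact: measurable_cst.
    by have [v' []] := multi_step_int_gaussian bmB (st01 l j).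
  - by apply/mem_set; exact: measurable_sqr_le.
  move=> w1 /= [p hp]; apply: le_trans (ltW hp); rewrite -[leRHS]mulr1 -nx.
  apply: le_trans (nsq_dot _ _).
  have UE : row' l (M (w1, w2)) = row' l (step_matrix w2 + c).
    apply/matrixP => i j; rewrite !mxE /=.
    by rewrite eq_sym (negbTE (neq_lift l i)).
  rewrite mulmxBl UE -mulmxA Ux mulmx0 subr0.
  have -> : xi w1 + (row l c *m x^T) 0 0 = (row l (M (w1, w2)) *m x^T) 0 0.
    rewrite xiE !mxE -big_split /=; apply: eq_bigr => j _.
    by rewrite !mxE eqxx /= mulrDl mulrC.
  by [].
apply: (le_trans (centered_gaussian_anticoncentration _ gxi v0 K0)).
rewrite lee_fin ler_wpM2l //; apply: ler_wsqrtr.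
by rewrite ler_pM2l // lef_pV2.
Qed.

End block_anticoncentration.

(** * Test functions *)

Section bernstein.
Variable R : realType.

(* The Bernstein polynomial of degree N with values f 0, ..., f N at the nodes,
   by de Casteljau's recursion. *)
Fixpoint bernstein (N : nat) (f : nat -> R) (z : R) : R :=
  if N is N'.+1
  then (1 - z) * bernstein N' f z + z * bernstein N' (fun k => f k.+1) z
  else f 0%N.

Lemma bernsteinD N f g z :
  bernstein N (fun k => f k + g k) z = bernstein N f z + bernstein N g z.
Proof. by elim: N f g => //= N IH f g; rewrite !IH; ring. Qed.

Lemma bernsteinZ N c f z : bernstein N (fun k => c * f k) z = c * bernstein N f z.
Proof. by elim: N f => //= N IH f; rewrite !IH; ring. Qed.

Lemma bernstein_cst N c z : bernstein N (fun=> c) z = c.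
Proof. by elim: N => //= N ->; ring. Qed.

Lemma bernsteinB N f g z :
  bernstein N (fun k => f k - g k) z = bernstein N f z - bernstein N g z.
Proof. by elim: N f g => //= N IH f g; rewrite !IH; ring. Qed.

Lemma bernstein_le N f g z : 0 <= z <= 1 ->
  (forall k, (k <= N)%N -> f k <= g k) -> bernstein N f z <= bernstein N g z.
Proof.
move=> /andP[z0 z1]; elim: N f g => [|N IH] f g h /=; first exact: h.
apply: lerD; (apply: ler_wpM2l; first by rewrite ?subr_ge0); apply: IH => k kN; apply: h => //.
exact: leqW.
Qed.

Lemma bernstein_norm_le N f C z : 0 <= z <= 1 ->
  (forall k, (k <= N)%N -> `|f k| <= C) -> `|bernstein N f z| <= C.
Proof.
move=> z01 h; rewrite ler_norml; apply/andP; split.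
  rewrite -(bernstein_cst N (- C) z); apply: bernstein_le => // k kN.
  by have := h k kN; rewrite ler_norml => /andP[].
rewrite -[leRHS](bernstein_cst N C z); apply: bernstein_le => // k kN.
by have := h k kN; rewrite ler_norml => /andP[].
Qed.

(** Variance plus squared bias: the Bernstein weights are those of the binomial law with parameters
    N and z. *)
Lemma bernstein_sqr N c z :
  bernstein N (fun k => (k%:R - c) ^+ 2) z = N%:R * z * (1 - z) + (N%:R * z - c) ^+ 2.
Proof.
elim: N c => [|N IH] c /=; first by ring.
have -> : bernstein N (fun k => (k.+1%:R - c) ^+ 2) z =
    N%:R * z * (1 - z) + (N%:R * z - (c - 1)) ^+ 2.
  rewrite -IH; congr (bernstein N _ z); apply/funext => k.
  by rewrite -natr1; congr (_ ^+ 2); ring.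
by rewrite IH -natr1; ring.
Qed.

Lemma is_derive_bernstein N (f : nat -> R) (z : R) :
  is_derive z 1 (bernstein N.+1 f) (N.+1%:R * bernstein N (fun k => f k.+1 - f k) z).
Proof.
elim: N f => [|N IH] f.
  rewrite (_ : bernstein 1 f = (fun z => (1 - z) * f 0%N + z * f 1%N)) //.
  apply: is_derive_eq; rewrite /GRing.scale /= mul1r; ring.
have -> : bernstein N.+2 f =
    (fun z => (1 - z) * bernstein N.+1 f z + z * bernstein N.+1 (fun k => f k.+1) z) by [].
have h1 := IH f; have h2 := IH (fun k => f k.+1).
apply: is_derive_eq; rewrite /GRing.scale /= -/(bernstein N).
rewrite !bernsteinB.
by rewrite -[in RHS]natr1; ring.
Qed.

End bernstein.

Section bump.
Variable R : realType.

Definition sqr_pos (x : R) : R := Num.max x 0 ^+ 2.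

Lemma sqr_posE (x : R) : sqr_pos x = if 0 <= x then x ^+ 2 else 0.
Proof. by rewrite /sqr_pos; case: leP => // _; rewrite expr0n. Qed.

Lemma sqr_pos_ge0 (x : R) : 0 <= sqr_pos x.
Proof. exact: sqr_ge0. Qed.

Lemma sqr_pos_le1 (x : R) : x <= 1 -> sqr_pos x <= 1.
Proof. by move=> x1; rewrite sqr_posE; case: ifP => // x0; nra. Qed.

Lemma sqr_pos_diff (x e : R) : 0 <= e -> x + e <= 1 -> 0 <= sqr_pos (x + e) - sqr_pos x <= 2 * e.
Proof.
move=> e0 xe; rewrite !sqr_posE; case: ifPn => h1; case: ifPn => h2; apply/andP; split; try nra.
Qed.

Lemma sqr_pos_diff2 (x e : R) : 0 <= e ->
  0 <= sqr_pos (x + e) - 2 * sqr_pos x + sqr_pos (x - e) <= 2 * e ^+ 2.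
Proof.
move=> e0; rewrite !sqr_posE.
case: ifPn => h1; case: ifPn => h2; case: ifPn => h3; rewrite -?ltNge in h1 h2 h3 *;
  apply/andP; split; try nra.
Qed.

(* A C^{1,1} bump supported in [al, be]. *)
Definition bump (al be z : R) : R := sqr_pos (z - al) * sqr_pos (be - z).

Section unit_interval.
Variables al be : R.
Hypotheses (al0 : 0 <= al) (be1 : be <= 1).

Lemma bump_bounds (z : R) : 0 <= z <= 1 -> 0 <= bump al be z <= 1.
Proof.
have := al0; have := be1 => be1' al0'.
move=> /andP[z0 z1]; rewrite /bump.
have h1 := sqr_pos_ge0 (z - al); have h2 := sqr_pos_ge0 (be - z).
have h3 : sqr_pos (z - al) <= 1 by apply: sqr_pos_le1; lra.
have h4 : sqr_pos (be - z) <= 1 by apply: sqr_pos_le1; lra.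
by apply/andP; split; nra.
Qed.

Lemma bump_diff (z e : R) : 0 <= z -> 0 <= e -> z + e <= 1 ->
  `|bump al be (z + e) - bump al be z| <= 4 * e.
Proof.
have := al0; have := be1 => be1' al0'.
move=> z0 e0 ze; rewrite /bump.
have /andP[a1 a2] : 0 <= sqr_pos (z + e - al) - sqr_pos (z - al) <= 2 * e.
  by rewrite (_ : z + e - al = z - al + e); [apply: sqr_pos_diff => //; lra | ring].
have /andP[b1 b2] : 0 <= sqr_pos (be - z) - sqr_pos (be - (z + e)) <= 2 * e.
  rewrite (_ : be - z = be - (z + e) + e); last by ring.
  by apply: sqr_pos_diff => //; lra.
have c1 := sqr_pos_ge0 (z - al); have c2 := sqr_pos_ge0 (be - (z + e)).
have c3 : sqr_pos (z - al) <= 1 by apply: sqr_pos_le1; lra.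
have c4 : sqr_pos (be - (z + e)) <= 1 by apply: sqr_pos_le1; lra.
move: a1 a2 b1 b2 c1 c2 c3 c4.
move: (sqr_pos (z + e - al)) (sqr_pos (z - al)) (sqr_pos (be - z)) (sqr_pos (be - (z + e))).
move=> F' F G G' *; rewrite ler_norml.
have -> : F' * G' - F * G = (F' - F) * G' - F * (G - G') by ring.
have h1 : 0 <= (F' - F) * G' <= 2 * e by apply/andP; split; nra.
have h2 : 0 <= F * (G - G') <= 2 * e by apply/andP; split; nra.
by move: h1 h2 => /andP[? ?] /andP[? ?]; apply/andP; split; lra.
Qed.

(** The product rule for second differences. The four terms are bounded by 2, 2, 4 and 4 times e^2.
    Differences, not derivatives, are estimated because they are the coefficients of the derivatives
    of a Bernstein polynomial. *)
Lemma bump_diff2 (z e : R) : 0 <= e -> 0 <= z - e -> z + e <= 1 ->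
  `|bump al be (z + e) - 2 * bump al be z + bump al be (z - e)| <= 12 * e ^+ 2.
Proof.
have := al0; have := be1 => be1' al0'.
move=> e0 ze0 ze; rewrite /bump.
have /andP[a1 a2] := sqr_pos_diff2 (z - al) e0.
have /andP[b1 b2] := sqr_pos_diff2 (be - z) e0.
have /andP[d1 d2] : 0 <= sqr_pos (z - al + e) - sqr_pos (z - al) <= 2 * e.
  by apply: sqr_pos_diff => //; lra.
have /andP[d3 d4] : 0 <= sqr_pos (z - al) - sqr_pos (z - al - e) <= 2 * e.
  have := @sqr_pos_diff (z - al - e) e e0; rewrite subrK => H; apply: H; lra.
have /andP[f1 f2] : 0 <= sqr_pos (be - z + e) - sqr_pos (be - z) <= 2 * e.
  by apply: sqr_pos_diff => //; lra.
have /andP[f3 f4] : 0 <= sqr_pos (be - z) - sqr_pos (be - z - e) <= 2 * e.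
  have := @sqr_pos_diff (be - z - e) e e0; rewrite subrK => H; apply: H; lra.
have c1 := sqr_pos_ge0 (z - al); have c2 := sqr_pos_ge0 (be - z).
have c3 : sqr_pos (z - al) <= 1 by apply: sqr_pos_le1; lra.
have c4 : sqr_pos (be - z) <= 1 by apply: sqr_pos_le1; lra.
rewrite (_ : z + e - al = z - al + e); last by ring.
rewrite (_ : z - e - al = z - al - e); last by ring.
rewrite (_ : be - (z + e) = be - z - e); last by ring.
rewrite (_ : be - (z - e) = be - z + e); last by ring.
move: a1 a2 b1 b2 c1 c2 c3 c4 d1 d2 d3 d4 f1 f2 f3 f4.
move: (sqr_pos (z - al)) (sqr_pos (z - al + e)) (sqr_pos (z - al - e)).
move: (sqr_pos (be - z)) (sqr_pos (be - z + e)) (sqr_pos (be - z - e)).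
move=> G Gp Gm F Fp Fm a1 a2 b1 b2 c1 c2 c3 c4 d1 d2 d3 d4 f1 f2 f3 f4.
have -> : Fp * Gm - 2 * (F * G) + Fm * Gp =
  F * (Gp - 2 * G + Gm) + G * (Fp - 2 * F + Fm)
   - (Fp - F) * (G - Gm) - (F - Fm) * (Gp - G) by ring.
have h1 : 0 <= F * (Gp - 2 * G + Gm) <= 2 * e ^+ 2 by apply/andP; split; nra.
have h2 : 0 <= G * (Fp - 2 * F + Fm) <= 2 * e ^+ 2 by apply/andP; split; nra.
have h3 : 0 <= (Fp - F) * (G - Gm) <= 4 * e ^+ 2.
  rewrite mulr_ge0 //= (_ : 4 * e ^+ 2 = (2 * e) * (2 * e)); last by ring.
  by apply: ler_pM.
have h4 : 0 <= (F - Fm) * (Gp - G) <= 4 * e ^+ 2.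
  rewrite mulr_ge0 //= (_ : 4 * e ^+ 2 = (2 * e) * (2 * e)); last by ring.
  by apply: ler_pM.
move: h1 h2 h3 h4 => /andP[? ?] /andP[? ?] /andP[? ?] /andP[? ?].
by rewrite ler_norml; apply/andP; split; lra.
Qed.

Lemma bump_out (z : R) : ~~ (al < z < be) -> bump al be z = 0.
Proof.
rewrite /bump !sqr_posE => h; case: ifPn => h1; last by rewrite mul0r.
case: ifPn => h2; last by rewrite mulr0.
move: h; rewrite negb_and -!leNgt => /orP[] h.
  by rewrite (_ : z - al = 0) ?expr0n ?mul0r //; lra.
by rewrite (_ : be - z = 0) ?expr0n ?mulr0 //; lra.
Qed.

Variable n : nat.
Let f (k : nat) : R := bump al be (k%:R / n.+2%:R).

Lemma node_bounds k : (k <= n.+2)%N -> 0 <= (k%:R / n.+2%:R : R) <= 1.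
Proof.
by move=> kn; rewrite divr_ge0 //= ler_pdivrMr // mul1r ler_nat.
Qed.

Lemma bernstein_bump_bound (z : R) : 0 <= z <= 1 -> `|bernstein n.+2 f z| <= 1.
Proof.
move=> z01; apply: bernstein_norm_le => // k kn.
by have /andP[h1 h2] := bump_bounds (node_bounds kn); rewrite ger0_norm.
Qed.

Lemma nodeS k : k.+1%:R / n.+2%:R = k%:R / n.+2%:R + n.+2%:R^-1 :> R.
Proof. by rewrite -natr1 mulrDl mul1r. Qed.

Lemma bernstein_bump_deriv_bound (z : R) : 0 <= z <= 1 ->
  `|n.+2%:R * bernstein n.+1 (fun k => f k.+1 - f k) z| <= 4.
Proof.
move=> z01; rewrite normrM ger0_norm // mulrC -ler_pdivlMr //.
apply: bernstein_norm_le => // k kn; rewrite /f nodeS.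
apply: bump_diff; rewrite ?divr_ge0 //.
by rewrite -nodeS; have /andP[] := @node_bounds k.+1 kn.
Qed.

Lemma bernstein_bump_deriv2_bound (z : R) : 0 <= z <= 1 ->
  `|n.+2%:R * (n.+1%:R * bernstein n (fun k => (f k.+2 - f k.+1) - (f k.+1 - f k)) z)| <= 12.
Proof.
move=> z01; set b := bernstein _ _ _.
have hb : `|b| <= 12 * n.+2%:R^-1 ^+ 2.
  apply: bernstein_norm_le => // k kn; rewrite /f.
  have -> : forall x y w : R, (x - y) - (y - w) = x - 2 * y + w by move=> *; ring.
  have -> : k%:R / n.+2%:R = k.+1%:R / n.+2%:R - n.+2%:R^-1 :> R by rewrite nodeS; ring.
  rewrite nodeS; apply: bump_diff2; rewrite ?invr_ge0 //.
    by rewrite nodeS addrK divr_ge0.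
  by rewrite -nodeS; have /andP[] := @node_bounds k.+2 kn.
rewrite !normrM !normr_nat.
have n1 : n.+1%:R <= n.+2%:R :> R by rewrite ler_nat.
apply: (@le_trans _ _ (n.+2%:R * (n.+2%:R * (12 * n.+2%:R^-1 ^+ 2)))).
  by rewrite ler_wpM2l // ler_pM.
rewrite [leLHS](_ : _ = 12) //.
have : n.+2%:R != 0 :> R by [].
by generalize (n.+2%:R : R) => x x0; field.
Qed.

(** The bump is 4-Lipschitz, and 4 x <= 2 e + 2 x^2 / e replaces the distance x between node and z
    by its square, whose Bernstein mean is z (1 - z) / m <= 1 / (4 m). *)
Lemma bernstein_bump_approx (z e : R) : 0 <= z <= 1 -> 0 < e ->
  `|bernstein n.+2 f z - bump al be z| <= 2 * e + (2 * e * n.+2%:R)^-1.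
Proof.
move=> z01 e0; have /andP[z0 z1] := z01; set m := n.+2%:R : R.
have m0 : 0 < m by [].
pose g (k : nat) : R := 2 * e + 2 / e / m ^+ 2 * (k%:R - m * z) ^+ 2.
have fg k : (k <= n.+2)%N -> `|f k - bump al be z| <= g k.
  move=> kn; have /andP[k0 k1] := node_bounds kn.
  have h1 : `|f k - bump al be z| <= 4 * `|k%:R / m - z|.
    rewrite /f -/m; have [zk|kz] := leP z (k%:R / m).
      have := @bump_diff z (k%:R / m - z) z0; rewrite subr_ge0 subrKC => H.
      by rewrite [`|k%:R / m - z|]ger0_norm ?subr_ge0 //; exact: H.
    have := @bump_diff (k%:R / m) (z - k%:R / m) k0; rewrite subr_ge0 subrKC => H.
    rewrite distrC [`|k%:R / m - z|]distrC [`|z - _|]ger0_norm ?subr_ge0; last exact: ltW.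
    by apply: H => //; exact: ltW.
  apply: (le_trans h1); rewrite /g.
  have -> : 2 / e / m ^+ 2 * (k%:R - m * z) ^+ 2 = 2 / e * `|k%:R / m - z| ^+ 2.
    rewrite real_normK ?num_real //; field; rewrite !gt_eqF //.
  set x := `|_|.
  have -> : 2 * e + 2 / e * x ^+ 2 = 2 / e * (e - x) ^+ 2 + 4 * x.
    by field; rewrite gt_eqF.
  by rewrite lerDr mulr_ge0 ?sqr_ge0 // divr_ge0 // ltW.
have Eg : bernstein n.+2 g z = 2 * e + 2 / e / m ^+ 2 * (m * z * (1 - z)).
  by rewrite /g bernsteinD bernstein_cst bernsteinZ bernstein_sqr subrr expr0n addr0.
have zz : z * (1 - z) <= 1 / 4 by have := sqr_ge0 (z - 1 / 2); nra.
have hg : bernstein n.+2 g z <= 2 * e + (2 * e * m)^-1.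
  rewrite Eg lerD2l.
  have -> : 2 / e / m ^+ 2 * (m * z * (1 - z)) = 2 / (e * m) * (z * (1 - z)).
    by field; rewrite !gt_eqF.
  have -> : (2 * e * m)^-1 = 2 / (e * m) * (1 / 4) by field; rewrite !gt_eqF.
  by rewrite ler_wpM2l // divr_ge0 // ltW // mulr_gt0.
have -> : bernstein n.+2 f z - bump al be z =
    bernstein n.+2 (fun k => f k - bump al be z) z.
  by rewrite bernsteinB bernstein_cst.
rewrite ler_norml; apply/andP; split.
  rewrite lerNl; apply: le_trans hg; rewrite -mulN1r -bernsteinZ.
  apply: bernstein_le => // k /fg; rewrite mulN1r ler_norml => /andP[h _].
  by rewrite lerNl.
apply: le_trans hg; apply: bernstein_le => // k /fg.
by rewrite ler_norml => /andP[].
Qed.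

End unit_interval.
End bump.

(** * Sine polynomials with controlled second derivative *)

Section sine_polynomials.
Variable R : realType.

Lemma sum_cos (phi : R) n :
  2 * sin (phi / 2) * (\sum_(m < n) cos (m%:R * phi)) =
  sin (n%:R * phi - phi / 2) + sin (phi / 2).
Proof.
elim: n => [|n IH]; first by rewrite big_ord0 mulr0 mul0r add0r sinN addNr.
rewrite big_ord_recr /= mulrDr IH.
have -> : n.+1%:R * phi - phi / 2 = n%:R * phi + phi / 2 by rewrite -natr1; field.
rewrite sinB sinD; ring.
Qed.

Lemma sum_cos_period (N l : nat) : (0 < l)%N -> (l < N.*2)%N ->
  \sum_(m < N.*2) cos (m%:R * (l%:R * (pi / N%:R))) = 0 :> R.
Proof.
move=> l0 lN; have N0 : (0 < N)%N by case: N lN.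
have N0R : 0 < N%:R :> R by rewrite ltr0n.
set phi := l%:R * (pi / N%:R).
have s0 : 0 < sin (phi / 2).
  apply: sin_gt0_pi; apply/andP; split.
    apply: divr_gt0 => //; apply: mulr_gt0; rewrite ?ltr0n //.
    by apply: divr_gt0 => //; exact: pi_gt0.
  have -> : phi / 2 = pi * (l%:R / N.*2%:R).
    rewrite -mul2n natrM /phi; move: (gt_eqF N0R) => N0'.
    by generalize (pi : R) => p; field; rewrite N0'.
  by rewrite gtr_pMr ?pi_gt0 // ltr_pdivrMr ?ltr0n ?double_gt0 // mul1r ltr_nat.
apply: (mulfI (x := 2 * sin (phi / 2))); first by rewrite gt_eqF // mulr_gt0.
rewrite sum_cos mulr0.
have -> : N.*2%:R * phi - phi / 2 = - (phi / 2) + (pi *+ 2) *+ l.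
  rewrite -mul2n natrM -mulrnA -[pi *+ _]mulr_natl natrM /phi.
  move: (gt_eqF N0R) => N0'.
  by generalize (pi : R) => p; field; rewrite N0'.
by rewrite (periodicn (@sinD2pi R)) sinN addNr.
Qed.

Lemma sine_orthogonality (N j k : nat) : (0 < j < N)%N -> (0 < k < N)%N ->
  \sum_(m < N.*2) sin (j%:R * (m%:R * (pi / N%:R))) * sin (k%:R * (m%:R * (pi / N%:R)))
  = N%:R * (j == k)%:R :> R.
Proof.
wlog jk : j k / (k <= j)%N.
  move=> h hj hk; have [/h|/ltnW kj] := leqP k j; first exact.
  by rewrite eq_sym -(h _ _ kj hk hj); apply: eq_bigr => m _; rewrite mulrC.
move=> /andP[j0 jN] /andP[k0 kN].
pose C l := \sum_(m < N.*2) cos (m%:R * (l%:R * (pi / N%:R))) : R.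
have -> : \sum_(m < N.*2) sin (j%:R * (m%:R * (pi / N%:R))) *
    sin (k%:R * (m%:R * (pi / N%:R))) = (C (j - k)%N - C (j + k)%N) / 2.
  rewrite /C -sumrB mulr_suml; apply: eq_bigr => m _.
  have -> : m%:R * ((j - k)%:R * (pi / N%:R)) =
      j%:R * (m%:R * (pi / N%:R)) - k%:R * (m%:R * (pi / N%:R)) :> R.
    by rewrite natrB //; generalize (pi / N%:R : R) => p; ring.
  have -> : m%:R * ((j + k)%:R * (pi / N%:R)) =
      j%:R * (m%:R * (pi / N%:R)) + k%:R * (m%:R * (pi / N%:R)) :> R.
    by rewrite natrD //; generalize (pi / N%:R : R) => p; ring.
  by rewrite cosB cosD; field.
have -> : C (j + k)%N = 0.
  by apply: sum_cos_period; [rewrite addn_gt0 j0 | rewrite -addnn (ltn_trans (n := j + N)) ?ltn_add2l ?ltn_add2r].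
rewrite subr0; case: eqVneq => [->|neq].
  rewrite subnn /C (eq_bigr (fun=> 1)); last by move=> m _; rewrite mul0r mulr0 cos0.
  by rewrite sumr_const card_ord -mul2n natrM mulrAC mulfV // mul1r mulr1.
rewrite [C _]sum_cos_period ?mul0r ?mulr0 //.
  by rewrite subn_gt0 ltn_neqAle eq_sym neq.
by rewrite (leq_ltn_trans (leq_subr _ _)) // (ltn_trans jN) // -addnn -[X in (X < _)%N]addn0 ltn_add2l (ltn_trans j0).
Qed.

(** Discrete Parseval: on 2N equally spaced points with N = J + 1 the sines of frequency 1, ..., J
    are orthogonal, so averaging the squared bound over the points is enough. *)
Lemma sine_parseval_le (J : nat) (b : nat -> R) (M : R) :
  (forall th, `|\sum_(j < J) b j * sin (j.+1%:R * th)| <= M) ->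
  \sum_(j < J) b j ^+ 2 <= 2 * M ^+ 2.
Proof.
move=> hM; pose N := J.+1; pose th (m : nat) : R := m%:R * (pi / N%:R).
have N0 : 0 < N%:R :> R by rewrite ltr0n.
have E : \sum_(m < N.*2) (\sum_(j < J) b j * sin (j.+1%:R * th m)) ^+ 2 =
    N%:R * \sum_(j < J) b j ^+ 2.
  under eq_bigr do rewrite expr2 big_distrlr /=.
  rewrite exchange_big mulr_sumr /=; apply: eq_bigr => j _.
  rewrite exchange_big /= (bigD1 j) //= [X in _ + X]big1 ?addr0.
    transitivity (b j ^+ 2 * \sum_(m < N.*2) sin (j.+1%:R * th m) * sin (j.+1%:R * th m)).
      by rewrite mulr_sumr; apply: eq_bigr => m _; ring.
    by rewrite sine_orthogonality ?eqxx ?mulr1 1?mulrC //= ltnS.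
  move=> k kj; transitivity (b j * b k *
      \sum_(m < N.*2) sin (j.+1%:R * th m) * sin (k.+1%:R * th m)).
    by rewrite mulr_sumr; apply: eq_bigr => m _; ring.
  rewrite sine_orthogonality //= ?ltnS //.
  by rewrite eqSS eq_sym (inj_eq val_inj) (negbTE kj) !mulr0.
rewrite -(ler_pM2l N0) -E mulrA -natrM muln2.
have -> : N.*2%:R * M ^+ 2 = \sum_(m < N.*2) M ^+ 2.
  by rewrite sumr_const card_ord mulr_natl.
apply: ler_sum => m _; rewrite -(real_normK (num_real (\sum_(j < J) _))).
by apply: lerXn2r; rewrite ?nnegrE // (le_trans _ (hM (th m))).
Qed.

(** At z = (1 + cos th) / 2 a de Casteljau step reads (p + q) / 2 + cos th (q - p) / 2, and
    multiplication by cos th maps sin(j th) to half the sum of its two neighbours. *)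
Lemma sine_coefficients N (f : nat -> R) :
  exists a : nat -> R, forall th, sin th * bernstein N f ((1 + cos th) / 2) =
    \sum_(j < N.+1) a j * sin (j.+1%:R * th).
Proof.
elim: N f => [|N IH] f.
  exists (fun=> f 0%N) => th; rewrite big_ord_recl big_ord0 addr0 /= mul1r; ring.
have [a ha] := IH f; have [a' ha'] := IH (fun k => f k.+1).
pose ext (c : nat -> R) j := if (j < N.+1)%N then c j else 0.
pose b j := (a' j - a j) / 2.
(* The average of the two coefficient lists, plus half of [b] shifted up and half of [b] shifted
   down. The downward shift of the lowest frequency falls on sin 0 = 0, and [ext] pads with zeros
   above the degree. *)
pose A j := (ext a j + ext a' j) / 2 + (if j is j'.+1 then b j' / 2 else 0) + ext b j.+1 / 2.
exists A => th.
have extE (c : nat -> R) (g : nat -> R) :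
    \sum_(j < N.+1) c j * g j = \sum_(j < N.+2) ext c j * g j.
  rewrite [RHS]big_ord_recr /= /ext ltnn mul0r addr0.
  by apply: eq_bigr => j _; rewrite ltn_ord.
pose S j := sin (j%:R * th).
have E1 : \sum_(j < N.+1) b j * (cos th * S j.+1) =
    \sum_(j < N.+2) (if (j : nat) is j'.+1 then b j' / 2 else 0) * S j.+1 +
    \sum_(j < N.+2) ext b j.+1 / 2 * S j.+1.
  have -> : \sum_(j < N.+2) (if (j : nat) is j'.+1 then b j' / 2 else 0) * S j.+1 =
      \sum_(j < N.+1) b j / 2 * S j.+2.
    by rewrite big_ord_recl /= mul0r add0r; apply: eq_bigr.
  have -> : \sum_(j < N.+2) ext b j.+1 / 2 * S j.+1 = \sum_(j < N.+1) b j / 2 * S j.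
    transitivity (\sum_(j < N.+2) ext b j / 2 * S j).
      rewrite [RHS]big_ord_recl /= {2}/S mul0r sin0 mulr0 add0r.
      by rewrite big_ord_recr /= /ext ltnNge leqW //= mul0r mul0r addr0; apply: eq_bigr.
    rewrite big_ord_recr /= {2}/ext ltnn !mul0r addr0.
    by apply: eq_bigr => j _; rewrite /ext ltn_ord.
  rewrite -big_split /=; apply: eq_bigr => j _.
  have -> : S j.+2 = S j.+1 * cos th + cos (j.+1%:R * th) * sin th.
    by rewrite /S -sinD; congr sin; rewrite -natr1; ring.
  have -> : S j = S j.+1 * cos th - cos (j.+1%:R * th) * sin th.
    by rewrite /S -sinB; congr sin; rewrite -natr1; ring.
  by field.
have -> : sin th * bernstein N.+1 f ((1 + cos th) / 2) =
    (\sum_(j < N.+1) a j * S j.+1 + \sum_(j < N.+1) a' j * S j.+1) / 2 +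
    \sum_(j < N.+1) b j * (cos th * S j.+1).
  rewrite /= mulrDr mulrCA ha mulrCA ha' /b.
  have -> : \sum_(j < N.+1) (a' j - a j) / 2 * (cos th * S j.+1) =
     cos th / 2 * (\sum_(j < N.+1) a' j * S j.+1 - \sum_(j < N.+1) a j * S j.+1).
    by rewrite -sumrB mulr_sumr; apply: eq_bigr => j _; ring.
  by rewrite /S; field.
rewrite E1 (extE a (fun j => S j.+1)) (extE a' (fun j => S j.+1)) -big_split mulr_suml /=.
rewrite addrA -!big_split /=; apply: eq_bigr => j _.
rewrite /A /S !mulrDl; congr (_ + _ + _); ring.
Qed.

Lemma is_derive_big_sum n (F dF : nat -> R -> R) (x : R) :
  (forall j, is_derive x 1 (F j) (dF j x)) ->
  is_derive x 1 (fun y => \sum_(j < n) F j y) (\sum_(j < n) dF j x).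
Proof.
move=> h; elim: n => [|n IH].
  rewrite big_ord0 (_ : (fun y => _) = cst 0); first exact: is_derive_cst.
  by apply/funext => y; rewrite big_ord0.
rewrite big_ord_recr /= (_ : (fun y => _) = (fun y => \sum_(j < n) F j y + F n y)).
  exact: is_deriveD.
by apply/funext => y; rewrite big_ord_recr.
Qed.

Lemma is_derive_unique (f : R -> R) (x u v : R) :
  is_derive x 1 f u -> is_derive x 1 f v -> u = v.
Proof. by move=> [_ <-] [_ <-]. Qed.

(** The bounds 3 and 200 do not depend on e, although J does. With |p| <= 1, |p'| <= 4, |p''| <= 12
    the first derivative of sin th p(z) is at most 1 + 2, the second at most 1 + 6 + 3 = 10, and
    Parseval gives 2 * 10^2. *)
Lemma sine_approximation (al be e : R) : 0 <= al -> be <= 1 -> 0 < e ->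
  exists J (a : nat -> R), [/\
    forall th, `|\sum_(j < J) a j * (j.+1%:R * cos (j.+1%:R * th))| <= 3,
    \sum_(j < J) (a j * j.+1%:R ^+ 2) ^+ 2 <= 200 &
    forall th, `|\sum_(j < J) a j * sin (j.+1%:R * th) -
                 sin th * bump al be ((1 + cos th) / 2)| <= e].
Proof.
move=> al0 be1 e0.
have [n hn] : exists n : nat, (2 * (e / 4) * n.+2%:R)^-1 <= e / 2.
  have h0 : 0 <= 4 / e ^+ 2 by rewrite divr_ge0 // sqr_ge0.
  have /andP[_ h] := truncn_itv h0; exists (Num.truncn (4 / e ^+ 2)).
  have : 4 / e ^+ 2 <= (Num.truncn (4 / e ^+ 2)).+2%:R.
    by apply: ltW; apply: lt_trans h _; rewrite ltr_nat.
  rewrite ler_pdivrMr ?exprn_gt0 //; generalize (Num.truncn (4 / e ^+ 2)).+2 => m hm.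
  have m0 : 0 < m%:R :> R by move: hm; case: m => //; rewrite mul0r => hm; have := lt_le_trans (ltr0n R 4) hm; rewrite ltxx.
  rewrite -[leLHS]mul1r ler_pdivrMr; last by rewrite !mulr_gt0 // divr_gt0.
  by have -> : e / 2 * (2 * (e / 4) * m%:R) = m%:R * e ^+ 2 / 4; [field | lra].
pose f (k : nat) : R := bump al be (k%:R / n.+2%:R).
have [a ha] := sine_coefficients n.+2 f.
pose z (th : R) := (1 + cos th) / 2.
have z01 th : 0 <= z th <= 1.
  by have := cos_geN1 th; have := cos_le1 th; rewrite /z => h1 h2; apply/andP; split; lra.
pose p := bernstein n.+2 f.
pose p1 (y : R) := n.+2%:R * bernstein n.+1 (fun k => f k.+1 - f k) y.
pose p2 (y : R) := n.+2%:R * (n.+1%:R * bernstein n (fun k => (f k.+2 - f k.+1) - (f k.+1 - f k)) y).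
have dp (y : R) : is_derive y 1 p (p1 y) by exact: is_derive_bernstein.
have dp1 (y : R) : is_derive y 1 p1 (p2 y).
  have h := is_derive_bernstein n (fun k => f k.+1 - f k) y.
  by rewrite /p1; apply: is_derive_eq; rewrite /GRing.scale /= /p2; ring.
have dz (th : R) : is_derive th 1 z (- sin th / 2).
  by apply: is_derive_eq; rewrite /GRing.scale /=; ring.
pose Psi (th : R) := sin th * p (z th).
pose Psi1 (th : R) := cos th * p (z th) - sin th ^+ 2 / 2 * p1 (z th).
pose Psi2 (th : R) := - (sin th * p (z th)) - 3 / 2 * sin th * cos th * p1 (z th) +
  sin th ^+ 3 / 4 * p2 (z th).
have dpz (th : R) : is_derive th 1 (p \o z) (p1 (z th) * (- sin th / 2)).
  by have h1 := dp (z th); have h2 := dz th; exact: is_derive1_comp.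
have dp1z (th : R) : is_derive th 1 (p1 \o z) (p2 (z th) * (- sin th / 2)).
  by have h1 := dp1 (z th); have h2 := dz th; exact: is_derive1_comp.
have dPsi (th : R) : is_derive th 1 Psi (Psi1 th).
  rewrite (_ : Psi = fun t => sin t * (p \o z) t) //; have h := dpz th.
  by apply: is_derive_eq; rewrite /GRing.scale /= /Psi1; field.
have dPsi1 (th : R) : is_derive th 1 Psi1 (Psi2 th).
  rewrite (_ : Psi1 = fun t => cos t * (p \o z) t - sin t ^+ 2 / 2 * (p1 \o z) t) //.
  have h := dpz th; have h' := dp1z th.
  by apply: is_derive_eq; rewrite /GRing.scale /= /Psi2; field.
have PsiE : Psi = fun th => \sum_(j < n.+3) a j * sin (j.+1%:R * th).
  by apply/funext => th; rewrite -ha.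
have dS (c k th : R) : is_derive th 1 (fun y => c * sin (k * y)) (c * (k * cos (k * th))).
  by apply: is_derive_eq; rewrite /GRing.scale /=; ring.
have dC (c k th : R) : is_derive th 1 (fun y => c * (k * cos (k * y))) (- (c * k ^+ 2) * sin (k * th)).
  by apply: is_derive_eq; rewrite /GRing.scale /=; ring.
have Psi1E : Psi1 = fun th => \sum_(j < n.+3) a j * (j.+1%:R * cos (j.+1%:R * th)).
  apply/funext => th; apply: (is_derive_unique (dPsi th)); rewrite PsiE.
  apply: (@is_derive_big_sum n.+3 (fun j y => a j * sin (j.+1%:R * y))
    (fun j y => a j * (j.+1%:R * cos (j.+1%:R * y)))) => j; exact: dS.
have Psi2E th : Psi2 th = \sum_(j < n.+3) - (a j * j.+1%:R ^+ 2) * sin (j.+1%:R * th).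
  apply: (is_derive_unique (dPsi1 th)); rewrite Psi1E.
  apply: (@is_derive_big_sum n.+3 (fun j y => a j * (j.+1%:R * cos (j.+1%:R * y)))
    (fun j y => - (a j * j.+1%:R ^+ 2) * sin (j.+1%:R * y))) => j; exact: dC.
have b0 th : `|p (z th)| <= 1 by exact: bernstein_bump_bound.
have b1 th : `|p1 (z th)| <= 4 by exact: bernstein_bump_deriv_bound.
have b2 th : `|p2 (z th)| <= 12 by exact: bernstein_bump_deriv2_bound.
have hM (x y X Y : R) : `|x| <= X -> `|y| <= Y -> `|x * y| <= X * Y.
  by move=> hx hy; rewrite normrM; exact: ler_pM.
exists n.+3, a; split.
- move=> th; rewrite -[X in `|X|](congr1 (fun g => g th) Psi1E) /Psi1.
  apply: (le_trans (ler_normB _ _)).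
  have h1 : `|cos th * p (z th)| <= 1 * 1 by exact: hM (cos_max th) (b0 th).
  have h2 : `|sin th ^+ 2 / 2 * p1 (z th)| <= 1 / 2 * 4.
    apply: (hM _ _ _ _ _ (b1 th)); rewrite normrM ger0_norm ?sqr_ge0 // ger0_norm ?invr_ge0 //.
    by rewrite ler_pM2r ?invr_gt0 // sin2cos2 gerBl sqr_ge0.
  lra.
- have -> : \sum_(j < n.+3) (a j * j.+1%:R ^+ 2) ^+ 2 =
      \sum_(j < n.+3) (- (a j * j.+1%:R ^+ 2)) ^+ 2.
    by apply: eq_bigr => j _; rewrite sqrrN.
  rewrite (_ : 200 = 2 * 10 ^+ 2); last by ring.
  apply: (sine_parseval_le (b := fun j => - (a j * j.+1%:R ^+ 2))) => th.
  rewrite -Psi2E /Psi2.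
  have h1 : `|sin th * p (z th)| <= 1 * 1 by exact: hM (sin_max th) (b0 th).
  have h2 : `|3 / 2 * sin th * cos th * p1 (z th)| <= 3 / 2 * 1 * 1 * 4.
    apply: (hM _ _ _ _ _ (b1 th)); apply: (hM _ _ _ _ _ (cos_max th)).
    apply: (hM _ _ _ _ _ (sin_max th)).
    by rewrite ger0_norm // divr_ge0.
  have h3 : `|sin th ^+ 3 / 4 * p2 (z th)| <= 1 / 4 * 12.
    apply: (hM _ _ _ _ _ (b2 th)); apply: hM; last by rewrite ger0_norm ?invr_ge0.
    by rewrite normrX exprn_ile1 // sin_max.
  apply: (le_trans (ler_normD _ _)).
  have := ler_normB (- (sin th * p (z th))) (3 / 2 * sin th * cos th * p1 (z th)).
  rewrite normrN; lra.
- move=> th; rewrite -ha -/(z th) -/p -mulrBr normrM.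
  have h := bernstein_bump_approx al0 be1 n (z01 th) (e := e / 4).
  have {}h : `|p (z th) - bump al be (z th)| <= 2 * (e / 4) + (2 * (e / 4) * n.+2%:R)^-1.
    by apply: h; rewrite divr_gt0.
  have : `|sin th| * `|p (z th) - bump al be (z th)| <=
      1 * (2 * (e / 4) + (2 * (e / 4) * n.+2%:R)^-1).
    by apply: ler_pM => //; exact: sin_max.
  by move: hn; generalize (2 * (e / 4) * n.+2%:R)^-1 => q hq; lra.
Qed.

End sine_polynomials.

(** * Approximation in probability *)

Section outer_probability.
Context d (T : measurableType d) (R : realType) (P : probability T R).

(** Events such as failure of an almost sure identity, or divergence of a series, are not known to
    be measurable, so their probability is bounded through a measurable superset. *)
Definition outer_le (A : set T) (e : R) : Prop :=
  exists B, [/\ measurable B, A `<=` B & (P B <= e%:E)%E].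

Lemma outer_le_sub (A A' : set T) (e e' : R) : A `<=` A' -> e' <= e ->
  outer_le A' e' -> outer_le A e.
Proof.
move=> AA ee [B [mB AB PB]]; exists B; split=> //; first exact: subset_trans AB.
by apply: (le_trans PB); rewrite lee_fin.
Qed.

Lemma outer_leU (A A' : set T) (e e' : R) :
  outer_le A e -> outer_le A' e' -> outer_le (A `|` A') (e + e').
Proof.
move=> [B [mB AB PB]] [B' [mB' AB' PB']]; exists (B `|` B'); split.
- exact: measurableU.
- exact: setUSS.
- by apply: (le_trans (measureU2 P mB mB')); rewrite EFinD leeD.
Qed.

Lemma outer_le_bigcup (I : finType) (A : I -> set T) (e : I -> R) :
  (forall i, outer_le (A i) (e i)) -> outer_le [set w | exists i, A i w] (\sum_i e i).
Proof.
move=> h.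
have H s : outer_le [set w | exists2 i, i \in s & A i w] (\sum_(i <- s) e i).
  elim: s => [|i s IH].
    exists set0; split; first exact: measurable0.
      by move=> w [].
    by rewrite measure0 big_nil.
  rewrite big_cons; apply: (outer_le_sub _ (lexx _) (outer_leU (h i) IH)).
  move=> w [j]; rewrite inE => /orP[/eqP->|js] Aw; first by left.
  by right; exists j.
apply: (outer_le_sub _ (lexx _) (H (index_enum I))).
by move=> w [i Aw]; exists i; rewrite // mem_index_enum.
Qed.

Lemma outer_le_ae (Q : T -> Prop) : {ae P, forall w, Q w} -> outer_le [set w | ~ Q w] 0.
Proof.
by move=> [B [mB PB QB]]; exists B; split=> //; rewrite PB.
Qed.

Lemma outer_le_measure (A : set T) (e : R) : measurable A -> outer_le A e -> (P A <= e%:E)%E.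
Proof.
move=> mA [B [mB AB PB]]; apply: le_trans PB.
by apply: le_measure => //; exact/mem_set.
Qed.

Lemma outer_le_self (A : set T) (e : R) : measurable A -> (P A <= e%:E)%E -> outer_le A e.
Proof. by move=> mA PA; exists A; split. Qed.

End outer_probability.

Section step_approximation.
Context d (T : measurableType d) (R : realType) (P : probability T R).
Local Notation mu := (@lebesgue_measure R).

(** A single step function per tolerance e controls both the L^2 error and the error in probability.
    This form of the stochastic integral passes easily to finite linear combinations and to larger
    intervals. *)
Definition approximable (Z : R -> T -> R) (a b : R) (f : R -> R) (V : T -> R) : Prop :=
  measurable_fun (`[a, b] : set R) f /\
  forall e : R, 0 < e -> exists s, [/\ step_in a b s,
    (\int[mu]_(x in `[a, b]) ((f x - step_fun s x) ^+ 2)%:E <= e%:E)%E &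
    outer_le P [set w | e <= `|step_int Z s w - V w|] e].

Lemma cvg0_near_lt (u : nat -> \bar R) (e : R) : 0 < e ->
  u k @[k --> \oo] --> 0%E -> \forall k \near \oo, (u k < e%:E)%E.
Proof.
move=> e0 /(_ [set x | (x < e%:E)%E]); apply.
by apply: open_nbhs_nbhs; split; [exact: open_ereal_lt_ereal | rewrite /= lte_fin].
Qed.

Lemma measurable_ge_cst (g : T -> R) (c : R) :
  measurable_fun setT g -> measurable [set w | c <= g w].
Proof.
move=> mg; rewrite (_ : [set w | _] = ~` [set w | g w < c]).
  by apply: measurableC; exact: measurable_lt_cst.
by apply/seteqP; split=> w /=; [move=> h; apply/negP; rewrite -leNgt
  | move/negP; rewrite -leNgt].
Qed.

Lemma measurable_step_int (Z : R -> T -> R) a b s :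
  (forall x, a <= x <= b -> measurable_fun setT (Z x)) -> step_in a b s ->
  measurable_fun setT (step_int Z s).
Proof.
move=> mZ; elim: s => [|q s IH].
  move=> _; rewrite (_ : step_int Z _ = cst 0) //.
  by apply/funext => w; rewrite /step_int big_nil.
move=> /= /andP[/and3P[h1 h2 h3] hs].
rewrite (_ : step_int Z _ = fun w => q.2 * (Z q.1.2 w - Z q.1.1 w) + step_int Z s w).
  apply: measurable_funD; last exact: IH.
  apply: measurable_funM => //; apply: measurable_funB; apply: mZ.
    by rewrite h3 (le_trans h1).
  by rewrite h1 (le_trans h2).
by apply/funext => w; rewrite /step_int big_cons.
Qed.

Lemma stoch_integral_approximable (Z : R -> T -> R) a b f V :
  (forall x, a <= x <= b -> measurable_fun setT (Z x)) ->
  measurable_fun (`[a, b] : set R) f ->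
  stoch_integral P Z a b f V -> approximable Z a b f V.
Proof.
move=> mZ mf [mV [s [s1 s2 s3]]]; split=> // e e0.
have h2 := cvg0_near_lt e0 s2; have h3 := cvg0_near_lt e0 (s3 e e0).
have [k [h2k h3k]] : exists k,
    ((\int[mu]_(x in `[a, b]) ((f x - step_fun (s k) x) ^+ 2)%:E < e%:E)%E /\
    (P [set w | (e <= `|step_int Z (s k) w - V w|)%R] < e%:E)%E).
  have [N _ hN] : \forall k \near \oo,
     (\int[mu]_(x in `[a, b]) ((f x - step_fun (s k) x) ^+ 2)%:E < e%:E)%E /\
     (P [set w | (e <= `|step_int Z (s k) w - V w|)%R] < e%:E)%E by near=> k; split; near: k.
  by exists N; exact: hN (leqnn N).
exists (s k); split=> //; first exact: ltW.
apply: outer_le_self; last exact: ltW.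
apply: measurable_ge_cst; apply: measurableT_comp => //.
by apply: measurable_funB => //; exact: (measurable_step_int mZ).
Unshelve. all: by end_near. Qed.

Lemma approximable0 (Z : R -> T -> R) a b : approximable Z a b (fun=> 0) (fun=> 0).
Proof.
split=> // e e0; exists [::]; split=> //.
- under eq_integral do rewrite /step_fun big_nil subrr expr0n.
  by rewrite integral0 lee_fin ltW.
- exists set0; split=> //; last by rewrite measure0 lee_fin ltW.
  by move=> w /=; rewrite /step_int big_nil subrr normr0 leNgt e0.
Qed.

Lemma measurable_sqr_diff a b (f : R -> R) s : measurable_fun (`[a, b] : set R) f ->
  measurable_fun (`[a, b] : set R) (fun x => ((f x - step_fun s x) ^+ 2)%:E).
Proof.
move=> mf; apply/measurable_EFinP; apply: measurable_funX; apply: measurable_funB => //.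
by apply: measurable_funTS; exact: measurable_step_fun.
Qed.

Lemma approximableD (Z : R -> T -> R) a b f g V U :
  approximable Z a b f V -> approximable Z a b g U ->
  approximable Z a b (fun x => f x + g x) (fun w => V w + U w).
Proof.
move=> [mf hf] [mg hg]; split; first exact: measurable_funD.
move=> e e0; have e40 : 0 < e / 4 by rewrite divr_gt0.
have [s [sin s2 s3]] := hf _ e40; have [s' [sin' s2' s3']] := hg _ e40.
exists (s ++ s'); split.
- by rewrite step_in_cat sin.
- apply: (@le_trans _ _ (\int[mu]_(x in `[a, b])
     (2%:E * ((f x - step_fun s x) ^+ 2)%:E + 2%:E * ((g x - step_fun s' x) ^+ 2)%:E))%E).
    apply: ge0_le_integral => //.
    + by move=> x _; rewrite lee_fin sqr_ge0.
    + by apply: measurable_sqr_diff; exact: measurable_funD.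
    + by apply: emeasurable_funD; apply: measurable_funeM; exact: measurable_sqr_diff.
    + move=> x _; rewrite step_fun_cat -!EFinM -EFinD lee_fin.
      have := sqr_ge0 ((f x - step_fun s x) - (g x - step_fun s' x)); nra.
  rewrite ge0_integralD //.
  + rewrite !ge0_integralZl //; try exact: measurable_sqr_diff;
      try by move=> x _; rewrite lee_fin sqr_ge0.
    have -> : e%:E = (2%:E * (e / 4)%:E + 2%:E * (e / 4)%:E)%E.
      by rewrite -!EFinM -EFinD; congr EFin; field.
    by apply: leeD; apply: lee_wpmul2l.
  + by move=> x _; rewrite -EFinM lee_fin mulr_ge0 ?sqr_ge0.
  + by apply: measurable_funeM; exact: measurable_sqr_diff.
  + by move=> x _; rewrite -EFinM lee_fin mulr_ge0 ?sqr_ge0.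
  + by apply: measurable_funeM; exact: measurable_sqr_diff.
- apply: outer_le_sub (outer_leU s3 s3'); last by lra.
  move=> w /= hw; rewrite step_int_cat in hw.
  have [h1|h1] := leP (e / 4) `|step_int Z s w - V w|; first by left.
  right; rewrite leNgt; apply/negP => h2.
  have := ler_normD (step_int Z s w - V w) (step_int Z s' w - U w).
  rewrite (_ : _ + _ - _ = step_int Z s w - V w + (step_int Z s' w - U w)) in hw; last by ring.
  by lra.
Qed.

Lemma approximableZ (Z : R -> T -> R) a b c f V :
  approximable Z a b f V -> approximable Z a b (fun x => c * f x) (fun w => c * V w).
Proof.
move=> [mf hf]; split; first exact: measurable_funM.
move=> e e0; pose k := 1 + `|c| + c ^+ 2.
have k1 : 1 <= k by rewrite /k -addrA lerDl addr_ge0 ?sqr_ge0.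
have k0 : 0 < k by exact: lt_le_trans k1.
have ck : `|c| <= k by have := sqr_ge0 c; rewrite /k; lra.
have cck : c ^+ 2 <= k by have := normr_ge0 c; rewrite /k; lra.
have ek0 : 0 < e / k by rewrite divr_gt0.
have eke : e / k <= e by rewrite ler_pdivrMr // ler_peMr // ltW.
have [s [sin s2 s3]] := hf _ ek0; exists (scale_steps c s); split.
- by rewrite step_in_scale.
- under eq_integral do rewrite step_fun_scale -mulrBr exprMn EFinM.
  rewrite ge0_integralZl //; last 3 first.
  + exact: measurable_sqr_diff.
  + by move=> x _; rewrite lee_fin sqr_ge0.
  + by rewrite lee_fin sqr_ge0.
  apply: (@le_trans _ _ ((c ^+ 2)%:E * (e / k)%:E)%E).
    by apply: lee_wpmul2l => //; rewrite lee_fin sqr_ge0.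
  by rewrite -EFinM lee_fin mulrA ler_pdivrMr // mulrC ler_wpM2l // ltW.
- apply: (outer_le_sub _ eke s3) => w /=; rewrite step_int_scale -mulrBr normrM => h.
  rewrite ler_pdivrMr //; apply: (le_trans h); rewrite mulrC.
  by rewrite ler_wpM2l.
Qed.

Lemma approximable_sum (Z : R -> T -> R) a b (J : nat) (c : nat -> R)
    (f : nat -> R -> R) (V : nat -> T -> R) :
  (forall j, (j < J)%N -> approximable Z a b (f j) (V j)) ->
  approximable Z a b (fun x => \sum_(j < J) c j * f j x) (fun w => \sum_(j < J) c j * V j w).
Proof.
elim: J => [|J IH] h.
  rewrite (_ : (fun x : R => _) = fun=> 0); last by apply/funext => x; rewrite big_ord0.
  rewrite (_ : (fun w : T => _) = fun=> 0); last by apply/funext => x; rewrite big_ord0.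
  exact: approximable0.
rewrite (_ : (fun x : R => _) = fun x => \sum_(j < J) c j * f j x + c J * f J x); last first.
  by apply/funext => x; rewrite big_ord_recr.
rewrite (_ : (fun w : T => _) = fun w => \sum_(j < J) c j * V j w + c J * V J w); last first.
  by apply/funext => x; rewrite big_ord_recr.
apply: approximableD; first by apply: IH => j jJ; exact/h/ltnW.
by apply: approximableZ; exact: h.
Qed.

End step_approximation.

(** * Boundedness and uniform continuity of paths *)

Section continuous_paths.
Variable R : realType.

Lemma within_continuous_near (x : R -> R) (s e : R) : {within `[0, 1], continuous x} ->
  0 <= s <= 1 -> 0 < e ->
  exists2 r : R, 0 < r & forall s', 0 <= s' <= 1 -> `|s - s'| < r -> `|x s - x s'| < e.
Proof.
move=> /subspace_continuousP cx s01 e0.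
have sin : `[0, 1]%classic s by rewrite /= in_itv.
have /cvgrPdist_lt/(_ e e0) := cx s sin.
rewrite /within /= => /nbhs_ballP[r /= r0 hr]; exists r => // s' s'01 ss'.
by apply: (hr s') => //=; rewrite in_itv.
Qed.

Lemma path_uniform_modulus (x : R -> R) (om : R) : {within `[0, 1], continuous x} ->
  0 < om -> exists2 de : R, 0 < de &
   forall s s', 0 <= s <= 1 -> 0 <= s' <= 1 -> `|s - s'| < de -> `|x s - x s'| <= om.
Proof.
move=> cx om0; have om20 : 0 < om / 2 by rewrite divr_gt0.
have /compact_near_coveringP hc := @segment_compact R 0 1.
have [|de /= de0 hde] := hc R (0^'+) (fun de s => 0 <= s <= 1 -> forall s', 0 <= s' <= 1 -> `|s - s'| < de -> `|x s - x s'| <= om) _.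
- move=> s0 /=; rewrite in_itv /= => s001.
  have [r r0 hr] := within_continuous_near cx s001 om20.
  have r20 : 0 < r / 2 by rewrite divr_gt0.
  near=> s de => s01 s' s'01 ss'.
  have h1 : `|s0 - s| < r / 2 by near: s; exact: (@near_ball R R s0 (r / 2)).
  have h2 : de < r / 2 by near: de; exact: nbhs_right_lt.
  have h3 : `|s0 - s'| < r.
    by rewrite (le_lt_trans (ler_distD s _ _)) // [ltRHS]splitr ltrD // (lt_trans ss').
  have h4 : `|s0 - s| < r by rewrite (lt_trans h1) // ltr_pdivrMr // ltr_pMr // ltr1n.
  rewrite (le_trans (ler_distD (x s0) _ _)) // [leRHS]splitr lerD //.
    by rewrite distrC ltW // hr.
  by rewrite ltW // hr.
- exists (de / 2); first by rewrite divr_gt0.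
  move=> s s' s01 s'01 ss'.
  apply: (hde (de / 2)) => //=.
  + rewrite sub0r normrN ger0_norm; last by rewrite divr_ge0 ?ltW.
    by rewrite ltr_pdivrMr // ltr_pMr // ltr1n.
  + by rewrite divr_gt0.
Unshelve. all: by end_near. Qed.

Lemma path_bounded (x : R -> R) : {within `[0, 1], continuous x} ->
  exists K : R, forall s, 0 <= s <= 1 -> `|x s| <= K.
Proof.
move=> cx; have ax : {within `[0, 1], continuous (fun s => `|x s|)}.
  by move=> s; apply: cvg_norm; exact: cx.
have [c _ hc] := EVT_max ler01 ax.
by exists `|x c| => s s01; apply: hc; rewrite in_itv.
Qed.

Lemma rational_approx01 (s e : R) : 0 <= s <= 1 -> 0 < e ->
  exists q : rat, 0 <= (ratr q : R) <= 1 /\ `|s - ratr q| < e.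
Proof.
move=> /andP[s0 s1] e0.
have [a [b [ab ha hb hs]]] : exists a b : R, [/\ a < b, 0 <= a, b <= 1 & s - e <= a /\ b <= s + e].
  have [s12|s12] := leP s (1 / 2).
    exists s, (Num.min 1 (s + e)); split=> //.
    - by rewrite lt_min; lra.
    - by rewrite ge_min lexx.
    - by split; [lra | rewrite ge_min lexx orbT].
  exists (Num.max 0 (s - e)), s; split=> //.
  - by rewrite gt_max; lra.
  - by rewrite le_max lexx.
  - by split; [rewrite le_max lexx orbT | lra].
have [q] := rat_in_itvoo ab; rewrite in_itv /= => /andP[aq qb].
exists q; split; first by rewrite (le_trans ha (ltW aq)) (le_trans (ltW qb)).
by rewrite ltr_norml; lra.
Qed.

(** Continuity extends the bound and the modulus from rational times to all times; at rational times
    they are countably many conditions, hence measurable. *)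
Lemma path_regular_rational (x : R -> R) (K de om : R) : {within `[0, 1], continuous x} ->
  (forall q : rat, 0 <= (ratr q : R) <= 1 -> `|x (ratr q)| <= K) ->
  (forall q q' : rat, 0 <= (ratr q : R) <= 1 -> 0 <= (ratr q' : R) <= 1 ->
     `|ratr q - ratr q' : R| < de -> `|x (ratr q) - x (ratr q')| <= om) ->
  (forall s, 0 <= s <= 1 -> `|x s| <= K) /\
  (forall s s', 0 <= s <= 1 -> 0 <= s' <= 1 -> `|s - s'| < de -> `|x s - x s'| <= om).
Proof.
move=> cx hK hom; split=> [/= s s01|/= s s' s01 s'01 ss'].
  apply/ler_addgt0Pl => e e0.
  have [r r0 hr] := within_continuous_near cx s01 e0.
  have [q [q01 sq]] := rational_approx01 s01 r0.
  have := hr _ q01 sq; have := hK _ q01.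
  by have := ler_distD (x (ratr q)) (x s) 0; rewrite !subr0; lra.
apply/ler_addgt0Pl => e e0; have e20 : 0 < e / 2 by rewrite divr_gt0.
have [r r0 hr] := within_continuous_near cx s01 e20.
have [r' r'0 hr'] := within_continuous_near cx s'01 e20.
pose g := (de - `|s - s'|) / 2; have g0 : 0 < g by rewrite divr_gt0 // subr_gt0.
have rg0 : 0 < Num.min r g by rewrite lt_min r0.
have rg'0 : 0 < Num.min r' g by rewrite lt_min r'0.
have [q [q01]] := rational_approx01 s01 rg0.
rewrite lt_min => /andP[sq sqg].
have [q' [q'01]] := rational_approx01 s'01 rg'0.
rewrite lt_min => /andP[sq' sqg'].
have hq : `|ratr q - ratr q' : R| < de.
  have h1 := ler_distD s (ratr q) (ratr q'); have h2 := ler_distD s' s (ratr q').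
  rewrite (distrC (ratr q) s) in h1.
  by rewrite (le_lt_trans h1) //; move: sqg sqg' h2; rewrite /g; lra.
have := hom _ _ q01 q'01 hq; have := hr _ q01 sq; have := hr' _ q'01 sq'.
have h1 := ler_distD (x (ratr q)) (x s) (x s').
have h2 := ler_distD (x (ratr q')) (x (ratr q)) (x s').
by rewrite (distrC (x s') (x (ratr q'))); lra.
Qed.

End continuous_paths.

Section regular_paths.
Context d (T : measurableType d) (R : realType) (P : probability T R).

Lemma countable_bigcap_measurable (I : choiceType) (A : I -> set T) :
  countable [set: I] -> (forall i, measurable (A i)) -> measurable [set w | forall i, A i w].
Proof.
move=> cI mA; rewrite (_ : [set w | _] = \bigcap_(i in [set: I]) A i).
  rewrite -[X in measurable X]setCK setC_bigcap; apply: measurableC.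
  by apply: countable_bigcupT_measurable => // i; apply: measurableC; exact: mA.
by apply/seteqP; split=> w /= h i //; exact: h.
Qed.

(** The events [A m] impose the bound m and the modulus om at scale 1 / (m + 1) at rational times.
    They increase to the whole space by continuity of the paths, so one of them has probability
    above 1 - e. *)
Lemma path_regular (q : nat) (X : R -> T -> 'cV[R]_q) (om e : R) :
  (forall s i, 0 <= s <= 1 -> measurable_fun setT (fun w => X s w i 0)) ->
  (forall w i, {within `[0, 1], continuous (fun s => X s w i 0)}) ->
  0 < om -> 0 < e ->
  exists K de : R, [/\ 0 < K, 0 < de & outer_le P [set w | ~ forall i,
    (forall s, 0 <= s <= 1 -> `|X s w i 0| <= K) /\
    (forall s s', 0 <= s <= 1 -> 0 <= s' <= 1 -> `|s - s'| < de ->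
        `|X s w i 0 - X s' w i 0| <= om)] e].
Proof.
move=> mX cX om0 e0.
pose G (m : nat) (i : 'I_q) (a b : rat) := [set w |
  (0 <= (ratr a : R) <= 1 -> `|X (ratr a) w i 0| <= m%:R) /\
  (0 <= (ratr a : R) <= 1 -> 0 <= (ratr b : R) <= 1 -> `|ratr a - ratr b : R| < m.+1%:R^-1 ->
     `|X (ratr a) w i 0 - X (ratr b) w i 0| <= om)].
pose A m := [set w | forall z : 'I_q * rat * rat, G m z.1.1 z.1.2 z.2 w].
have mimp (Q : bool) (S : set T) : (Q -> measurable S) -> measurable [set w | Q -> S w].
  case: Q => h.
    rewrite (_ : [set w | _] = S); first exact: h.
    by apply/seteqP; split=> w /= hw //; exact: hw.
  by rewrite (_ : [set w | _] = setT) //; apply/seteqP; split=> w.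
have mle (f : T -> R) c : measurable_fun setT f -> measurable [set w | `|f w| <= (c : R)].
  move=> mf; rewrite (_ : [set w | _] = [set w | - c <= - `|f w|]).
    by apply: measurable_ge_cst; apply: measurableT_comp => //; apply: measurableT_comp.
  by apply/seteqP; split=> w /=; rewrite lerN2.
have mA m : measurable (A m).
  apply: countable_bigcap_measurable; first exact: countableP.
  move=> [[i a] b] /=; apply: measurableI.
    by apply: (mimp) => a01; apply: (mle); exact: mX.
  apply: (mimp) => a01; apply: (mimp) => b01; apply: (mimp) => _.
  by apply: (mle); apply: measurable_funB; exact: mX.
have ndA : nondecreasing_seq A.
  move=> m n mn; apply/subsetPset => w Aw z; have [h1 h2] := Aw z; split.
    by move=> /h1 h; apply: (le_trans h); rewrite ler_nat.
  move=> a01 b01 ab; apply: h2 => //; apply: (lt_le_trans ab).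
  by rewrite lef_pV2 ?posrE // ler_nat ltnS.
have UA : \bigcup_m A m = setT.
  apply/seteqP; split=> // w _.
  have [K hK] : exists K : nat, forall i s, 0 <= s <= 1 -> `|X s w i 0| <= K%:R.
    pose K i := sval (cid (path_bounded (cX w i))).
    have hK i : forall s, 0 <= s <= 1 -> `|X s w i 0| <= K i by rewrite /K; case: cid.
    exists (\max_i (Num.truncn (K i)).+1)%N => i s s01.
    apply: (le_trans (hK i s s01)); apply: (@le_trans _ _ (Num.truncn (K i)).+1%:R).
      exact/ltW/truncnS_gt.
    by rewrite ler_nat (@leq_bigmax _ (fun i => (Num.truncn (K i)).+1) i).
  have [de hde] : exists k : nat, forall i s s', 0 <= s <= 1 -> 0 <= s' <= 1 ->
     `|s - s'| < k.+1%:R^-1 -> `|X s w i 0 - X s' w i 0| <= om.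
    pose D i := (s2val (cid2 (path_uniform_modulus (cX w i) om0)))^-1.
    have hD i : 0 < D i /\ forall s s', 0 <= s <= 1 -> 0 <= s' <= 1 -> `|s - s'| < (D i)^-1 ->
        `|X s w i 0 - X s' w i 0| <= om.
      by rewrite /D invrK; case: cid2 => /= z z0 hz; rewrite invr_gt0.
    exists (\max_i (Num.truncn (D i)).+1)%N => i s s' s01 s'01 ss'.
    apply: (hD i).2 => //; apply: (lt_le_trans ss').
    rewrite lef_pV2 ?posrE //; last exact: (hD i).1.
    apply: (@le_trans _ _ (Num.truncn (D i)).+1%:R); first exact/ltW/truncnS_gt.
    rewrite ler_nat; apply: leqW.
    by rewrite (@leq_bigmax _ (fun i => (Num.truncn (D i)).+1) i).
  exists (maxn K de) => // -[[i a] b] /=; split=> [a01|a01 b01 ab].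
    by apply: (le_trans (hK i _ a01)); rewrite ler_nat leq_maxl.
  apply: hde => //; apply: (lt_le_trans ab).
  by rewrite lef_pV2 ?posrE // ler_nat ltnS leq_maxr.
have mU : measurable (\bigcup_m A m) by rewrite UA.
have := nondecreasing_cvg_mu (mu := P) mA mU ndA; rewrite UA => hcvg.
have [m hm] : exists m, ((1 - e)%:E < P (A m))%E.
  have : \forall m \near \oo, ((1 - e)%:E < P (A m))%E.
    apply: (hcvg [set x | ((1 - e)%:E < x)%E]); apply: open_nbhs_nbhs; split; first exact: open_ereal_gt_ereal.
    by rewrite /= [X in (_ < X)%E](probability_setT P) lte_fin; lra.
  by move=> [N _ hN]; exists N; exact: hN (leqnn N).
exists m.+1%:R, m.+1%:R^-1; split=> //.
exists (~` A m); split; first exact: measurableC.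
- move=> w /= hw Aw; apply: hw => i.
  have [h1 h2] := @path_regular_rational R (fun s => X s w i 0) m%:R m.+1%:R^-1 om (cX w i)
     (fun a => (Aw (i, a, a)).1) (fun a b => (Aw (i, a, b)).2).
  by split=> // s /h1 h; apply: (le_trans h); rewrite ler_nat.
- rewrite probability_setC //; apply: (@le_trans _ _ (1 - (1 - e)%:E)%E).
    by apply: leeB => //; exact: ltW.
  by rewrite -EFinB lee_fin; lra.
Qed.

End regular_paths.

Section bounded_measurable_functions.
Variable R : realType.
Local Notation mu := (@lebesgue_measure R).

Definition bounded_measurable (a b : R) (F : R -> R) : Prop :=
  measurable_fun (`]a, b] : set R) F /\ exists K, forall x, a < x <= b -> `|F x| <= K.

Lemma bounded_measurable_integrable a b F : bounded_measurable a b F ->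
  mu.-integrable `]a, b] (EFin \o F).
Proof.
move=> [mF [K hK]]; apply: measurable_bounded_integrable => //.
  rewrite /= lebesgue_measure_itv /=; case: ifP => _; last by rewrite ltry.
  by rewrite -EFinB ltry.
exists K; split; first exact: num_real.
move=> y Ky x /=; rewrite in_itv /= => xab; exact: (le_trans (hK x xab) (ltW Ky)).
Qed.

Lemma bounded_measurableD a b F G : bounded_measurable a b F -> bounded_measurable a b G ->
  bounded_measurable a b (fun x => F x + G x).
Proof.
move=> [mF [K hK]] [mG [K' hK']]; split; first exact: measurable_funD.
by exists (K + K') => x xab; rewrite (le_trans (ler_normD _ _)) // lerD ?hK ?hK'.
Qed.

Lemma bounded_measurableM a b F G : bounded_measurable a b F -> bounded_measurable a b G ->
  bounded_measurable a b (fun x => F x * G x).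
Proof.
move=> [mF [K hK]] [mG [K' hK']]; split; first exact: measurable_funM.
by exists (K * K') => x xab; rewrite normrM ler_pM ?hK ?hK'.
Qed.

Lemma bounded_measurable_cst a b c : bounded_measurable a b (fun=> c).
Proof. by split=> //; exists `|c|. Qed.

Lemma bounded_measurableB a b F G : bounded_measurable a b F -> bounded_measurable a b G ->
  bounded_measurable a b (fun x => F x - G x).
Proof.
move=> hF hG; rewrite (_ : (fun x => _) = fun x => F x + (-1) * G x).
  by apply: bounded_measurableD => //; apply: bounded_measurableM => //;
     exact: bounded_measurable_cst.
by apply/funext => x; rewrite mulN1r.
Qed.

Lemma bounded_measurable_norm a b F : bounded_measurable a b F ->
  bounded_measurable a b (fun x => `|F x|).
Proof.
move=> [mF [K hK]]; split; first exact: measurableT_comp.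
by exists K => x xab; rewrite normr_id hK.
Qed.

Lemma bounded_measurable_step_fun a b s : bounded_measurable a b (step_fun s : R -> R).
Proof.
split; first by apply: measurable_funTS; exact: measurable_step_fun.
exists (\sum_(q <- s) `|q.2|) => x _.
rewrite (le_trans (ler_norm_sum _ _ _)) //; apply: ler_sum => q _.
by rewrite normrM indic_itv_oc ler_piMr //; case: (_ < _ <= _); rewrite ?normr1 ?normr0.
Qed.

Lemma bounded_measurable_continuous (a b : R) F : {within `[a, b], continuous F} ->
  bounded_measurable a b F.
Proof.
move=> cF; split.
  apply: (@measurable_funS _ _ _ _ `[a, b]%classic) => //.
    by move=> x /=; rewrite !in_itv /= => /andP[/ltW -> ->].
  by apply: subspace_continuous_measurable_fun.
have := continuous_compact cF (@segment_compact R a b).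
move=> /compact_bounded[M [_ hM]]; exists (M + 1) => x /andP[ax xb].
apply: (hM (M + 1)); first by rewrite ltrDl.
by exists x => //=; rewrite in_itv /= ltW.
Qed.

Lemma Rintegral_step_fun (a b : R) s F : bounded_measurable a b F -> step_in a b s ->
  \int[mu]_(x in `]a, b]) (step_fun s x * F x) =
  \sum_(q <- s) q.2 * \int[mu]_(x in `]q.1.1, q.1.2]) F x.
Proof.
move=> hF; elim: s => [|q s IH].
  move=> _; rewrite big_nil; under eq_Rintegral do rewrite /step_fun big_nil mul0r.
  by rewrite Rintegral_cst // mul0r.
move=> /= /andP[/and3P[h1 h2 h3] hs]; rewrite big_cons -IH //.
have hI : bounded_measurable a b (fun x => step_fun [:: (q.1, 1)] x * F x).
  by apply: bounded_measurableM => //; exact: bounded_measurable_step_fun.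
transitivity (\int[mu]_(x in `]a, b])
    (q.2 * (step_fun [:: (q.1, 1)] x * F x) + step_fun s x * F x)).
  by apply: eq_Rintegral => x _; rewrite !step_fun_cons /= /step_fun big_nil; ring.
rewrite RintegralD //; last 2 first.
- apply: bounded_measurable_integrable; apply: bounded_measurableM => //.
  exact: bounded_measurable_cst.
- apply: bounded_measurable_integrable; apply: bounded_measurableM => //.
  exact: bounded_measurable_step_fun.
rewrite RintegralZl //; last exact: bounded_measurable_integrable.
congr (_ * _ + _).
rewrite -[in RHS](@setIidr _ (`]a, b]) `]q.1.1, q.1.2]); last first.
  move=> x /=; rewrite !in_itv /= => /andP[qx xq].
  by rewrite (le_lt_trans h1 qx) (le_trans xq h3).
rewrite Rintegral_mkcondr; apply: eq_Rintegral => x _.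
rewrite step_fun_cons /= /step_fun big_nil addr0 mul1r patchE mem_setE in_itv /=.
by case: (_ < _ <= _); rewrite ?mul1r ?mul0r.
Qed.

End bounded_measurable_functions.

Section path_step_approximation.
Variable R : realType.
Local Notation mu := (@lebesgue_measure R).

Lemma subdivision_cell (a b : R) m u y : subdivision a b m u -> a < y -> y <= b ->
  exists2 i, (i < m)%N & u i < y <= u i.+1.
Proof.
move=> [u0 um _] ay yb.
have ex : exists i, (y <= u i) && (i <= m)%N by exists m; rewrite um yb /=.
case: (ex_minnP ex) => -[|i] /andP[yi im] hi.
  by move: yi; rewrite u0 leNgt ay.
exists i => //; rewrite yi andbT ltNge; apply/negP => h.
by have := hi i; rewrite h ltnW // ltnn => /(_ isT).
Qed.

Definition interpolation_steps (m : nat) (u c : nat -> R) :=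
  [seq ((u i, u i.+1), c i) | i <- index_iota 0 m].

Lemma interpolation_steps_in (a b : R) m u c :
  subdivision a b m u -> step_in a b (interpolation_steps m u c).
Proof.
move=> su; have [u0 um ult] := su.
rewrite /step_in all_map; apply/allP => i; rewrite mem_index_iota /= => im.
by rewrite -u0 -um !(subdivision_le su) // ltnW.
Qed.

Lemma step_fun_interpolation (a b : R) m u c i y : subdivision a b m u -> (i < m)%N ->
  u i < y <= u i.+1 -> step_fun (interpolation_steps m u c) y = c i.
Proof.
move=> su im /andP[ui iu]; rewrite /step_fun big_map big_mkord.
rewrite (bigD1 (Ordinal im)) //= big1 ?addr0.
  by rewrite indic_itv_oc ui iu mulr1.
move=> j ji; rewrite indic_itv_oc [X in _ * (nat_of_bool X)%:R](_ : _ = false) ?mulr0 //.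
apply: contraNF ji => /andP[jx xj]; apply/eqP/val_inj => /=.
have h1 : (j < i.+1)%N by rewrite -(subdivision_ltE su (ltnW (ltn_ord j)) im) (lt_le_trans jx iu).
have h2 : (i < j.+1)%N by rewrite -(subdivision_ltE su (ltnW im) (ltn_ord j)) (lt_le_trans ui xj).
by apply/eqP; rewrite eqn_leq -ltnS h1 -ltnS h2.
Qed.

(** The first sum is the integral of the step function times x, the second that of f = g' times x
    frozen at the left nodes. Their difference splits into (f - step) x, estimated by |z| <= ka +
    z^2 / ka since only an L^2 bound is available, and f times the oscillation of x on a cell. *)
Lemma path_step_approx (x g f : R -> R) (K C om de ka eta a b : R) (m : nat) (u : nat -> R) s :
  {within `[0, 1], continuous x} -> 0 <= a -> b <= 1 ->
  (forall y, 0 <= y <= 1 -> `|x y| <= K) ->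
  (forall y y', 0 <= y <= 1 -> 0 <= y' <= 1 -> `|y - y'| < de -> `|x y - x y'| <= om) ->
  continuous f -> (forall y : R, is_derive y 1 g (f y)) -> 0 <= C ->
  (forall y, a <= y <= b -> `|f y| <= C) -> step_in a b s ->
  0 < ka -> (\int[mu]_(y in `[a, b]) ((f y - step_fun s y) ^+ 2)%:E <= eta%:E)%E ->
  subdivision a b m u -> (forall i, (i < m)%N -> u i.+1 - u i < de) ->
  `|\sum_(q <- s) q.2 * (\int[mu]_(y in `[0, q.1.2]) x y - \int[mu]_(y in `[0, q.1.1]) x y) -
    \sum_(i < m) (g (u i.+1) - g (u i)) * x (u i)| <=
  K * (ka * (b - a) + eta / ka) + C * om * (b - a).
Proof.
move=> cx a0 b1 hK hom cf hg C0 hC sin ka0 heta su mesh.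
have [u0 um ult] := su.
have ab : a <= b by rewrite -u0 -um; exact: (subdivision_le su).
have cw (p q : R) (F : R -> R) : continuous F -> {within `[p, q], continuous F}.
  exact: continuous_subspaceT.
have xab p q : 0 <= p -> q <= 1 -> {within `[p, q], continuous x}.
  move=> p0 q1; apply: continuous_subspaceW cx => y /=.
  by rewrite !in_itv /= => /andP[py yq]; rewrite (le_trans p0) // (le_trans yq).
have bx : bounded_measurable a b x by apply: bounded_measurable_continuous; exact: xab.
have bf : bounded_measurable a b f by apply: bounded_measurable_continuous; exact: cw.
pose xs := interpolation_steps m u (fun i => x (u i)).
have uin i : (i <= m)%N -> a <= u i <= b.
  by move=> im; rewrite -u0 -um !(subdivision_le su).
have xsin : step_in a b xs by exact: interpolation_steps_in.
have -> : \sum_(q <- s) q.2 * (\int[mu]_(y in `[0, q.1.2]) x y - \int[mu]_(y in `[0, q.1.1]) x y)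
   = \int[mu]_(y in `]a, b]) (step_fun s y * x y).
  rewrite Rintegral_step_fun //; apply: eq_big_seq => q qs; congr (_ * _).
  have /allP/(_ q qs)/and3P[h1 h2 h3] := sin.
  have int : mu.-integrable `[0, q.1.2] (EFin \o x).
    apply: continuous_compact_integrable; first exact: segment_compact.
    by apply: xab => //; exact: le_trans b1.
  by rewrite Rintegral_itvB // bnd_simp // (le_trans a0).
have -> : \sum_(i < m) (g (u i.+1) - g (u i)) * x (u i)
   = \int[mu]_(y in `]a, b]) (step_fun xs y * f y).
  rewrite Rintegral_step_fun // /xs /interpolation_steps big_map /= big_mkord.
  apply: eq_bigr => i _; rewrite mulrC; congr (_ * _).
  rewrite Rintegral_itv_obnd_cbnd; last first.
    by apply: bounded_measurable_integrable; apply: bounded_measurable_continuous; exact: cw.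
  have dg y : derivable g y 1 by have [] := hg y.
  have cg y : {for y, continuous g} by apply/differentiable_continuous/derivable1_diffP.
  have := @continuous_FTC2 R f g (u i) (u i.+1) (ult i (ltn_ord i)).
  move=> h; rewrite /Rintegral h //.
  - exact: cw.
  - split.
    + by move=> y _.
    + exact/cvg_at_right_filter/cg.
    + exact/cvg_at_left_filter/cg.
  - by move=> y _; rewrite derive1E; have [_] := hg y.
rewrite -RintegralB //; last 2 first.
- apply: bounded_measurable_integrable; apply: bounded_measurableM => //.
  exact: bounded_measurable_step_fun.
- apply: bounded_measurable_integrable; apply: bounded_measurableM => //.
  exact: bounded_measurable_step_fun.
have bs := @bounded_measurable_step_fun R a b s.
have bxs := @bounded_measurable_step_fun R a b xs.
have bsq : bounded_measurable a b (fun y => (f y - step_fun s y) ^+ 2).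
  by rewrite (_ : (fun y => _) = fun y => (f y - step_fun s y) * (f y - step_fun s y));
    [apply: bounded_measurableM; exact: bounded_measurableB | apply/funext => y; rewrite expr2].
apply: (le_trans (le_normr_Rintegral _ _)) => //.
  apply: bounded_measurable_integrable; apply: bounded_measurableB;
    exact: bounded_measurableM.
have K0 : 0 <= K.
  apply: (le_trans (normr_ge0 (x a))); apply: hK; rewrite a0 /=.
  exact: le_trans b1.
apply: (@le_trans _ _ (\int[mu]_(y in `]a, b]) (K / ka * (f y - step_fun s y) ^+ 2 + (K * ka + C * om)))).
  apply: le_Rintegral => //.
  - apply: bounded_measurable_integrable; apply: bounded_measurable_norm;
    apply: bounded_measurableB; exact: bounded_measurableM.
  - apply: bounded_measurable_integrable; apply: bounded_measurableD; last exact: bounded_measurable_cst.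
    by apply: bounded_measurableM => //; exact: bounded_measurable_cst.
  move=> y; rewrite /= in_itv /= => /andP[ay yb].
  have y01 : 0 <= y <= 1 by rewrite (le_trans a0 (ltW ay)) (le_trans yb).
  rewrite (_ : _ - _ = - ((f y - step_fun s y) * x y) + f y * (x y - step_fun xs y)); last by ring.
  rewrite (le_trans (ler_normD _ _)) // normrN !normrM addrA lerD //.
    set z := f y - step_fun s y.
    have -> : K / ka * z ^+ 2 + K * ka = (`|z| ^+ 2 / ka + ka) * K by rewrite real_normK ?num_real //; ring.
    apply: ler_pM => //; last exact: hK.
    rewrite -(@ler_pM2r _ ka) // mulrDl divfK ?gt_eqF //.
    have := sqr_ge0 (`|z| - ka); have := mulr_ge0 (normr_ge0 z) (ltW ka0); nra.
  apply: ler_pM => //; first by apply: hC; rewrite ltW.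
  have [i im /andP[ui iu]] := subdivision_cell su ay yb.
  rewrite (step_fun_interpolation _ su im) ?ui //.
  apply: hom => //; first by have /andP[h1 h2] := uin i (ltnW im); rewrite (le_trans a0) // (le_trans h2).
  rewrite ger0_norm; last by rewrite subr_ge0 ltW.
  by apply: le_lt_trans (mesh i im); rewrite lerB.
rewrite RintegralD //; last 2 first.
- by apply: bounded_measurable_integrable; apply: bounded_measurableM => //; exact: bounded_measurable_cst.
- by apply: bounded_measurable_integrable; exact: bounded_measurable_cst.
rewrite RintegralZl //; last exact: bounded_measurable_integrable.
rewrite Rintegral_cst //.
have -> : fine (mu `]a, b]) = b - a.
  rewrite lebesgue_measure_itv /= lte_fin; case: ltP => // ba.
  by apply/esym/eqP; rewrite subr_eq0 eq_le ba.
rewrite (_ : _ + C * om * (b - a) = K / ka * eta + (K * ka + C * om) * (b - a)); last by ring.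
rewrite lerD2r ler_wpM2l //; first by rewrite divr_ge0 // ltW.
rewrite Rintegral_itv_obnd_cbnd; last exact: bounded_measurable_integrable.
rewrite -lee_fin; apply: (le_trans _ heta); rewrite /Rintegral fineK //.
have i0 : (0 <= \int[mu]_(y in `[a, b]) ((f y - step_fun s y) ^+ 2)%:E)%E.
  by apply: integral_ge0 => y _; rewrite lee_fin sqr_ge0.
by rewrite ge0_fin_numE // (le_lt_trans heta) // ltry.
Qed.

End path_step_approximation.

Section observed_processes.
Context d (T : measurableType d) (R : realType) (P : probability T R).
Local Notation mu := (@lebesgue_measure R).
Variables (q : nat) (X W Y : R -> T -> 'cV[R]_q) (en : R).
Hypothesis cX : forall w i, {within `[0, 1], continuous (fun s => X s w i 0)}.
Hypothesis hY : forall s, 0 <= s <= 1 -> {ae P, forall w, forall i,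
  Y s w i 0 = Y 0 w i 0 + \int[mu]_(y in `[0, s]) (X y w i 0) + en * W s w i 0}.

Lemma step_int_observation s : step_in 0 1 s ->
  {ae P, forall w, forall i, step_int (fun y w => Y y w i 0) s w =
    \sum_(p <- s) p.2 * (\int[mu]_(y in `[0, p.1.2]) (X y w i 0) - \int[mu]_(y in `[0, p.1.1]) (X y w i 0))
    + en * step_int (fun y w => W y w i 0) s w}.
Proof.
elim: s => [|p s IH].
  by move=> _; apply: aeW => w i; rewrite /step_int !big_nil mulr0 addr0.
move=> /= /andP[/and3P[h1 h2 h3] hs].
have p1 : 0 <= p.1.1 <= 1 by rewrite h1 (le_trans h2).
have p2 : 0 <= p.1.2 <= 1 by rewrite h3 (le_trans h1).
apply: filterS3 (hY p1) (hY p2) (IH hs) => w e1 e2 e3 i.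
move: (e3 i); rewrite /step_int !big_cons => ->; rewrite (e1 i) (e2 i).
by ring.
Qed.

Definition regular_path_event (K de om : R) : set T := [set w | forall i,
    (forall s, 0 <= s <= 1 -> `|X s w i 0| <= K) /\
    (forall s s', 0 <= s <= 1 -> 0 <= s' <= 1 -> `|s - s'| < de ->
        `|X s w i 0 - X s' w i 0| <= om)].

(** An integral of f = g' against Y becomes a sum of increments of g against X, plus noise. The
    noise keeps the same step functions that approximate f, so its variance is controlled by f. *)
Lemma functional_approx (a b om K de C e : R) (g f : R -> R) (Q : 'I_q -> T -> R)
    (m : nat) (u : nat -> R) :
  0 <= a -> b <= 1 -> 0 < K ->
  0 <= C -> continuous f -> (forall y : R, is_derive y 1 g (f y)) ->
  (forall y, a <= y <= b -> `|f y| <= C) ->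
  (forall i, approximable P (fun s w => Y s w i 0) a b f (Q i)) ->
  subdivision a b m u -> (forall i, (i < m)%N -> u i.+1 - u i < de) -> 0 < e ->
  exists st : 'I_q -> seq (R * R * R),
   [/\ forall i, step_in a b (st i),
       forall i, (\int[mu]_(y in `[a, b]) ((f y - step_fun (st i) y) ^+ 2)%:E <= e%:E)%E &
       outer_le P [set w | regular_path_event K de om w /\ exists i, C * om * (b - a) + e <=
         `|Q i w - (\sum_(j < m) (g (u j.+1) - g (u j)) * X (u j) w i 0 +
              en * step_int (fun y w => W y w i 0) (st i) w)|] e].
Proof.
move=> a0 b1 K0 C0 cf hg hC hQ su mesh e0.
pose ka := e / (4 * K); have ka0 : 0 < ka by rewrite divr_gt0 // mulr_gt0.
(* The three bounds serve the L^2 and probability errors, the drift error e' / ka, and the union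
   over the q coordinates. *)
pose e' := Num.min (e / 4) (Num.min (ka * e / (4 * K)) (e / q.+1%:R)).
have e'0 : 0 < e'.
  rewrite /e' !lt_min; apply/and3P; split; apply: divr_gt0 => //; exact: mulr_gt0.
have e'e : e' <= e / 4 by rewrite ge_min lexx.
have e'k : e' <= ka * e / (4 * K) by rewrite !ge_min lexx orbT.
have e'q : e' <= e / q.+1%:R by rewrite !ge_min lexx !orbT.
have /choice[st hst] : forall i, exists s, [/\ step_in a b s,
    (\int[mu]_(y in `[a, b]) ((f y - step_fun s y) ^+ 2)%:E <= e'%:E)%E &
    outer_le P [set w | e' <= `|step_int (fun s w => Y s w i 0) s w - Q i w|] e'].
  by move=> i; have [_ /(_ e' e'0)] := hQ i.
exists st; split.
- by move=> i; have [] := hst i.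
- move=> i; have [_ h _] := hst i; apply: (le_trans h); rewrite lee_fin (le_trans e'e) //.
  by rewrite ler_pdivrMr // ler_peMr ?ltW // ltr1n.
have hin i : step_in 0 1 (st i) by have [h _ _] := hst i; exact: step_inS h.
have ho : outer_le P [set w | exists i, e' <= `|step_int (fun s w => Y s w i 0) (st i) w - Q i w|] (\sum_(i < q) e').
  by apply: outer_le_bigcup => i; have [] := hst i.
have ha : outer_le P [set w | exists i, ~ (forall i', step_int (fun y w => Y y w i' 0) (st i) w =
    \sum_(p <- st i) p.2 * (\int[mu]_(y in `[0, p.1.2]) (X y w i' 0) - \int[mu]_(y in `[0, p.1.1]) (X y w i' 0))
    + en * step_int (fun y w => W y w i' 0) (st i) w)] (\sum_(i < q) 0).
  by apply: outer_le_bigcup => i; apply: outer_le_ae; exact: step_int_observation.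
apply: outer_le_sub (outer_leU ho ha); last first.
  rewrite sumr_const sumr_const mul0rn addr0 card_ord -mulr_natr.
  apply: (@le_trans _ _ (e / q.+1%:R * q%:R)); first exact: ler_wpM2r.
  by rewrite -mulrA ler_piMr ?(ltW e0) // ler_pdivrMl // mulr1 ler_nat.
move=> w /= [hw [i hi]].
have [h2|h2] := pselect (exists i, e' <= `|step_int (fun s w => Y s w i 0) (st i) w - Q i w|); first by left.
right; exists i => h3.
have h4 : `|step_int (fun s w => Y s w i 0) (st i) w - Q i w| < e'.
  by rewrite ltNge; apply/negP => h; apply: h2; exists i.
have [hK hom] := hw i; have [s1 s2 _] := hst i.
have h5 := @path_step_approx R (fun s => X s w i 0) g f K C om de ka e' a b m u (st i) (@cX w i) a0 b1 hK hom cf hg C0 hC s1 ka0 s2 su mesh.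
have h6 : K * (ka * (b - a) + e' / ka) <= e / 2.
  have -> : e / 2 = K * (ka + e / (4 * K)) by rewrite /ka; field; rewrite gt_eqF.
  rewrite ler_wpM2l ?(ltW K0) // lerD //.
    by rewrite ler_piMr ?(ltW ka0) //; lra.
  by rewrite ler_pdivrMr // mulrC mulrA.
move: hi; apply/negP; rewrite -ltNge.
set A := \sum_(j < m) _; rewrite h3 in h4.
move: h4 h5; set D := \sum_(p <- st i) _; set Z := en * _ => h4 h5.
rewrite (_ : Q i w - (A + Z) = (D - A) - (D + Z - Q i w)); last by ring.
apply: (le_lt_trans (ler_normB _ _)).
have h7 : `|D + Z - Q i w| < e / 4 by exact: lt_le_trans e'e.
by move: h5 h6 h7 e0; rewrite /A; set v := K * _; lra.
Qed.

End observed_processes.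

(** * Localised waves and their realisation by the scores *)

Section test_functions.
Variable R : realType.

Definition cos_height (x : R) : R := (1 + cos (pi * x)) / 2.
(** The inverse on [0, 1] of the decreasing map [cos_height], so intervals change orientation when
    passing between height and time. *)
Definition cos_angle (z : R) : R := acos (2 * z - 1) / pi.
Definition wave (al be x : R) : R := sin (pi * x) * bump al be (cos_height x).

Lemma cos_angle_bounds z : 0 <= z <= 1 -> 0 <= cos_angle z <= 1.
Proof.
move=> /andP[z0 z1]; have z11 : -1 <= 2 * z - 1 <= 1 by lra.
have p0 := pi_gt0 R; rewrite divr_ge0 ?acos_ge0 //=; last exact: ltW.
by rewrite ler_pdivrMr // mul1r acos_lepi.
Qed.

Lemma cos_angleK z : 0 <= z <= 1 -> cos (pi * cos_angle z) = 2 * z - 1.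
Proof.
move=> /andP[z0 z1]; have z11 : 2 * z - 1 \in `[-1, 1].
  by rewrite in_itv /=; lra.
by rewrite /cos_angle mulrC divfK ?gt_eqF ?pi_gt0 // acosK.
Qed.

Lemma pi_scale_in (x : R) : 0 <= x <= 1 -> pi * x \in `[0, pi].
Proof.
move=> /andP[x0 x1]; have p0 := pi_gt0 R.
by rewrite in_itv /= mulr_ge0 ?(ltW p0) //= ler_piMr // ltW.
Qed.

Lemma cos_angle_lt x z : 0 <= x <= 1 -> 0 <= z <= 1 -> (cos_angle z < x) = (cos_height x < z).
Proof.
move=> x01 z01; rewrite -(@ltr_pM2l _ pi) ?pi_gt0 //.
rewrite -(ltr_cos (pi_scale_in (cos_angle_bounds z01)) (pi_scale_in x01)) cos_angleK //.
by rewrite /cos_height ltr_pdivrMr //; apply/idP/idP; lra.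
Qed.

Lemma lt_cos_angle x z : 0 <= x <= 1 -> 0 <= z <= 1 -> (x < cos_angle z) = (z < cos_height x).
Proof.
move=> x01 z01; rewrite -(@ltr_pM2l _ pi) ?pi_gt0 //.
rewrite -(ltr_cos (pi_scale_in x01) (pi_scale_in (cos_angle_bounds z01))) cos_angleK //.
by rewrite /cos_height ltr_pdivlMr //; apply/idP/idP; lra.
Qed.

Lemma cos_angle_anti z z' : 0 <= z <= 1 -> 0 <= z' <= 1 -> (cos_angle z < cos_angle z') = (z' < z).
Proof.
move=> z01 z'01; rewrite cos_angle_lt ?cos_angle_bounds // /cos_height cos_angleK //.
by rewrite ltr_pdivrMr //; apply/idP/idP; lra.
Qed.

Lemma wave_support (al be x : R) : 0 <= al <= 1 -> 0 <= be <= 1 -> 0 <= x <= 1 ->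
  ~~ (cos_angle be < x < cos_angle al) -> wave al be x = 0.
Proof.
move=> al01 be01 x01; rewrite cos_angle_lt // lt_cos_angle // andbC => h.
by rewrite /wave bump_out // mulr0.
Qed.

(** On the middle half of [al, be] both distances to the edges are at least w, a quarter of its
    length, and so are y and 1 - y for y = [cos_height x]. The squared sine 4 y (1 - y) gives w^2
    and the squared bump w^8. *)
Lemma wave_lower (al be : R) : 0 <= al -> al < be -> be <= 1 -> exists p p' c : R,
  [/\ cos_angle be <= p, p < p', p' <= cos_angle al, 0 < c &
      forall x, p <= x <= p' -> c <= wave al be x ^+ 2].
Proof.
move=> al0 ab be1; pose w := (be - al) / 4.
have w0 : 0 < w by rewrite divr_gt0 // subr_gt0.
have wE : be = al + 4 * w by rewrite /w; field.
clearbody w.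
have b01 : 0 <= be - w <= 1 by move: w0; rewrite wE; lra.
have a01 : 0 <= al + w <= 1 by move: w0 be1; rewrite wE; lra.
exists (cos_angle (be - w)), (cos_angle (al + w)), (w ^+ 10); split.
- by rewrite ltW // cos_angle_anti //; lra.
- by rewrite cos_angle_anti //; move: w0; rewrite wE; lra.
- by rewrite ltW // cos_angle_anti //; lra.
- exact: exprn_gt0.
move=> x /andP[px xp].
have x01 : 0 <= x <= 1.
  have /andP[h1 _] := cos_angle_bounds b01; have /andP[_ h2] := cos_angle_bounds a01.
  by rewrite (le_trans h1 px) (le_trans xp).
have h1 : cos_height x <= be - w by rewrite leNgt -lt_cos_angle // -leNgt.
have h2 : al + w <= cos_height x by rewrite leNgt -cos_angle_lt // -leNgt.
have sE : sin (pi * x) ^+ 2 = 4 * (cos_height x * (1 - cos_height x)).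
  by rewrite sin2cos2 /cos_height; field.
set y := cos_height x in h1 h2 sE *.
rewrite /wave exprMn sE -/y (_ : w ^+ 10 = w ^+ 2 * (w ^+ 2 * w ^+ 2) ^+ 2); last by ring.
have wy : w <= y by lra.
have wy' : w <= 1 - y by lra.
apply: ler_pM.
- exact: sqr_ge0.
- exact: sqr_ge0.
- have : w * w <= y * (1 - y) by apply: ler_pM => //; exact: ltW.
  by rewrite expr2; have := mulr_gt0 w0 w0; lra.
- rewrite -/y /bump !sqr_posE !ifT; [|by lra|by lra].
  have wsq z : w <= z -> w ^+ 2 <= z ^+ 2.
    by move=> wz; rewrite !expr2; apply: ler_pM => //; exact: ltW.
  have hh : w ^+ 2 * w ^+ 2 <= (y - al) ^+ 2 * (be - y) ^+ 2.
    by apply: ler_pM; rewrite ?sqr_ge0 //; apply: wsq; lra.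
  have ww0 : 0 <= w ^+ 2 * w ^+ 2 by apply: mulr_ge0; exact: sqr_ge0.
  by rewrite [leLHS]expr2 [leRHS]expr2; exact: ler_pM.
Qed.

Lemma is_derive_Phi (t h : R) j (s : R) : is_derive s 1 (Phi t h j)
  (Num.sqrt (2 / h) * (j%:R * pi / h * cos (j%:R * pi * (s - t) / h))).
Proof.
pose k := j%:R * pi / h.
have kE y : j%:R * pi * (y - t) / h = k * y + (- (k * t)).
  by rewrite /k; generalize (pi : R) => p; ring.
rewrite -/k kE (_ : Phi t h j = fun y => Num.sqrt (2 / h) * sin (k * y + (- (k * t)))); last first.
  by apply/funext => y; rewrite /Phi kE.
clearbody k.
apply: is_derive_eq; rewrite /GRing.scale /=.
by set c := cos _; ring.
Qed.

Lemma continuous_big_sum n (F : nat -> R -> R) : (forall j, continuous (F j)) ->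
  continuous (fun y => \sum_(j < n) F j y).
Proof.
move=> h; elim: n => [|n IH] y.
  rewrite (_ : (fun y => _) = cst 0); first exact: cvg_cst.
  by apply/funext => z; rewrite big_ord0.
rewrite (_ : (fun y => _) = (fun y => \sum_(j < n) F j y + F n y)).
  by apply: cvgD; [exact: IH | exact: h].
by apply/funext => z; rewrite big_ord_recr.
Qed.

End test_functions.

Section score_approximation.
Context d (T : measurableType d) (R : realType) (P : probability T R).
Variables (q : nat) (X W Y : R -> T -> 'cV[R]_q) (en t h : R) (S : nat -> T -> 'cV[R]_q).
Hypothesis mX : forall s i, 0 <= s <= 1 -> measurable_fun setT (fun w => X s w i 0).
Hypothesis cX : forall w i, {within `[0, 1], continuous (fun s => X s w i 0)}.
Hypothesis hY : forall s, 0 <= s <= 1 -> {ae P, forall w, forall i,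
  Y s w i 0 = Y 0 w i 0 + \int[lebesgue_measure]_(y in `[0, s]) (X y w i 0) + en * W s w i 0}.
Hypotheses (t0 : 0 <= t) (h0 : 0 < h) (th1 : t + h <= 1).
Hypothesis hS : forall j i, (0 < j)%N ->
  approximable P (fun s w => Y s w i 0) t (t + h) (derive1 (Phi t h j)) (fun w => S j w i 0).

(** The order of choices avoids a circle. The derivative bound C is the same for every sine
    polynomial supplied by [sine_approximation], so the modulus [om] and then the mesh are fixed
    before the polynomial, whose uniform accuracy is allowed to depend on the number m of cells. The
    list [pts] forces the edges of the blocks into the grid. *)
Lemma score_approx (al be e : R) (pts : seq R) : 0 <= al -> be <= 1 -> 0 < e ->
  (forall x, x \in pts -> t <= x <= t + h) ->
  let psi s := Num.sqrt (2 / h) * wave al be ((s - t) / h) in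
  exists J (a : nat -> R) m u (st : 'I_q -> seq (R * R * R)),
  [/\ \sum_(j < J) (a j * j.+1%:R ^+ 2) ^+ 2 <= 200,
     subdivision t (t + h) m u,
     (forall x, x \in pts -> exists2 i, (i <= m)%N & u i = x),
     (forall i, step_in t (t + h) (st i)) &
     outer_le P [set w | exists i, e <= `|\sum_(j < J) a j * S j.+1 w i 0 -
        (\sum_(g < m) (psi (u g.+1) - psi (u g)) * X (u g) w i 0 +
          en * step_int (fun s w => W s w i 0) (st i) w)|] e].
Proof.
move=> al0 be1 e0 hpts psi; have p0 := pi_gt0 R.
pose A := Num.sqrt (2 / h); have A0 : 0 <= A by exact: sqrtr_ge0.
pose C := A * (pi / h) * 3.
have Aph0 : 0 <= A * (pi / h) by apply: mulr_ge0 => //; apply: divr_ge0; exact: ltW.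
have C0 : 0 <= C by exact: mulr_ge0.
have Ch0 : 0 < C * h + 1 by rewrite ltr_pwDr // mulr_ge0 // ltW.
pose om := e / (4 * (C * h + 1)).
have om0 : 0 < om by rewrite divr_gt0 // mulr_gt0.
have e40 : 0 < e / 4 by rewrite divr_gt0.
have [K [de [K0 de0 hreg]]] := path_regular P mX (@cX) om0 e40.
have tth : t < t + h by rewrite ltrDl.
have de20 : 0 < de / 2 by rewrite divr_gt0.
have [m [u [su mesh hu]]] := subdivision_exists tth de20 hpts.
(* Replacing g by psi changes each of the m increments by at most 2 A e2, against a path bounded by
   K; the total is at most e / 4. *)
pose e2 := e / (4 * (2 * m.+1%:R * K * (A + 1))).
have A10 : 0 < A + 1 by rewrite ltr_pwDr.
have D0 : 0 < 2 * m.+1%:R * K * (A + 1) by rewrite !mulr_gt0.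
have e20 : 0 < e2 by rewrite divr_gt0 // mulr_gt0.
have [J [a [a1 a2 a3]]] := sine_approximation al0 be1 e20.
pose th s := pi * ((s - t) / h).
have thE j s : j.+1%:R * pi * (s - t) / h = j.+1%:R * th s.
  by rewrite /th; generalize (pi : R) => p; ring.
pose g s := \sum_(j < J) a j * Phi t h j.+1 s.
pose f s := \sum_(j < J) a j * derive1 (Phi t h j.+1) s.
have dPhi j s : derive1 (Phi t h j) s = A * (j%:R * pi / h * cos (j%:R * pi * (s - t) / h)).
  by rewrite derive1E; have [_ ->] := is_derive_Phi t h j s.
have hg (y : R) : is_derive y 1 g (f y).
  apply: (@is_derive_big_sum _ J (fun j y => a j * Phi t h j.+1 y) (fun j y => a j * derive1 (Phi t h j.+1) y)) => j.
  have ->: a j * derive1 (Phi t h j.+1) y = a j *: derive1 (Phi t h j.+1) y by [].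
  by apply: is_deriveZ; rewrite dPhi; exact: is_derive_Phi.
have fE y : f y = A * (pi / h) * \sum_(j < J) a j * (j.+1%:R * cos (j.+1%:R * th y)).
  rewrite /f mulr_sumr; apply: eq_bigr => j _; rewrite dPhi thE.
  by generalize (pi : R) (cos (j.+1%:R * th y)) => p c; ring.
have cf : continuous f.
  rewrite (_ : f = fun y => \sum_(j < J) a j * (A * (j.+1%:R * pi / h * cos (j.+1%:R * pi * (y - t) / h)))); last first.
    by apply/funext => y; apply: eq_bigr => j _; rewrite dPhi.
  apply: (@continuous_big_sum _ J (fun j y => a j * (A * (j.+1%:R * pi / h * cos (j.+1%:R * pi * (y - t) / h))))) => j y.
  apply: cvgM; first exact: cvg_cst.
  apply: cvgM; first exact: cvg_cst.
  apply: cvgM; first exact: cvg_cst.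
  apply: (@continuous_comp _ _ _ (fun y => j.+1%:R * pi * (y - t) / h) cos); last exact: continuous_cos.
  apply: cvgM; last exact: cvg_cst.
  apply: cvgM; first exact: cvg_cst.
  by apply: cvgB; [exact: cvg_id | exact: cvg_cst].
have hC y : t <= y <= t + h -> `|f y| <= C.
  move=> _; rewrite fE normrM ger0_norm /C; last exact: Aph0.
  exact: ler_wpM2l.
have gE y : `|g y - psi y| <= A * e2.
  have -> : g y - psi y = A * (\sum_(j < J) a j * sin (j.+1%:R * th y) -
                 sin (th y) * bump al be ((1 + cos (th y)) / 2)).
    rewrite mulrBr /g /psi /wave mulr_sumr; congr (_ - _); apply: eq_bigr => j _.
    by rewrite /Phi thE -/A; ring.
  by rewrite normrM ger0_norm // ler_wpM2l.
have hQ i : approximable P (fun s w => Y s w i 0) t (t + h) f (fun w => \sum_(j < J) a j * S j.+1 w i 0).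
  by apply: (approximable_sum (fun j => a j) (f := fun j => derive1 (Phi t h j.+1))
      (V := fun j w => S j.+1 w i 0)) => j _; exact: hS.
have mesh' i : (i < m)%N -> u i.+1 - u i < de.
  by move=> /mesh h1; rewrite (le_lt_trans h1) // ltr_pdivrMr // ltr_pMr // ltr1n.
have hreg' : outer_le P (~` regular_path_event X K de om) (e / 4) by exact: hreg.
have [st [st1 _ st3]] := functional_approx (@cX) hY om t0 th1 K0 C0 cf hg hC hQ su mesh' e40.
exists J, a, m, u, st; split=> //.
apply: outer_le_sub (outer_leU hreg' st3); last by lra.
move=> w /= [i hi].
have [hw|hw] := pselect (regular_path_event X K de om w); last by left.
right; split=> //; exists i; have [hK _] := hw i.
set Q := \sum_(j < J) _ in hi *; set Z := en * _ in hi *.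
have hdiff : `|\sum_(j < m) (g (u j.+1) - g (u j)) * X (u j) w i 0 -
    \sum_(j < m) (psi (u j.+1) - psi (u j)) * X (u j) w i 0| <= e / 4.
  rewrite -sumrB; apply: (le_trans (ler_norm_sum _ _ _)).
  apply: (@le_trans _ _ (\sum_(j < m) 2 * (A * e2) * K)).
    apply: ler_sum => j _; rewrite -mulrBl normrM; apply: ler_pM => //.
      rewrite (_ : _ - _ - _ = (g (u j.+1) - psi (u j.+1)) - (g (u j) - psi (u j))); last by ring.
      by rewrite (le_trans (ler_normB _ _)) // mulr2n mulrDl mul1r lerD.
    apply: hK; have [ua ub _] := su.
    have h1 := subdivision_le su (leq0n j) (ltnW (ltn_ord j)).
    have h2 := subdivision_le su (ltnW (ltn_ord j)) (leqnn m).
    by rewrite ua in h1; rewrite ub in h2; rewrite (le_trans t0 h1) (le_trans h2).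
  rewrite sumr_const card_ord -[leLHS]mulr_natr.
  apply: (@le_trans _ _ (2 * ((A + 1) * e2) * K * m.+1%:R)).
    apply: ler_pM; last by rewrite ler_nat.
    - by apply: mulr_ge0; [apply: mulr_ge0 => //; apply: mulr_ge0 => //; exact: ltW | exact: ltW].
    - by [].
    apply: ler_wpM2r; first exact: ltW.
    by rewrite ler_wpM2l // ler_wpM2r ?lerDl // ltW.
  rewrite (_ : _ * m.+1%:R = e / 4) // /e2; field.
  by rewrite !gt_eqF.
have hom : C * om * h <= e / 4.
  rewrite /om (_ : _ * h = (e / 4) * ((C * h) / (C * h + 1))); last first.
    by field; rewrite gt_eqF.
  by rewrite ler_piMr ?(ltW e40) // ler_pdivrMr // mul1r lerDl.
set B := \sum_(j < m) _ in hi hdiff *; set B' := \sum_(j < m) _ in hi hdiff *.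
rewrite (addrC t) addrK; have := ler_distD (B' + Z) Q (B + Z).
rewrite (_ : B' + Z - (B + Z) = B' - B); last by ring.
move=> h1; have [//|h2] := leP (C * om * h + e / 4) `|Q - (B' + Z)|.
by move: h1 h2 hdiff hom hi e0; lra.
Qed.

End score_approximation.

(** * The signal and its anticoncentration *)

Section signal.
Context d (T : measurableType d) (R : realType) (P : probability T R).
Local Notation mu := (@lebesgue_measure R).

(** The integrals up to different times u become integrals over [0, 1] of truncated integrands,
    which can then be added. *)
Lemma approximable_extend (Z : R -> T -> R) (u : R) (f : R -> R) (V : T -> R) :
  0 <= u <= 1 -> measurable_fun (`[0, 1] : set R) f -> approximable P Z 0 u f V ->
  approximable P Z 0 1 (fun x => (0 < x <= u)%R%:R * f x) V.
Proof.
move=> /andP[u0 u1] mf [_ hf]; split.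
  apply: measurable_funM => //; apply: measurable_funTS.
  rewrite (_ : (fun x => _) = \1_(`]0, u]) :> (R -> R)); first exact: measurable_indic.
  by apply/funext => x; rewrite indic_itv_oc.
move=> e e0; have [s [s1 s2 s3]] := hf e e0; exists s; split=> //.
  by apply: step_inS s1.
apply: le_trans s2.
have sub : `[0, u] `<=` (`[0, 1] : set R).
  by move=> x /=; rewrite !in_itv /= => /andP[-> xu]; rewrite (le_trans xu).
have mfu : measurable_fun (`[0, u] : set R) f by exact: measurable_funS mf.
have gE x : ((0 < x <= u)%R%:R * f x - step_fun s x) ^+ 2 = (0 < x <= u)%R%:R * (f x - step_fun s x) ^+ 2.
  have [h|h] := boolP (0 < x <= u); first by rewrite !mul1r.
  by rewrite !mul0r (step_fun_out s1) // subr0 expr0n.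
under eq_integral do rewrite gE.
rewrite [leRHS](_ : _ = (\int[mu]_(x in `[0%R, 1%R] `&` `[0%R, u]) ((f x - step_fun s x) ^+ 2)%:E)%E); last first.
  by rewrite setIidr.
rewrite integral_mkcondr.
apply: ge0_le_integral => //.
- by move=> x _; rewrite lee_fin mulr_ge0 ?sqr_ge0.
- apply/measurable_EFinP; apply: measurable_funM.
    apply: measurable_funTS.
    rewrite (_ : (fun x => _) = \1_(`]0, u]) :> (R -> R)); first exact: measurable_indic.
    by apply/funext => x; rewrite indic_itv_oc.
  by apply/measurable_EFinP; exact: measurable_sqr_diff.
- apply/(measurable_restrict _ _ _).1 => //.
  by rewrite setIidr //; exact: measurable_sqr_diff.
- move=> x _; rewrite patchE mem_setE in_itv /=.
  have [/andP[h1 h2]|h] := boolP (0 < x <= u); first by rewrite (ltW h1) h2 mul1r.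
  by rewrite mul0r; case: ifP => // _; rewrite lee_fin sqr_ge0.
Qed.

(** The integrand obtained by inserting X(u_g) = X(0) + int_0^(u_g) sigma dB into the sum of
    (psi(u_(g+1)) - psi(u_g)) X(u_g). By Abel summation it is - psi at the right end of each
    cell. *)
Definition grid_fun (psi : R -> R) (m : nat) (u : nat -> R) (s : R) : R :=
  \sum_(g < m) (psi (u g.+1) - psi (u g)) * (0 < s <= u g)%R%:R.

Lemma grid_fun_cell (psi : R -> R) (a b : R) m u i s : subdivision a b m u -> 0 <= a ->
  psi b = 0 -> (i < m)%N -> u i < s <= u i.+1 -> grid_fun psi m u s = - psi (u i.+1).
Proof.
move=> su a0 pb im /andP[us su']; have [u0 um _] := su.
have s0 : 0 < s by apply: le_lt_trans us; rewrite (le_trans a0) // -u0 (subdivision_le su) // ltnW.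
transitivity (\sum_(g < m | (i.+1 <= g)%N) (psi (u g.+1) - psi (u g))).
  rewrite [RHS]big_mkcond /=; apply: eq_bigr => g _; rewrite s0 /=.
  have -> : (s <= u g) = (i < g)%N.
    apply/idP/idP => [h|h].
      by rewrite -(subdivision_ltE su (ltnW im) (ltnW (ltn_ord g))) (lt_le_trans us).
    by rewrite (le_trans su') // (subdivision_leE su) // ltnW.
  by case: ifP => _; rewrite ?mulr1 ?mulr0.
have h := telescope_sumr (fun k => psi (u k)) (im : (i.+1 <= m)%N).
rewrite um pb sub0r in h; rewrite -h big_geq_mkord /=.
by [].
Qed.

Lemma grid_fun_out (psi : R -> R) (a b : R) m u s : subdivision a b m u -> 0 <= a ->
  psi a = 0 -> psi b = 0 -> ~~ (a < s <= b) -> grid_fun psi m u s = 0.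
Proof.
move=> su a0 pa pb hs; have [u0 um _] := su.
have [s0|s0] := leP s 0.
  by rewrite /grid_fun big1 // => g _; rewrite ltNge s0 /= mulr0.
move: hs; rewrite negb_and -!leNgt -ltNge => /orP[sa|bs].
  have h := telescope_sumr (fun k => psi (u k)) (leq0n m).
  rewrite um pb u0 pa subrr big_mkord in h; rewrite -[RHS]h.
  apply: eq_bigr => g _; rewrite s0 (le_trans sa) ?mulr1 // -u0.
  by rewrite (subdivision_le su) // ltnW.
rewrite /grid_fun big1 // => g _; rewrite [X in (_ && X)](_ : _ = false) ?andbF ?mulr0 //.
apply/negbTE; rewrite -ltNge; apply: le_lt_trans bs.
by rewrite -um (subdivision_le su) // ltnW.
Qed.

Section brownian_integrals.
Variables (q p : nat) (B : R -> T -> 'cV[R]_q) (X : R -> T -> 'cV[R]_p) (sig : R -> 'M[R]_(p, q)).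
Hypothesis bmB : brownian_motion P B.
Hypothesis msig : forall i k, measurable_fun (`[0, 1] : set R) (fun s => sig s i k).
Hypothesis hX : forall s, 0 <= s <= 1 -> exists J : T -> 'M[R]_(p, q),
  (forall i k, stoch_integral P (fun u w => B u w k 0) 0 s (fun u => sig u i k) (fun w => J w i k)) /\
  {ae P, forall w, X s w = X 0 w + \col_i \sum_k J w i k}.

(** The coefficient of X(0) telescopes to psi b - psi a = 0, so the initial value drops out whatever
    its law and its dependence on B. *)
Lemma signal_approximable (psi : R -> R) (a b : R) m u : 0 <= a -> b <= 1 ->
  subdivision a b m u -> psi a = 0 -> psi b = 0 ->
  exists V : T -> 'M[R]_(p, q),
   (forall i k, approximable P (fun s w => B s w k 0) 0 1
       (fun s => grid_fun psi m u s * sig s i k) (fun w => V w i k)) /\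
   {ae P, forall w, forall i, \sum_(g < m) (psi (u g.+1) - psi (u g)) * X (u g) w i 0 =
       \sum_k V w i k}.
Proof.
move=> a0 b1 su pa pb; have [u0 um _] := su; have [mB _ _ _] := bmB.
have u01 g : (g <= m)%N -> 0 <= u g <= 1.
  move=> gm; rewrite (le_trans a0) /=; last by rewrite -u0 (subdivision_le su).
  by rewrite (le_trans _ b1) // -um (subdivision_le su).
have /choice[J hJ] : forall g, exists J : T -> 'M[R]_(p, q), (g < m)%N ->
    (forall i k, stoch_integral P (fun u w => B u w k 0) 0 (u g) (fun u => sig u i k) (fun w => J w i k)) /\
    {ae P, forall w, X (u g) w = X 0 w + \col_i \sum_k J w i k}.
  move=> g; have [gm|gm] := ltnP g m; last by exists (fun=> 0).
  by have [J hJ] := hX (u01 g (ltnW gm)); exists J.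
exists (fun w => \matrix_(i, k) \sum_(g < m) (psi (u g.+1) - psi (u g)) * J g w i k); split.
  move=> i k.
  rewrite (_ : (fun s => _) = fun s => \sum_(g < m) (psi (u g.+1) - psi (u g)) * ((0 < s <= u g)%R%:R * sig s i k)); last first.
    by apply/funext => s; rewrite /grid_fun mulr_suml; apply: eq_bigr => g _; rewrite mulrA.
  rewrite (_ : (fun w => _) = fun w => \sum_(g < m) (psi (u g.+1) - psi (u g)) * J g w i k); last first.
    by apply/funext => w; rewrite mxE.
  apply: (approximable_sum (fun g => psi (u g.+1) - psi (u g))
    (f := fun g s => (0 < s <= u g)%R%:R * sig s i k) (V := fun g w => J g w i k)) => g gm.
  have ug := u01 g (ltnW gm); have /andP[ug0 ug1] := ug.
  apply: approximable_extend => //; apply: stoch_integral_approximable.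
  - by move=> x /andP[x0 x1]; apply: mB; rewrite x0 (le_trans x1).
  - apply: measurable_funS (msig i k) => //.
    by move=> x /=; rewrite !in_itv /= => /andP[-> xu]; rewrite (le_trans xu).
  - by have [+ _] := hJ g gm; apply.
have hae : {ae P, forall w, forall g, (g < m)%N -> X (u g) w = X 0 w + \col_i \sum_k J g w i k}.
  apply/ae_foralln => g; have [gm|gm] := ltnP g m; last by apply: aeW.
  by have [_ h] := hJ g gm; apply: filterS h => w.
apply: filterS hae => w hw i.
under eq_bigr => g _ do rewrite (hw g (ltn_ord g)) !mxE mulrDr.
rewrite big_split /= -mulr_suml.
have h := telescope_sumr (fun k => psi (u k)) (leq0n m).
rewrite um pb u0 pa subrr big_mkord in h; rewrite h mul0r add0r.
under eq_bigr do rewrite mulr_sumr.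
rewrite exchange_big /=; apply: eq_bigr => k _.
by rewrite mxE.
Qed.

Definition clamp (lo hi x : R) : R := Num.max lo (Num.min hi x).

Definition clamp_steps (lo hi : R) (s : seq (R * R * R)) :=
  [seq ((clamp lo hi z.1.1, clamp lo hi z.1.2), z.2) | z <- s].

Lemma clamp_steps_in (a b lo hi : R) s : lo <= hi -> step_in a b s ->
  step_in lo hi (clamp_steps lo hi s).
Proof.
move=> lh hs; rewrite /step_in all_map; apply/allP => z zs /=.
have /allP/(_ z zs)/and3P[_ h _] := hs.
rewrite /clamp; apply/and3P; split.
- by rewrite le_max lexx.
- rewrite ge_max !le_max lexx /=; apply/orP; right.
  by rewrite le_min !ge_min lexx /= h orbT.
- by rewrite ge_max lh ge_min lexx.
Qed.

Lemma step_fun_clamp (lo hi : R) s x : lo < x <= hi ->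
  step_fun (clamp_steps lo hi s) x = step_fun s x.
Proof.
move=> /andP[lx xh]; rewrite /step_fun big_map; apply: eq_bigr => z _ /=.
rewrite !indic_itv_oc /clamp gt_max lx /= gt_min ltNge xh /= le_max leNgt lx /= le_min xh /=.
by [].
Qed.

(** Clamping the endpoints to [lo, hi] keeps the step function on ]lo, hi] and kills it elsewhere,
    where f vanishes, so the L^2 error does not grow. The difference of the two step integrals is
    Gaussian with small variance, hence small in probability. *)
Lemma truncated_steps (lo hi e : R) k (f : R -> R) (V : T -> R) :
  0 <= lo -> lo <= hi -> hi <= 1 -> (forall x, ~~ (lo < x <= hi) -> f x = 0) ->
  approximable P (fun s w => B s w k 0) 0 1 f V -> 0 < e ->
  exists st, [/\ step_in lo hi st,
    (\int[mu]_(x in `[0%R, 1%R]) ((f x - step_fun st x) ^+ 2)%:E <= e%:E)%E &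
    outer_le P [set w | e <= `|step_int (fun s w => B s w k 0) st w - V w|] e].
Proof.
move=> lo0 lh hi1 fout [mf hf] e0; have [mB _ _ _] := bmB.
(* A variance of at most e^3 / 24 makes the tail bound 3 v / (e / 2)^2 at most e / 2. *)
pose e' := Num.min (e / 2) (e ^+ 3 / 24).
have e30 : 0 < e ^+ 3 by exact: exprn_gt0.
have e'0 : 0 < e' by rewrite /e' lt_min !divr_gt0.
have e'1 : e' <= e / 2 by rewrite ge_min lexx.
have e'2 : e' <= e ^+ 3 / 24 by rewrite ge_min lexx orbT.
have [s [s1 s2 s3]] := hf e' e'0.
pose st := clamp_steps lo hi s.
have stin : step_in lo hi st by exact: clamp_steps_in s1.
have st01 : step_in 0 1 st by exact: step_inS stin.
have h1 : (\int[mu]_(x in `[0%R, 1%R]) ((f x - step_fun st x) ^+ 2)%:E <= e'%:E)%E.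
  apply: le_trans s2; apply: ge0_le_integral => //.
  - by move=> x _; rewrite lee_fin sqr_ge0.
  - exact: measurable_sqr_diff.
  - exact: measurable_sqr_diff.
  move=> x _; rewrite lee_fin; have [h|h] := boolP (lo < x <= hi).
    by rewrite /st step_fun_clamp.
  by rewrite fout // (step_fun_out stin) // subrr expr0n sqr_ge0.
pose D := s ++ scale_steps (-1) st.
pose Dk k' := if k' == k then D else [::].
have [|v gv hv] := @multi_step_int_gaussian _ _ _ P _ B bmB Dk.
  by move=> k'; rewrite /Dk; case: eqP => // _; rewrite step_in_cat s1 step_in_scale.
have DE w : multi_step_int B Dk w = step_int (fun s w => B s w k 0) s w - step_int (fun s w => B s w k 0) st w.
  rewrite /multi_step_int (bigD1 k) //= big1 ?addr0.
    by rewrite /Dk eqxx /D step_int_cat step_int_scale mulN1r.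
  by move=> k' /negbTE kk; rewrite /Dk kk /step_int big_nil.
have ve' : v <= e'.
  rewrite -lee_fin hv (bigD1 k) //= big1 ?adde0.
    rewrite /Dk eqxx; apply: le_trans s2; apply: ge0_le_integral => //.
    - by move=> x _; rewrite lee_fin sqr_ge0.
    - apply/measurable_EFinP; apply: measurable_funX; apply: measurable_funTS.
      exact: measurable_step_fun.
    - exact: measurable_sqr_diff.
    move=> x _; rewrite lee_fin step_fun_cat step_fun_scale mulN1r.
    have [h|h] := boolP (lo < x <= hi).
      by rewrite /st step_fun_clamp // subrr expr0n sqr_ge0.
    by rewrite fout // (step_fun_out stin) // subr0 sub0r sqrrN.
  move=> k' /negbTE kk; rewrite /Dk kk; under eq_integral do rewrite /step_fun big_nil expr0n.
  by rewrite integral0.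
have e20 : 0 < e / 2 by rewrite divr_gt0.
exists st; split=> //.
  by apply: (le_trans h1); rewrite lee_fin (le_trans e'1) // ler_pdivrMr // ler_peMr ?ltW // ltr1n.
have tail : outer_le P [set w | e / 2 <= `|multi_step_int B Dk w|] (e / 2).
  apply: outer_le_self; first by apply: measurable_ge_cst; apply: measurableT_comp => //; case: gv.
  apply: (le_trans (centered_gaussian_tail gv e20)); rewrite lee_fin.
  rewrite ler_pdivrMr ?exprn_gt0 // (_ : e / 2 * _ = 3 * (e ^+ 3 / 24)); last by field.
  by rewrite ler_wpM2l // (le_trans ve').
apply: outer_le_sub (outer_leU s3 tail); last by lra.
move=> w /= hw; have [h2|h2] := leP e' `|step_int (fun s w => B s w k 0) s w - V w|; first by left.
right; rewrite DE; rewrite leNgt; apply/negP => h3.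
have := ler_distD (step_int (fun s w => B s w k 0) s w) (step_int (fun s w => B s w k 0) st w) (V w).
by rewrite distrC in h3; lra.
Qed.

End brownian_integrals.
End signal.

Section variance.
Variable R : realType.
Local Notation mu := (@lebesgue_measure R).
Variables (n q r : nat) (sig : R -> 'M[R]_(n, q)) (lam rho c2 p p' : R) (phi : R -> R).
Hypothesis rn : (r < n)%N.
Hypothesis psd : forall s, 0 <= s <= 1 -> spd (sig s *m (sig s)^T).
Hypotheses (p0 : 0 <= p) (pp : p < p') (p'1 : p' <= 1) (lam0 : 0 < lam) (c20 : 0 <= c2).
Hypothesis rhoE : rho <= c2 * (p' - p).
Hypothesis hlam : forall s, p < s <= p' -> lam <= eigval r.+1 (sig s *m (sig s)^T).
Hypothesis hphi : forall s, p < s <= p' -> c2 <= phi s ^+ 2.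
Hypothesis mphi : forall j k, measurable_fun (`[0, 1] : set R) (fun s => phi s * sig s j k).

Lemma variance_bound (e : R) (st : 'I_n -> 'I_q -> seq (R * R * R)) : 0 <= e ->
  (forall j k, \int[mu]_(x in `[0%R, 1%R]) ((phi x * sig x j k - step_fun (st j k) x) ^+ 2)%:E <= e%:E)%E ->
  (n - r)%:R * (n%:R * q%:R * e) <= lam * rho / 4 ->
  forall U : 'M[R]_(r, n), exists x : 'rV[R]_n, [/\ nsq x = 1, U *m x^T = 0 &
    ((lam * rho / (4 * (n - r)%:R))%:E <= \sum_k \int[mu]_(s in `[0%R, 1%R])
       ((\sum_j x 0 j * step_fun (st j k) s) ^+ 2)%:E)%E].
Proof.
move=> e0 hst he U; have [V VV UV] := orthonormal_complement U rn.
pose V0 := lam * rho / (4 * (n - r)%:R).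
have nr0 : 0 < (n - r)%:R :> R by rewrite ltr0n subn_gt0.
pose H (ik : 'I_(n - r) * 'I_q) s := (\sum_j V ik.1 j * step_fun (st j ik.2) s) ^+ 2.
pose D (z : 'I_(n - r) * ('I_n * 'I_q)) s := (phi s * sig s z.2.1 z.2.2 - step_fun (st z.2.1 z.2.2) s) ^+ 2.
have mst j k : measurable_fun (`[0, 1] : set R) (step_fun (st j k)).
  by apply: measurable_funTS; exact: measurable_step_fun.
have mH ik : measurable_fun (`[0, 1] : set R) (fun s => (H ik s)%:E).
  apply/measurable_EFinP; apply: measurable_funX; apply: measurable_sum => j.
  by apply: measurable_funM.
have mD z : measurable_fun (`[0, 1] : set R) (fun s => (D z s)%:E).
  by apply: measurable_sqr_diff.
have nV i : nsq (row i V) = 1.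
  have := congr1 (fun A : 'M[R]_(n - r) => A i i) VV; rewrite !mxE eqxx => VVi.
  by rewrite nsqE; apply: etrans VVi; apply: eq_bigr => j _; rewrite !mxE expr2.
(* Pointwise b^2 + (phi a - b)^2 >= (phi a)^2 / 2, where b is the step version of phi a; summing
   over rows and coordinates, the trace bound supplies lam. *)
have key s : 0 <= s <= 1 ->
   lam * c2 / 2 * (p < s <= p')%R%:R <= \sum_ik H ik s + \sum_z D z s.
  move=> s01; have [hs|hs] := boolP (p < s <= p'); last first.
    by rewrite mulr0 addr_ge0 // sumr_ge0 // => z _; exact: sqr_ge0.
  rewrite mulr1.
  have h1 := qform_trace_ge (psd s01) rn _ VV (hlam hs).
  have {}h1 : lam <= \sum_i \sum_k (\sum_j V i j * sig s j k) ^+ 2.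
    apply: (le_trans (h1 _)); first by rewrite subnK // ltnW.
    apply: ler_sum => i _.
    have -> : qform (sig s *m (sig s)^T) (row i V) = nsq (row i V *m sig s).
      by rewrite /qform /nsq trmx_mul !mulmxA.
    rewrite nsqE; apply: ler_sum => k _; rewrite mxE.
    by under eq_bigr do rewrite mxE.
  have h2 : phi s ^+ 2 / 2 * \sum_i \sum_k (\sum_j V i j * sig s j k) ^+ 2 <=
      \sum_ik H ik s + \sum_z D z s.
    rewrite mulr_sumr.
    have -> : \sum_ik H ik s = \sum_i \sum_k H (i, k) s.
      by rewrite pair_big /=; apply: eq_bigr => -[].
    have -> : \sum_z D z s = \sum_(i < n - r) \sum_k \sum_j D (i, (j, k)) s.
      transitivity (\sum_(i < n - r) \sum_jk D (i, jk) s).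
        by rewrite pair_big /=; apply: eq_bigr => -[].
      apply: eq_bigr => i _; rewrite exchange_big pair_big /=; apply: eq_bigr => -[] //.
    rewrite -big_split; apply: ler_sum => i _; rewrite mulr_sumr -big_split /=.
    apply: ler_sum => k _.
    set a := \sum_j V i j * sig s j k; set b := \sum_j V i j * step_fun (st j k) s.
    have hd : (phi s * a - b) ^+ 2 <= \sum_j D (i, (j, k)) s.
      have -> : phi s * a - b = \sum_j V i j * (phi s * sig s j k - step_fun (st j k) s).
        by rewrite mulr_sumr -sumrB; apply: eq_bigr => j _; ring.
      apply: (le_trans (sum_cauchy_schwarz _ _)).
      have -> : \sum_j V i j ^+ 2 = 1.
        by rewrite -(nV i) nsqE; apply: eq_bigr => j _; rewrite mxE.
      by rewrite mul1r.
    apply: (@le_trans _ _ (b ^+ 2 + (phi s * a - b) ^+ 2)); last by rewrite lerD2l.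
    by have := sqr_ge0 (phi s * a - 2 * b); lra.
  apply: le_trans h2; have := hphi hs; move: lam0 c20 h1; set z := \sum_i _ => l0 c0 h1 h3.
  have h4 : lam * c2 <= z * phi s ^+ 2 by apply: ler_pM => //; exact: ltW.
  by rewrite (_ : phi s ^+ 2 / 2 * z = z * phi s ^+ 2 / 2); [lra | ring].
have [//|hno] := pselect (exists x : 'rV[R]_n, [/\ nsq x = 1, U *m x^T = 0 &
    (V0%:E <= \sum_k \int[mu]_(s in `[0%R, 1%R])
       ((\sum_j x 0 j * step_fun (st j k) s) ^+ 2)%:E)%E]).
exfalso.
have hi i : exists2 v : R, v < V0 & (\sum_k \int[mu]_(s in `[0%R, 1%R]) (H (i, k) s)%:E = v%:E)%E.
  have a0 : (0 <= \sum_k \int[mu]_(s in `[0%R, 1%R]) (H (i, k) s)%:E)%E.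
    by apply: sume_ge0 => k _; apply: integral_ge0 => s _; rewrite lee_fin sqr_ge0.
  have a1 : (\sum_k \int[mu]_(s in `[0%R, 1%R]) (H (i, k) s)%:E < V0%:E)%E.
    rewrite ltNge; apply/negP => h; apply: hno; exists (row i V); split=> //.
      apply/matrixP => a b; have := congr1 (fun A : 'M[R]_(r, n - r) => A a i) UV.
      by rewrite !mxE => h'; apply: etrans h'; apply: eq_bigr => j _; rewrite !mxE.
    apply: (le_trans h); apply: lee_sum => k _; rewrite le_eqVlt; apply/orP; left; apply/eqP.
    by apply: eq_integral => s _; congr (_ ^+ 2)%:E; apply: eq_bigr => j _; rewrite !mxE.
  exists (fine (\sum_k \int[mu]_(s in `[0%R, 1%R]) (H (i, k) s)%:E)%E).
    by rewrite -lte_fin fineK // ge0_fin_numE // (lt_trans a1) ?ltry.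
  by rewrite fineK // ge0_fin_numE // (lt_trans a1) ?ltry.
have {hi} /choice[v hv] : forall i, exists v : R, v < V0 /\
    (\sum_k \int[mu]_(s in `[0%R, 1%R]) (H (i, k) s)%:E = v%:E)%E.
  by move=> i; have [v] := hi i; exists v.
have cI : 0 <= lam * c2 / 2 by rewrite divr_ge0 // mulr_ge0 // ltW.
have : ((lam * c2 / 2 * (p' - p))%:E <= (\sum_i v i)%:E + ((n - r)%:R * (n%:R * q%:R * e))%:E)%E.
  apply: (@le_trans _ _ (\int[mu]_(s in `[0%R, 1%R]) (lam * c2 / 2 * (p < s <= p')%R%:R)%:E)%E).
    under eq_integral do rewrite EFinM.
    have mi : measurable_fun (`[0, 1] : set R) (fun s => ((p < s <= p')%R%:R : R)%:E).
      apply/measurable_EFinP; apply: measurable_funTS.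
      rewrite (_ : (fun x => _) = \1_(`]p, p']) :> (R -> R)); first exact: measurable_indic.
      by apply/funext => x; rewrite indic_itv_oc.
    rewrite ge0_integralZl // EFinM lee_wpmul2l //.
    under eq_integral do rewrite -indic_itv_oc.
    rewrite integral_indic // setIidl; last first.
      by move=> x /=; rewrite !in_itv /= => /andP[px xp]; rewrite (le_trans p0 (ltW px)) (le_trans xp).
    by rewrite /= lebesgue_measure_itv /= lte_fin pp.
  apply: (@le_trans _ _ (\int[mu]_(s in `[0%R, 1%R]) (\sum_ik (H ik s)%:E + \sum_z (D z s)%:E))%E).
    apply: ge0_le_integral => //.
    - by move=> s _; rewrite lee_fin mulr_ge0.
    - apply/measurable_EFinP; apply: measurable_funM => //; apply: measurable_funTS.
      rewrite (_ : (fun x => _) = \1_(`]p, p']) :> (R -> R)); first exact: measurable_indic.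
      by apply/funext => x; rewrite indic_itv_oc.
    - by apply: emeasurable_funD; apply: emeasurable_sum.
    - move=> s; rewrite /= in_itv /= => s01; rewrite !sumEFin -EFinD lee_fin.
      exact: key.
  rewrite ge0_integralD //; last 4 first.
  - by move=> s _; apply: sume_ge0 => z _; rewrite lee_fin sqr_ge0.
  - exact: emeasurable_sum.
  - by move=> s _; apply: sume_ge0 => z _; rewrite lee_fin sqr_ge0.
  - exact: emeasurable_sum.
  rewrite !ge0_integral_sum //; try by move=> z s _; rewrite lee_fin sqr_ge0.
  apply: leeD.
    rewrite -sumEFin (eq_bigr (fun ik => \int[mu]_(s in `[0%R, 1%R]) (H (ik.1, ik.2) s)%:E)%E); last by case.
    rewrite -(pair_big xpredT xpredT (fun i k => \int[mu]_(s in `[0%R, 1%R]) (H (i, k) s)%:E)%E) /=.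
    by apply: lee_sum => i _; have [_ ->] := hv i.
  apply: (@le_trans _ _ (\sum_(z : 'I_(n - r) * ('I_n * 'I_q)) e%:E)%E).
    by apply: lee_sum => z _; exact: hst.
  by rewrite sumEFin lee_fin sumr_const !card_prod !card_ord -[leLHS]mulr_natl !natrM !mulrA.
rewrite -EFinD lee_fin; apply/negP; rewrite -ltNge.
have hsum : \sum_i v i < (n - r)%:R * V0.
  have i0 : 'I_(n - r) by apply: (@Ordinal _ 0%N); rewrite subn_gt0.
  rewrite mulr_natl -[X in _ *+ X]card_ord -sumr_const (bigD1 i0) //= [ltRHS](bigD1 i0) //=.
  apply: ltr_leD; first by have [] := hv i0.
  by apply: ler_sum => i _; have [/ltW] := hv i.
have V0E : (n - r)%:R * V0 = lam * rho / 4.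
  by rewrite /V0; field; rewrite gt_eqF.
have hr : lam * rho <= lam * (c2 * (p' - p)) by rewrite ler_pM2l.
by move: hsum V0E hr he; lra.
Qed.

End variance.

Section shifted_signal.
Context d (T : measurableType d) (R : realType) (P : probability T R).
Local Notation mu := (@lebesgue_measure R).
Variables (n q r : nat) (B : R -> T -> 'cV[R]_q) (sig : R -> 'M[R]_(n, q)).
Variables (lam rho : R) (lo hi p p' c2 : 'I_r.+1 -> R) (phi : 'I_r.+1 -> R -> R).
Variables (V : 'I_r.+1 -> T -> 'M[R]_(n, q)) (G : T -> 'M[R]_(r.+1, n)).
Hypothesis bmB : brownian_motion P B.
Hypothesis rn : (r < n)%N.
Hypothesis psd : forall s, 0 <= s <= 1 -> spd (sig s *m (sig s)^T).
Hypotheses (lam0 : 0 < lam) (rho0 : 0 < rho).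
Hypothesis blk : forall l, [/\ 0 <= lo l, lo l <= p l, p l < p' l, p' l <= hi l & hi l <= 1].
Hypothesis disj : forall l l' x, l != l' -> lo l < x <= hi l -> ~~ (lo l' < x <= hi l').
Hypothesis c20 : forall l, 0 <= c2 l.
Hypothesis rhoE : forall l, rho <= c2 l * (p' l - p l).
Hypothesis hlam : forall l s, p l < s <= p' l -> lam <= eigval r.+1 (sig s *m (sig s)^T).
Hypothesis hphi : forall l s, p l < s <= p' l -> c2 l <= phi l s ^+ 2.
Hypothesis phi_out : forall l s, ~~ (lo l < s <= hi l) -> phi l s = 0.
Hypothesis hV : forall l i k, approximable P (fun s w => B s w k 0) 0 1
       (fun s => phi l s * sig s i k) (fun w => V l w i k).
Hypothesis hG : {ae P, forall w, forall l i, G w l i = \sum_k V l w i k}.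

Lemma shifted_anticoncentration (K e : R) (c : 'M[R]_(r.+1, n)) l : 0 < K -> 0 < e ->
  outer_le P [set w | row_near_span l (G w + c) K]
    (r.+1%:R * (2 * Num.sqrt (16 * r.+1%:R * K / (lam * rho / (4 * (n - r)%:R)))) + e).
Proof.
move=> K0 e0.
have nr0 : 0 < (n - r)%:R :> R by rewrite ltr0n subn_gt0.
have lr0 : 0 < lam * rho by exact: mulr_gt0.
pose N := r.+1%:R * n.+1%:R * q.+1%:R : R.
have N1 : 1 <= N by rewrite /N -!natrM ler1n !muln_gt0.
have N0 : 0 < N by exact: lt_le_trans N1.
pose e' := Num.min (lam * rho / 4 / ((n - r)%:R * N)) (Num.min (e / N) (Num.min 1 K / (N * N))).
have e'0 : 0 < e'.
  rewrite /e' !lt_min; apply/and3P; split; apply: divr_gt0 => //; try exact: mulr_gt0.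
  by rewrite lt_min ltr01.
have e'1 : e' <= lam * rho / 4 / ((n - r)%:R * N) by rewrite ge_min lexx.
have e'2 : e' <= e / N by rewrite !ge_min lexx orbT.
have e'3 : e' <= Num.min 1 K / (N * N) by rewrite !ge_min lexx !orbT.
have /choice[st hst] : forall z : 'I_r.+1 * ('I_n * 'I_q), exists s, [/\ step_in (lo z.1) (hi z.1) s,
    (\int[mu]_(x in `[0%R, 1%R]) ((phi z.1 x * sig x z.2.1 z.2.2 - step_fun s x) ^+ 2)%:E <= e'%:E)%E &
    outer_le P [set w | e' <= `|step_int (fun s w => B s w z.2.2 0) s w - V z.1 w z.2.1 z.2.2|] e'].
  move=> [l' [j k]] /=; have [b1 b2 b3 b4 b5] := blk l'.
  apply: (truncated_steps bmB b1 _ b5 _ (hV l' j k)) => //.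
    by rewrite (le_trans b2) // (le_trans (ltW b3)).
  by move=> x hx; rewrite phi_out // mul0r.
pose sts l' j k := st (l', (j, k)).
pose M w := step_matrix B sts w.
have lo0 l' : 0 <= lo l' by have [] := blk l'.
have hi1 l' : hi l' <= 1 by have [] := blk l'.
have stin l' j k : step_in (lo l') (hi l') (sts l' j k) by have [] := hst (l', (j, k)).
(* A factor 4 for the perturbation, and 4 (r + 1) for singling out a row again. *)
pose K3 := 16 * r.+1%:R * K.
have K30 : 0 < K3 by rewrite !mulr_gt0.
pose V0 := lam * rho / (4 * (n - r)%:R).
have V00 : 0 < V0 by rewrite divr_gt0 // mulr_gt0.
have hM l' : outer_le P [set w | row_near_span l' (M w + c) K3] (2 * Num.sqrt (K3 / V0)).
  have mB x k : 0 <= x <= 1 -> measurable_fun setT (fun w => B x w k 0).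
    by have [mB _ _ _] := bmB; exact: mB.
  apply: outer_le_self.
    apply: measurable_row_near_span => i j.
    rewrite (_ : (fun w => _) = fun w => (\sum_k step_int (fun s w => B s w k 0) (sts i j k) w) + c i j); last first.
      by apply/funext => w; rewrite !mxE.
    apply: measurable_funD => //; apply: measurable_sum => k.
    apply: (@measurable_step_int _ _ _ _ 0 1) => [x x01|]; first exact: mB.
    exact: step_inS (stin i j k).
  apply: (block_anticoncentration bmB lo0 hi1 stin disj) => // U.
  have [b1 b2 b3 b4 b5] := blk l'.
  have p0 : 0 <= p l' by exact: le_trans b2.
  have p'1 : p' l' <= 1 by exact: le_trans b5.
  have mphi j k : measurable_fun (`[0, 1] : set R) (fun s => phi l' s * sig s j k).
    by have [] := hV l' j k.
  have hste j k : (\int[mu]_(x in `[0%R, 1%R]) ((phi l' x * sig x j k - step_fun (sts l' j k) x) ^+ 2)%:E <= e'%:E)%E.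
    by have [] := hst (l', (j, k)).
  have he' : (n - r)%:R * (n%:R * q%:R * e') <= lam * rho / 4.
    apply: (@le_trans _ _ ((n - r)%:R * (N * e'))).
      rewrite ler_wpM2l // ler_wpM2r ?(ltW e'0) // /N -!natrM ler_nat.
      by apply: leq_mul => //; apply: (leq_trans (leqnSn n)); rewrite leq_pmull.
    by rewrite mulrA mulrC -ler_pdivlMr // mulr_gt0.
  have [x [x1 x2 x3]] := (@variance_bound R n q r sig lam rho (c2 l') (p l') (p' l') (phi l') rn psd p0 b3 p'1 lam0
    (c20 l') (rhoE l') (@hlam l') (@hphi l') mphi e' (sts l') (ltW e'0) hste he' U).
  by exists x.
have ho : outer_le P [set w | exists z : 'I_r.+1 * ('I_n * 'I_q),
    e' <= `|step_int (fun s w => B s w z.2.2 0) (st z) w - V z.1 w z.2.1 z.2.2|]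
    (\sum_(z : 'I_r.+1 * ('I_n * 'I_q)) e').
  by apply: outer_le_bigcup => z; have [] := hst z.
have hae := outer_le_ae hG.
apply: outer_le_sub (outer_leU (outer_le_bigcup hM) (outer_leU ho hae)); last first.
  apply: lerD; first by rewrite sumr_const card_ord -[leLHS]mulr_natl.
  rewrite addr0 sumr_const !card_prod !card_ord -[leLHS]mulr_natl.
  apply: (@le_trans _ _ (N * e')).
    rewrite ler_wpM2r ?(ltW e'0) // /N -!natrM ler_nat mulnA.
    by rewrite leq_mul // leq_mul.
  by rewrite mulrC -ler_pdivlMr.
move=> w /= hw.
have [hg|hg] := pselect (forall l i, G w l i = \sum_k V l w i k); last by right; right.
have [hz|hz] := pselect (exists z : 'I_r.+1 * ('I_n * 'I_q),
    e' <= `|step_int (fun s w => B s w z.2.2 0) (st z) w - V z.1 w z.2.1 z.2.2|); first by right; left.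
left.
have hent l' j : `|M w l' j - G w l' j| <= q%:R * e'.
  rewrite hg mxE /multi_step_int -sumrB (le_trans (ler_norm_sum _ _ _)) //.
  rewrite mulr_natl -[X in _ *+ X]card_ord -sumr_const; apply: ler_sum => k _.
  by rewrite leNgt; apply/negP => h; apply: hz; exists (l', (j, k)); exact: ltW.
have hd : \sum_i nsq (row i ((G w + c) - (M w + c))) <= K.
  apply: (@le_trans _ _ (\sum_(i < r.+1) \sum_(j < n) (q%:R * e') ^+ 2)).
    apply: ler_sum => i _; rewrite nsqE; apply: ler_sum => j _; rewrite !mxE.
    rewrite -[leLHS]real_normK ?num_real // ler_pXn2r ?nnegrE ?normr_ge0 //.
      rewrite opprD addrACA subrr addr0 distrC; have := hent i j; by rewrite !mxE.
    by rewrite mulr_ge0 // ltW.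
  under eq_bigr do rewrite sumr_const card_ord.
  rewrite sumr_const card_ord -mulrnA -[leLHS]mulr_natl.
  have h1 : (q%:R * e') ^+ 2 <= q%:R ^+ 2 * e'.
    rewrite exprMn ler_wpM2l ?sqr_ge0 // expr2 ler_piMr ?(ltW e'0) //.
    apply: (le_trans e'3); rewrite ler_pdivrMr ?mulr_gt0 // mul1r ge_min.
    by rewrite (le_trans N1) //= ler_peMr // ltW.
  apply: (@le_trans _ _ ((N * N) * e')).
    apply: (le_trans (ler_wpM2l _ h1)) => //; rewrite mulrA ler_wpM2r ?(ltW e'0) //.
    rewrite /N -natrX -!natrM ler_nat; apply: (@leq_trans (r.+1 * n.+1 * q.+1 * q.+1)%N).
      by rewrite -mulnn (mulnC n) -!mulnA; do !apply: leq_mul.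
    by rewrite leq_mul // leq_pmull.
  by rewrite mulrC -ler_pdivlMr ?mulr_gt0 // (le_trans e'3) // ler_wpM2r ?ge_min ?lexx ?orbT // invr_ge0 mulr_ge0 // ltW.
have := nearly_dependent_perturb hd (row_near_span_nearly_dependent (ltW K0) hw).
have K40 : 0 < 4 * K by exact: mulr_gt0.
move=> /(nearly_dependent_row_near_span K40)[l' hl']; exists l'.
by move: hl'; rewrite (_ : 4 * r.+1%:R * (4 * K) = K3) // /K3; ring.
Qed.

End shifted_signal.

Section wave_blocks.
Variable R : realType.

(** The blocks have equal length in the variable [cos_height]. In time, block l runs from the angle
    of edge l + 1 to that of edge l. *)
Definition block_edge (r l : nat) : R := l%:R / r.+1%:R.

Lemma block_edge01 r (l : nat) : (l <= r.+1)%N -> 0 <= block_edge r l <= 1.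
Proof.
move=> lr; rewrite /block_edge divr_ge0 //= ler_pdivrMr // mul1r ler_nat.
by [].
Qed.

Lemma block_edge_lt r (l l' : nat) : (block_edge r l < block_edge r l') = (l < l')%N.
Proof. by rewrite /block_edge ltr_pM2r ?invr_gt0 // ltr_nat. Qed.

(** All these constants depend on r alone. The product of the minima with 1 is a positive number
    below each single one, which yields a common [rho]. *)
Lemma wave_blocks (r : nat) : exists (p p' c : 'I_r.+1 -> R) (rho : R),
  [/\ 0 < rho,
      forall l : 'I_r.+1, [/\ cos_angle (block_edge r l.+1) <= p l, p l < p' l,
                   p' l <= cos_angle (block_edge r l) & 0 < c l],
      forall l, rho <= 2 * c l * (p' l - p l) &
      forall (l : 'I_r.+1) x, p l <= x <= p' l -> c l <= wave (block_edge r l) (block_edge r l.+1) x ^+ 2].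
Proof.
have /choice[z hz] : forall l : 'I_r.+1, exists z : R * R * R,
  [/\ cos_angle (block_edge r l.+1) <= z.1.1, z.1.1 < z.1.2,
                   z.1.2 <= cos_angle (block_edge r l), 0 < z.2 &
     forall x, z.1.1 <= x <= z.1.2 -> z.2 <= wave (block_edge r l) (block_edge r l.+1) x ^+ 2].
  move=> l; have /andP[h1 _] := block_edge01 (ltnW (ltn_ord l)).
  have /andP[_ h2] := block_edge01 (ltn_ord l).
  have h3 : block_edge r l < block_edge r l.+1 by rewrite block_edge_lt.
  have [p [p' [c hc]]] := wave_lower h1 h3 h2.
  by exists (p, p', c).
pose f l := 2 * (z l).2 * ((z l).1.2 - (z l).1.1).
have f0 l : 0 < f l.
  by have [_ h _ c0 _] := hz l; rewrite /f !mulr_gt0 // subr_gt0.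
exists (fun l => (z l).1.1), (fun l => (z l).1.2), (fun l => (z l).2), (\prod_l Num.min 1 (f l)); split.
- by apply: prodr_gt0 => l _; rewrite lt_min ltr01 f0.
- by move=> l; have [] := hz l.
- move=> l; rewrite (bigD1 l) //= -[leRHS]mulr1; apply: ler_pM.
  + by rewrite le_min ler01 ltW.
  + by apply: prodr_ge0 => i _; rewrite le_min ler01 ltW.
  + by rewrite ge_min lexx orbT.
  + by apply: prodr_ile1 => i _; rewrite le_min ler01 (ltW (f0 i)) /= ge_min lexx.
- by move=> l; have [] := hz l.
Qed.

End wave_blocks.

Section decoupled_signal.
Context d (T : measurableType d) (R : realType) (P : probability T R).
Variables (q r n : nat) (X W : R -> T -> 'cV[R]_n).
Hypothesis mX : forall s i, 0 <= s <= 1 -> measurable_fun setT (fun w => X s w i 0).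
Hypothesis mW : forall s i, 0 <= s <= 1 -> measurable_fun setT (fun w => W s w i 0).
Hypothesis indXW : indep_process P X W.
Variables (m : 'I_r.+1 -> nat) (u : 'I_r.+1 -> nat -> R) (psi : 'I_r.+1 -> R -> R).
Variables (st : 'I_r.+1 -> 'I_n -> seq (R * R * R)) (en : R).
Hypothesis u01 : forall l g, (g < m l)%N -> 0 <= u l g <= 1.
Hypothesis st01 : forall l i, step_in 0 1 (st l i).

Definition signal_part (w : T) : 'M[R]_(r.+1, n) :=
  \matrix_(l, i) \sum_(g < m l) (psi l (u l g.+1) - psi l (u l g)) * X (u l g) w i 0.

Definition noise_part (w : T) : 'M[R]_(r.+1, n) :=
  \matrix_(l, i) (en * step_int (fun s w => W s w i 0) (st l i) w).

(** By independence of X and W the noise can be frozen: the signal part reads X only at finitely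
    many nodes, the noise part reads only W. *)
Lemma decoupled_row_near_span (l : 'I_r.+1) (K b : R) :
  (forall c, (P [set w | row_near_span l (signal_part w + c) K] <= b%:E)%E) ->
  (P [set w | row_near_span l (signal_part w + noise_part w) K] <= b%:E)%E.
Proof.
move=> hc.
pose gen q' (Z : R -> T -> 'cV[R]_q') := [set A : set T | exists s k (A' : set R),
         [/\ 0 <= s <= 1, measurable A' & A = [set w | A' (Z s w k 0)]]].
have genm q' (Z : R -> T -> 'cV[R]_q') : (forall s i, 0 <= s <= 1 -> measurable_fun setT (fun w => Z s w i 0)) ->
    gen q' Z `<=` measurable.
  move=> mZ _ [s [k [A' [s01 mA' ->]]]].
  by have := mZ s k s01 measurableT _ mA'; rewrite setTI.
have genf q' (Z : R -> T -> 'cV[R]_q') s i : 0 <= s <= 1 ->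
    measurable_fun [set: g_sigma_algebraType (gen q' Z)] (fun w => Z s w i 0).
  move=> s01 _ A mA; rewrite setTI; apply: sub_gen_smallest.
  by exists s, i, A.
apply: (@decoupling_set_le _ _ _ P (gen n X) (gen n W) (genm _ _ mX) (genm _ _ mW) _
   [set z | row_near_span l (signal_part z.1 + noise_part z.2) K]).
- by move=> A B hA hB; exact: indXW.
- apply: measurable_row_near_span => i j.
  rewrite (_ : (fun w => _) = (fun z =>
    \sum_(g < m i) (psi i (u i g.+1) - psi i (u i g)) * X (u i g) z.1 j 0 +
    en * step_int (fun s w => W s w j 0) (st i j) z.2)); last first.
    by apply/funext => z; rewrite !mxE.
  apply: measurable_funD.
    apply: measurable_sum => g; apply: measurable_funM => //.
    apply: (measurableT_comp (f := fun w : g_sigma_algebraType (gen n X) => X (u i g) w j 0)) => //.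
    by apply: genf; exact: u01.
  apply: measurable_funM => //.
  apply: (measurableT_comp (f := fun w : g_sigma_algebraType (gen n W) => step_int (fun s w => W s w j 0) (st i j) w)) => //.
  apply: (@measurable_step_int _ (g_sigma_algebraType (gen n W)) _ _ 0 1) => //.
  by move=> x x01; exact: genf.
- by move=> w2; exact: (hc (noise_part w2)).
Qed.

End decoupled_signal.

Section core.
Context d (T : measurableType d) (R : realType) (P : probability T R).
Variables (q r n : nat) (X W Y : R -> T -> 'cV[R]_n) (B : R -> T -> 'cV[R]_q).
Variables (en t h : R) (S : nat -> T -> 'cV[R]_n) (sig : R -> 'M[R]_(n, q)).
Hypothesis mX : forall s i, 0 <= s <= 1 -> measurable_fun setT (fun w => X s w i 0).
Hypothesis cX : forall w i, {within `[0, 1], continuous (fun s => X s w i 0)}.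
Hypothesis mW : forall s i, 0 <= s <= 1 -> measurable_fun setT (fun w => W s w i 0).
Hypothesis indXW : indep_process P X W.
Hypothesis bmB : brownian_motion P B.
Hypothesis hY : forall s, 0 <= s <= 1 -> {ae P, forall w, forall i,
  Y s w i 0 = Y 0 w i 0 + \int[lebesgue_measure]_(y in `[0, s]) (X y w i 0) + en * W s w i 0}.
Hypotheses (t0 : 0 <= t) (h0 : 0 < h) (th1 : t + h <= 1).
Hypothesis hS : forall j i, (0 < j)%N ->
  approximable P (fun s w => Y s w i 0) t (t + h) (derive1 (Phi t h j)) (fun w => S j w i 0).
Hypothesis msig : forall i k, measurable_fun (`[0, 1] : set R) (fun s => sig s i k).
Hypothesis hX : forall s, 0 <= s <= 1 -> exists J : T -> 'M[R]_(n, q),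
  (forall i k, stoch_integral P (fun u w => B u w k 0) 0 s (fun u => sig u i k) (fun w => J w i k)) /\
  {ae P, forall w, X s w = X 0 w + \col_i \sum_k J w i k}.
Hypothesis rn : (r < n)%N.
Hypothesis psd : forall s, 0 <= s <= 1 -> spd (sig s *m (sig s)^T).
Variables (lam : R) (p p' c : 'I_r.+1 -> R) (rho : R).
Hypotheses (lam0 : 0 < lam) (rho0 : 0 < rho).
Hypothesis hp : forall l : 'I_r.+1, [/\ cos_angle (block_edge R r l.+1) <= p l, p l < p' l,
                   p' l <= cos_angle (block_edge R r l) & 0 < c l].
Hypothesis hrho : forall l : 'I_r.+1, rho <= 2 * c l * (p' l - p l).
Hypothesis hwave : forall (l : 'I_r.+1) x, p l <= x <= p' l ->
  c l <= wave (block_edge R r l) (block_edge R r l.+1) x ^+ 2.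
Hypothesis hlam : forall s, t <= s <= t + h -> lam <= eigval r.+1 (sig s *m (sig s)^T).

(** Near dependence is converted into nearness of a row twice, on passing from the scores to signal
    plus noise and from the signal to step integrals. Each passage costs a factor 16 (r + 1) in K
    and a union over r + 1 rows. *)
Definition anticoncentration_bound (K : R) : R :=
  r.+1%:R * (r.+1%:R * (2 * Num.sqrt (16 * r.+1%:R * (16 * r.+1%:R * K) / (lam * rho / (4 * (n - r)%:R))))).

Lemma core_anticoncentration (K e : R) : 0 < K -> 0 < e ->
  exists (J : 'I_r.+1 -> nat) (a : 'I_r.+1 -> nat -> R),
   (forall l, \sum_(j < J l) (a l j * j.+1%:R ^+ 2) ^+ 2 <= 200) /\
   outer_le P [set w | nearly_dependent (\matrix_(l, i) \sum_(j < J l) a l j * S j.+1 w i 0) K]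
     (anticoncentration_bound K + e).
Proof.
move=> K0 e0.
pose e1 := Num.min (e / (2 * r.+1%:R)) (Num.min 1 (K / (r.+1%:R * n.+1%:R))).
have e10 : 0 < e1.
  rewrite /e1 !lt_min ltr01 /=; apply/andP; split; apply: divr_gt0 => //; exact: mulr_gt0.
have e1e : e1 <= e / (2 * r.+1%:R) by rewrite ge_min lexx.
have e11 : e1 <= 1 by rewrite !ge_min lexx orbT.
have e1K : e1 <= K / (r.+1%:R * n.+1%:R) by rewrite !ge_min lexx !orbT.
pose at_ x := t + h * x.
have at_in x : 0 <= x <= 1 -> t <= at_ x <= t + h.
  by move=> /andP[x0 x1]; rewrite /at_ lerDl mulr_ge0 ?(ltW h0) //= lerD2l ler_piMr // ltW.
have at_le x y : (at_ x <= at_ y) = (x <= y) by rewrite /at_ lerD2l ler_pM2l.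
have at_K x : (at_ x - t) / h = x by rewrite /at_ addrAC subrr add0r mulrAC divff ?gt_eqF // mul1r.
have le_at s x : (x <= (s - t) / h) = (at_ x <= s).
  by rewrite ler_pdivlMr // /at_ -lerBrDl mulrC.
have at_ge s x : ((s - t) / h <= x) = (s <= at_ x).
  by rewrite ler_pdivrMr // /at_ lerBlDl mulrC.
have sub01 s : t <= s <= t + h -> 0 <= (s - t) / h <= 1.
  by rewrite le_at at_ge /at_ mulr0 addr0 mulr1.
have bl0 (l : 'I_r.+1) : 0 <= block_edge R r l <= 1 by apply: block_edge01; exact: ltnW.
have bl1 (l : 'I_r.+1) : 0 <= block_edge R r l.+1 <= 1 by exact: block_edge01.
pose lo (l : 'I_r.+1) := cos_angle (block_edge R r l.+1); pose hi (l : 'I_r.+1) := cos_angle (block_edge R r l).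
have lo01 (l : 'I_r.+1) : 0 <= lo l <= 1 by exact: cos_angle_bounds.
have hi01 (l : 'I_r.+1) : 0 <= hi l <= 1 by exact: cos_angle_bounds.
have p01 (l : 'I_r.+1) : 0 <= p l <= 1 /\ 0 <= p' l <= 1.
  have [h1 h2 h3 _] := hp l; have /andP[h4 h5] := lo01 l; have /andP[h6 h7] := hi01 l.
  have h8 := ltW h2.
  rewrite (le_trans h4 h1) (le_trans h4 (le_trans h1 h8)) (le_trans h3 h7).
  by rewrite (le_trans h8 (le_trans h3 h7)).
pose psi (l : 'I_r.+1) s := Num.sqrt (2 / h) * wave (block_edge R r l) (block_edge R r l.+1) ((s - t) / h).
have /choice[D hD] : forall l : 'I_r.+1, exists D : nat * (nat -> R) * nat * (nat -> R) * ('I_n -> seq (R * R * R)),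
  let: (J, a, m, u, st) := D in
  [/\ \sum_(j < J) (a j * j.+1%:R ^+ 2) ^+ 2 <= 200,
     subdivision t (t + h) m u,
     (forall x, x \in [:: at_ (lo l); at_ (hi l); at_ (p l); at_ (p' l)] -> exists2 i, (i <= m)%N & u i = x),
     (forall i, step_in t (t + h) (st i)) &
     outer_le P [set w | exists i, e1 <= `|\sum_(j < J) a j * S j.+1 w i 0 -
        (\sum_(g < m) (psi l (u g.+1) - psi l (u g)) * X (u g) w i 0 +
          en * step_int (fun s w => W s w i 0) (st i) w)|] e1].
  move=> l; have /andP[b0 _] := bl0 l; have /andP[_ b1] := bl1 l.
  have [hp1 hp2] := p01 l.
  have [x|J [a [m [u [st H]]]]] := score_approx mX (@cX) hY t0 h0 th1 hS b0 b1 e10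
     (pts := [:: at_ (lo l); at_ (hi l); at_ (p l); at_ (p' l)]).
    by rewrite !inE => /or4P[] /eqP ->; apply: at_in.
  by exists (J, a, m, u, st).
pose J l := (D l).1.1.1.1; pose a l := (D l).1.1.1.2; pose m l := (D l).1.1.2.
pose u l := (D l).1.2; pose st l := (D l).2.
have {}hD l : [/\ \sum_(j < J l) (a l j * j.+1%:R ^+ 2) ^+ 2 <= 200,
     subdivision t (t + h) (m l) (u l),
     (forall x, x \in [:: at_ (lo l); at_ (hi l); at_ (p l); at_ (p' l)] -> exists2 i, (i <= m l)%N & u l i = x),
     (forall i, step_in t (t + h) (st l i)) &
     outer_le P [set w | exists i, e1 <= `|\sum_(j < J l) a l j * S j.+1 w i 0 -
        (\sum_(g < m l) (psi l (u l g.+1) - psi l (u l g)) * X (u l g) w i 0 +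
          en * step_int (fun s w => W s w i 0) (st l i) w)|] e1].
  by have := hD l; rewrite /J /a /m /u /st; case: (D l) => [[[[? ?] ?] ?] ?].
exists J, a; split; first by move=> l; have [] := hD l.
have psit (l : 'I_r.+1) : psi l t = 0.
  by rewrite /psi /wave subrr mul0r mulr0 sin0 mul0r mulr0.
have psith (l : 'I_r.+1) : psi l (t + h) = 0.
  by rewrite /psi /wave (addrC t) addrK divff ?gt_eqF // mulr1 sinpi mul0r mulr0.
have su l : subdivision t (t + h) (m l) (u l) by have [] := hD l.
have /choice[V hV] : forall l : 'I_r.+1, exists V : T -> 'M[R]_(n, q),
   (forall i k, approximable P (fun s w => B s w k 0) 0 1
       (fun s => grid_fun (psi l) (m l) (u l) s * sig s i k) (fun w => V w i k)) /\
   {ae P, forall w, forall i, \sum_(g < m l) (psi l (u l g.+1) - psi l (u l g)) * X (u l g) w i 0 =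
       \sum_k V w i k}.
  by move=> l; exact: (signal_approximable bmB msig hX t0 th1 (su l) (psit l) (psith l)).
pose phi (l : 'I_r.+1) := grid_fun (psi l) (m l) (u l).
pose G := signal_part X m u psi; pose N := noise_part W st en.
(* Since x is a node, s and the right node of its cell lie on the same side of x. Replacing psi(s)
   by psi at that node therefore neither leaks out of the block nor loses the lower bound on ]p,
   p']. *)
have grid (l : 'I_r.+1) x s i : x \in [:: at_ (lo l); at_ (hi l); at_ (p l); at_ (p' l)] ->
    (i < m l)%N -> u l i < s <= u l i.+1 ->
    ((s <= x) = (u l i.+1 <= x)) /\ (x < s -> x <= u l i).
  move=> hx im /andP[us su']; have [_ _ /(_ x hx)[k km <-] _ _] := hD l; split.
    apply/idP/idP => [sx|]; last exact: le_trans.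
    by rewrite (subdivision_leE (su l)) // -(subdivision_ltE (su l) (ltnW im) km) (lt_le_trans us).
  move=> ks; rewrite (subdivision_leE (su l) km (ltnW im)) -ltnS.
  by rewrite -(subdivision_ltE (su l) km im) (lt_le_trans ks).
have cell (l : 'I_r.+1) s : t < s <= t + h -> exists i, [/\ (i < m l)%N, u l i < s <= u l i.+1,
    phi l s = - psi l (u l i.+1) & t <= u l i.+1 <= t + h].
  move=> /andP[ts sth]; have [i im us] := subdivision_cell (su l) ts sth.
  exists i; split=> //; first exact: (grid_fun_cell (su l) t0 (psith l) im us).
  have [<- <- _] := su l; by rewrite !(subdivision_le (su l)).
have phi_out (l : 'I_r.+1) s : ~~ (at_ (lo l) < s <= at_ (hi l)) -> phi l s = 0.
  move=> hs; have [hts|hts] := boolP (t < s <= t + h); last first.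
    exact: (grid_fun_out (su l) t0 (psit l) (psith l) hts).
  have [i [im us -> uin]] := cell l s hts.
  have [h1 h2] := grid l (at_ (lo l)) s i (mem_head _ _) im us.
  have [h3 h4] := grid l (at_ (hi l)) s i ltac:(by rewrite !inE eqxx orbT) im us.
  rewrite /psi wave_support ?mulr0 ?oppr0 //; first exact: sub01.
  move: hs; rewrite !negb_and -!leNgt -ltNge at_ge le_at => /orP[sl|hs].
    by rewrite -h1 sl.
  by have [_ _ ult] := su l; rewrite (le_trans (h4 hs) (ltW (ult i im))) orbT.
have hphi (l : 'I_r.+1) s : at_ (p l) < s <= at_ (p' l) -> 2 / h * c l <= phi l s ^+ 2.
  move=> /andP[ps sp]; have [hp1 hp2] := p01 l.
  have /andP[tp _] := at_in _ hp1; have /andP[_ tp'] := at_in _ hp2.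
  have [|i [im us -> uin]] := cell l s; first by rewrite (le_lt_trans tp ps) (le_trans sp).
  have [h1 h2] := grid l (at_ (p l)) s i ltac:(by rewrite !inE eqxx !orbT) im us.
  have [h3 h4] := grid l (at_ (p' l)) s i ltac:(by rewrite !inE eqxx !orbT) im us.
  rewrite sqrrN /psi exprMn sqr_sqrtr; last by rewrite divr_ge0 // ltW.
  rewrite ler_wpM2l ?divr_ge0 ?(ltW h0) //; apply: hwave.
  rewrite le_at at_ge -h3 sp andbT (le_trans (h2 ps)) //.
  have [_ _ ult] := su l; exact/ltW/ult.
have blk (l : 'I_r.+1) : [/\ 0 <= at_ (lo l), at_ (lo l) <= at_ (p l), at_ (p l) < at_ (p' l),
   at_ (p' l) <= at_ (hi l) & at_ (hi l) <= 1].
  have [h1 h2 h3 h4] := hp l; have /andP[h5 h6] := at_in _ (lo01 l); have /andP[h7 h8] := at_in _ (hi01 l).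
  rewrite !at_le (le_trans t0 h5) (le_trans h8) // ltNge at_le -ltNge.
  by split.
have disj (l l' : 'I_r.+1) x : l != l' -> at_ (lo l) < x <= at_ (hi l) -> ~~ (at_ (lo l') < x <= at_ (hi l')).
  move=> ll /andP[lx xh]; apply/negP => /andP[l'x xh'].
  have h1 : lo l < hi l' by rewrite ltNge -(at_le (hi l')) -ltNge (lt_le_trans lx).
  have h2 : lo l' < hi l by rewrite ltNge -(at_le (hi l)) -ltNge (lt_le_trans l'x).
  have h3 : (l' <= l)%N by move: h1; rewrite cos_angle_anti // block_edge_lt ltnS.
  have h4 : (l <= l')%N by move: h2; rewrite cos_angle_anti // block_edge_lt ltnS.
  by move: ll; rewrite -val_eqE /= eqn_leq h3 h4.
have cc0 (l : 'I_r.+1) : 0 <= 2 / h * c l by have [_ _ _ /ltW hc] := hp l; rewrite mulr_ge0 // divr_ge0 // ltW.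
(* The normalisation 2 / h of the squared waves cancels the length factor h, so the variance does
   not depend on h. *)
have rhoE (l : 'I_r.+1) : rho <= 2 / h * c l * (at_ (p' l) - at_ (p l)).
  apply: (le_trans (hrho l)); rewrite /at_ le_eqVlt; apply/orP; left; apply/eqP.
  by field; rewrite gt_eqF.
have lamE (l : 'I_r.+1) s : at_ (p l) < s <= at_ (p' l) -> lam <= eigval r.+1 (sig s *m (sig s)^T).
  move=> /andP[/ltW ps sp]; have [hp1 hp2] := p01 l; apply: hlam.
  have /andP[tp _] := at_in _ hp1; have /andP[_ tp'] := at_in _ hp2.
  by rewrite (le_trans tp ps) (le_trans sp).
have hG : {ae P, forall w, forall (l : 'I_r.+1) i, G w l i = \sum_k V l w i k}.
  have hl : outer_le P [set w | exists l : 'I_r.+1, ~ forall i, G w l i = \sum_k V l w i k] (\sum_(l < r.+1) 0).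
    apply: outer_le_bigcup => l; apply: outer_le_ae; have [_ hv] := hV l.
    by apply: filterS hv => w hw i; rewrite mxE hw.
  have [A [mA hA PA]] := hl; exists A; split=> //.
    by apply/eqP; rewrite eq_le measure_ge0 andbT (le_trans PA) // big1.
  move=> w /= hw; apply: hA => /=; apply: contrapT => hn; apply: hw => l i.
  by apply: contrapT => hi'; apply: hn; exists l => /(_ i).
pose K1 := 16 * r.+1%:R * K.
have K10 : 0 < K1 by rewrite !mulr_gt0.
pose b := r.+1%:R * (2 * Num.sqrt (16 * r.+1%:R * K1 / (lam * rho / (4 * (n - r)%:R)))).
have u01 (l : 'I_r.+1) g : (g < m l)%N -> 0 <= u l g <= 1.
  move=> gm; have [h1 h2 _] := su l; rewrite (le_trans t0) /=; last by rewrite -h1 (subdivision_le (su l)) // ltnW.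
  by rewrite (le_trans _ th1) // -h2 (subdivision_le (su l)) // ltnW.
have st01 l i : step_in 0 1 (st l i) by have [_ _ _ h1 _] := hD l; exact: step_inS (h1 i).
have mG l i : measurable_fun setT (fun w => G w l i).
  rewrite (_ : (fun w => _) = fun w => \sum_(g < m l) (psi l (u l g.+1) - psi l (u l g)) * X (u l g) w i 0); last first.
    by apply/funext => w; rewrite mxE.
  by apply: measurable_sum => g; apply: measurable_funM => //; apply: mX; exact: u01.
have mN l i : measurable_fun setT (fun w => N w l i).
  rewrite (_ : (fun w => _) = fun w => en * step_int (fun s w => W s w i 0) (st l i) w); last first.
    by apply/funext => w; rewrite mxE.
  by apply: measurable_funM => //; apply: (measurable_step_int (a := 0) (b := 1)) => // x; exact: mW.
have hrow (l : 'I_r.+1) : outer_le P [set w | row_near_span l (G w + N w) K1] (b + e1).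
  apply: outer_le_self.
    apply: measurable_row_near_span => i j.
    rewrite (_ : (fun w => _) = fun w => G w i j + N w i j); first exact: measurable_funD.
    by apply/funext => w; rewrite mxE.
  (* Freezing W turns the noise into a constant matrix c', to which the shifted bound applies. *)
  have hdec := @decoupled_row_near_span _ _ _ P r n X W mX mW indXW m u psi st en u01 st01 l K1 (b + e1).
  apply: hdec => c'.
  apply: outer_le_measure.
    apply: measurable_row_near_span => i j.
    rewrite (_ : (fun w => _) = fun w => G w i j + c' i j); first exact: measurable_funD.
    by apply/funext => w; rewrite mxE.
  exact: (shifted_anticoncentration bmB rn psd lam0 rho0 blk disj cc0 rhoE lamE hphi phi_out
     (fun l => (hV l).1) hG c' l K10 e10).
pose Q w := \matrix_(l < r.+1, i < n) \sum_(j < J l) a l j * S j.+1 w i 0.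
have hq : outer_le P [set w | exists (l : 'I_r.+1) i, e1 <= `|Q w l i - (G w l i + N w l i)|] (\sum_(l < r.+1) e1).
  have : outer_le P [set w | exists l : 'I_r.+1, [set w | exists i, e1 <= `|\sum_(j < J l) a l j * S j.+1 w i 0 -
        (\sum_(g < m l) (psi l (u l g.+1) - psi l (u l g)) * X (u l g) w i 0 +
          en * step_int (fun s w => W s w i 0) (st l i) w)|] w] (\sum_(l < r.+1) e1).
    by apply: outer_le_bigcup => l; have [] := hD l.
  by apply: outer_le_sub => // w /= [l [i hi']]; exists l, i; move: hi'; rewrite !mxE.
apply: outer_le_sub (outer_leU hq (outer_le_bigcup hrow)); last first.
  rewrite !sumr_const card_ord -[e1 *+ _]mulr_natl -[(b + e1) *+ _]mulr_natl mulrDr.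
  have h1 : r.+1%:R * e1 <= e / 2.
    by rewrite mulrC -ler_pdivlMr // -mulrA -invfM.
  by rewrite /anticoncentration_bound -/K1 -/b; lra.
move=> w /= hw; have [h1|h1] := pselect (exists (l : 'I_r.+1) i, e1 <= `|Q w l i - (G w l i + N w l i)|); first by left.
right.
have hd : \sum_i nsq (row i (Q w - (G w + N w))) <= K.
  apply: (@le_trans _ _ (\sum_(i < r.+1) \sum_(j < n) e1)).
    apply: ler_sum => i _; rewrite nsqE; apply: ler_sum => j _.
    have h2 : `|Q w i j - (G w i j + N w i j)| <= e1.
      by rewrite leNgt; apply/negP => h2; apply: h1; exists i, j; exact: ltW.
    have -> : row i (Q w - (G w + N w)) 0 j = Q w i j - (G w i j + N w i j) by rewrite !mxE.
    rewrite -real_normK ?num_real // expr2 (le_trans _ h2) // ler_piMr //.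
    exact: le_trans h2 e11.
  under eq_bigr do rewrite sumr_const card_ord.
  rewrite sumr_const card_ord -mulrnA -[leLHS]mulr_natl.
  apply: (@le_trans _ _ ((r.+1%:R * n.+1%:R) * e1)).
    by rewrite ler_wpM2r ?(ltW e10) // -natrM ler_nat mulnC leq_mul.
  by rewrite mulrC -ler_pdivlMr // mulr_gt0.
have h2 := nearly_dependent_perturb hd hw.
have K40 : 0 < 4 * K by exact: mulr_gt0.
move: h2 => /(nearly_dependent_row_near_span K40)[l hl]; exists l.
by move: hl; rewrite (_ : 4 * r.+1%:R * (4 * K) = K1) // /K1; ring.
Qed.

End core.

(** * The weighted covariance statistic *)

Section weighted_energy.
Context d (T : measurableType d) (R : realType) (P : probability T R).
Local Notation mu := (@lebesgue_measure R).
Variables (n : nat) (X W Y : R -> T -> 'cV[R]_n) (en t h : R) (S : nat -> T -> 'cV[R]_n).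
Hypothesis mX : forall s i, 0 <= s <= 1 -> measurable_fun setT (fun w => X s w i 0).
Hypothesis cX : forall w i, {within `[0, 1], continuous (fun s => X s w i 0)}.
Hypothesis bmW : brownian_motion P W.
Hypothesis hY : forall s, 0 <= s <= 1 -> {ae P, forall w, forall i,
  Y s w i 0 = Y 0 w i 0 + \int[mu]_(y in `[0, s]) (X y w i 0) + en * W s w i 0}.
Hypotheses (t0 : 0 <= t) (h0 : 0 < h) (th1 : t + h <= 1).
Hypothesis mS : forall j i, (0 < j)%N -> measurable_fun setT (fun w => S j w i 0).
Hypothesis hS : forall j i, (0 < j)%N ->
  approximable P (fun s w => Y s w i 0) t (t + h) (derive1 (Phi t h j)) (fun w => S j w i 0).

Lemma one_minus_exp_le (a b : R) : 0 <= a -> 1 - expR (- (a + b)) <= a + (1 - expR (- b)) \/ 1 < expR (- b).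
Proof.
move=> a0; have [h1|h1] := ltP 1 (expR (- b)); [by right | left].
rewrite opprD expRD; have := expR_ge1Dx (- a); have := expR_gt0 (- b).
set x := expR (- a); set y := expR (- b) in h1 *; move: (y : R) (x : R) h1 => {}y {}x h1 y0 hx; nra.
Qed.

Lemma expRN_le1 (a : R) : 0 <= a -> expR (- a) <= 1.
Proof. by move=> a0; rewrite -[leRHS]expR0 ler_expR oppr_le0. Qed.

(** A bounded and subadditive substitute for th x^2, so that neither X(0) nor the exceptional sets
    have to be integrable against x^2. *)
Definition exp_defect (th x : R) : R := 1 - expR (- (th * x ^+ 2)).

Lemma exp_defect_ge0 th x : 0 <= th -> 0 <= exp_defect th x.
Proof. by move=> th0; rewrite subr_ge0 expRN_le1 // mulr_ge0 // sqr_ge0. Qed.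

Lemma exp_defect_le1 th x : exp_defect th x <= 1.
Proof. by rewrite /exp_defect gerBl expR_ge0. Qed.

Lemma measurable_exp_defect th (f : T -> R) : measurable_fun setT f ->
  measurable_fun setT (fun w => exp_defect th (f w)).
Proof.
move=> mf; apply: measurable_funB => //; apply: measurableT_comp => //.
apply: measurableT_comp => //; apply: measurable_funM => //.
exact: measurable_funX.
Qed.

(** On A the drift part of S_j is of order j, being bounded through its integrand of size j, and the
    noise part is Gaussian of variance of order j^2. D is the same for all j, which makes the
    weighted series summable. *)
Lemma score_exp_moment (K : R) (A : set T) : 0 < K -> measurable A ->
  (forall w, A w -> forall i s, 0 <= s <= 1 -> `|X s w i 0| <= K) ->
  exists2 D : R, 0 <= D & forall j i th, (0 < j)%N -> 0 < th ->
    (\int[P]_(w in A) (exp_defect th (S j w i 0))%:E <= (th * (D * j%:R ^+ 2))%:E)%E.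
Proof.
move=> K0 mA hA; have p0 := pi_gt0 R.
have t0' := t0; have th1' := th1; have h0' := h0.
pose a := Num.sqrt (2 / h); have a0 : 0 <= a by exact: sqrtr_ge0.
have Aph0 : 0 <= a * (pi / h) by apply: mulr_ge0 => //; apply: divr_ge0; exact: ltW.
pose D1 := a * (pi / h) * (2 * K) + a * 2 * K + 1.
have D10 : 0 <= D1.
  apply: addr_ge0 => //; apply: addr_ge0.
    by apply: mulr_ge0; [exact: Aph0 | rewrite mulr_ge0 // ltW].
  by apply: mulr_ge0; [rewrite mulr_ge0 | exact: ltW].
pose D2 := 2 * (a * (pi / h)) ^+ 2 + 2.
have D20 : 0 <= D2 by apply: addr_ge0 => //; apply: mulr_ge0 => //; exact: sqr_ge0.
exists (2 * D1 ^+ 2 + 4 * en ^+ 2 * D2).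
  apply: addr_ge0; first by apply: mulr_ge0 => //; exact: sqr_ge0.
  by apply: mulr_ge0 => //; apply: mulr_ge0 => //; exact: sqr_ge0.
move=> j i th j0 th0.
have j1 : 1 <= j%:R :> R by rewrite ler1n.
have j0' : 0 <= j%:R :> R by [].
pose C := a * (pi / h) * j%:R.
have C0 : 0 <= C by apply: mulr_ge0.
pose f := derive1 (Phi t h j).
have fE s : f s = C * cos (j%:R * pi * (s - t) / h).
  rewrite /f derive1E; have [_ ->] := is_derive_Phi t h j s.
  by rewrite /C -/a; set c := cos _; generalize (pi : R) => q; ring.
have hg (s : R) : is_derive s 1 (Phi t h j) (f s).
  by rewrite fE; apply: is_derive_eq (is_derive_Phi t h j s) _; rewrite /C -/a; set c := cos _;
    generalize (pi : R) => q; ring.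
have cf : continuous f.
  rewrite (_ : f = fun s => C * cos (j%:R * pi * (s - t) / h)); last by apply/funext.
  move=> y; apply: cvgM; first exact: cvg_cst.
  apply: (@continuous_comp _ _ _ (fun y => j%:R * pi * (y - t) / h) cos); last exact: continuous_cos.
  apply: cvgM; last exact: cvg_cst.
  apply: cvgM; first exact: cvg_cst.
  by apply: cvgB; [exact: cvg_id | exact: cvg_cst].
have fC y : `|f y| <= C.
  rewrite fE normrM (ger0_norm C0) ler_piMr // ler_norml.
  by rewrite cos_geN1 cos_le1.
have gE y : `|Phi t h j y| <= a.
  rewrite /Phi normrM (ger0_norm a0) ler_piMr // ler_norml.
  by rewrite sin_geN1 sin_le1.
apply/lee_addgt0Pr => e' e'0.
pose e := Num.min 1 e'; have e0 : 0 < e by rewrite /e lt_min ltr01.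
have e1 : e <= 1 by rewrite ge_min lexx.
have ee : e <= e' by rewrite ge_min lexx orbT.
(* One cell is enough here: for paths bounded by K the oscillation 2 K is valid for any mesh, and
   only the order of growth in j matters. *)
pose u (k : nat) := if k == 0%N then t else t + h.
have su : subdivision t (t + h) 1 u.
  by split=> // -[|k] //; rewrite /u /= ltrDl.
have mesh k : (k < 1)%N -> u k.+1 - u k < 2.
  by case: k => // _; rewrite /u /= addrAC subrr add0r; lra.
have [st [st1 st2 st3]] := functional_approx (@cX) hY (2 * K) t0 th1 K0 C0 cf hg
  (fun y _ => fC y) (fun i => hS i j0) su mesh e0.
have [Bd [mBd hBd PBd]] := st3.
pose Wst w := step_int (fun s w => W s w i 0) (st i) w.
have st01 : step_in 0 1 (st i) by exact: step_inS (st1 i).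
pose sk (k : 'I_n) := if k == i then st i else [::].
have [|v gv hv] := @multi_step_int_gaussian _ _ _ P _ W bmW sk.
  by move=> k; rewrite /sk; case: eqP.
have WE w : multi_step_int W sk w = Wst w.
  rewrite /multi_step_int (bigD1 i) //= big1 ?addr0 ?/sk ?eqxx // => k /negbTE ki.
  by rewrite ki /step_int big_nil.
have vD : v <= D2 * j%:R ^+ 2.
  rewrite -lee_fin hv (bigD1 i) //= big1 ?adde0; last first.
    move=> k /negbTE ki; rewrite /sk ki.
    by under eq_integral do rewrite /step_fun big_nil expr0n; rewrite integral0.
  rewrite /sk eqxx.
  have hstep : (\int[mu]_(x in `[0%R, 1%R]) (step_fun (st i) x ^+ 2)%:E <=
      \int[mu]_(x in `[t, (t + h)%R]) (2%:E * ((f x - step_fun (st i) x) ^+ 2)%:E + (2 * C ^+ 2)%:E))%E.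
    have -> : (\int[mu]_(x in `[0%R, 1%R]) (step_fun (st i) x ^+ 2)%:E =
       \int[mu]_(x in `[0%R, 1%R] `&` `[t, (t + h)%R]) (step_fun (st i) x ^+ 2)%:E)%E.
      rewrite integral_mkcondr; apply: eq_integral => x _; rewrite patchE mem_setE in_itv /=.
      case: ifP => // hx; rewrite (step_fun_out (st1 i)) ?expr0n //.
      by apply: contraFN hx => /andP[/ltW -> ->].
    rewrite setIidr; last first.
      by move=> x /=; rewrite !in_itv /= => /andP[tx xt]; rewrite (le_trans t0 tx) (le_trans xt).
    apply: ge0_le_integral => //.
    - by move=> x _; rewrite lee_fin sqr_ge0.
    - by apply/measurable_EFinP; apply: measurable_funX; apply: measurable_funTS; exact: measurable_step_fun.
    - apply: emeasurable_funD => //; apply: measurable_funeM; apply: measurable_sqr_diff.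
      by have [mf _] := hS i j0.
    move=> x _; rewrite -EFinM -EFinD lee_fin.
    have h1 : f x ^+ 2 <= C ^+ 2 by rewrite -real_normK ?num_real // ler_pXn2r ?nnegrE ?normr_ge0.
    by have := sqr_ge0 (2 * f x - step_fun (st i) x); lra.
  apply: (le_trans hstep).
  have mf : measurable_fun (`[t, t + h] : set R) f by have [] := hS i j0.
  rewrite ge0_integralD //; last 3 first.
  - by move=> x _; rewrite -EFinM lee_fin mulr_ge0 // sqr_ge0.
  - by apply: measurable_funeM; exact: measurable_sqr_diff.
  - by move=> x _; rewrite lee_fin mulr_ge0 // sqr_ge0.
  rewrite ge0_integralZl //; last 2 first.
  - exact: measurable_sqr_diff.
  - by move=> x _; rewrite lee_fin sqr_ge0.
  rewrite integral_cst //= lebesgue_measure_itv /= lte_fin ltrDl h0 -EFinD addrAC subrr add0r.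
  apply: (@le_trans _ _ (2%:E * 1%:E + (2 * C ^+ 2 * 1)%:E)%E).
    apply: leeD.
      by apply: lee_wpmul2l => //; apply: (le_trans (st2 i)); rewrite lee_fin.
    have h1 : h <= 1 by lra.
    by rewrite -EFinM lee_fin; apply: ler_wpM2l => //; apply: mulr_ge0 => //; exact: sqr_ge0.
  have jj : 1 <= j%:R ^+ 2 :> R by rewrite exprn_ege1.
  rewrite -EFinM -EFinD lee_fin !mulr1 /C exprMn /D2.
  by move: jj; move: (_ ^+ 2) (_ ^+ 2) => x y jj; lra.
pose Z := D1 * j%:R.
have Z0 : 0 <= Z by rewrite mulr_ge0.
pose th2 := 2 * th * en ^+ 2.
have th20 : 0 <= th2 by rewrite mulr_ge0 ?sqr_ge0 // mulr_ge0 // ltW.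
have mWst : measurable_fun setT Wst.
  have [mgv _ _] := gv; apply: eq_measurable_fun mgv => w _; exact: WE.
have key w : A w -> exp_defect th (S j w i 0) <=
    th * (2 * Z ^+ 2) + exp_defect th2 (Wst w) + \1_Bd w.
  move=> Aw; have [hb|hb] := pselect (Bd w).
    rewrite (_ : \1_Bd w = 1); last by rewrite indicE mem_set.
    rewrite (le_trans (exp_defect_le1 _ _)) // lerDr addr_ge0 ?exp_defect_ge0 //.
    by rewrite mulr_ge0 ?(ltW th0) // mulr_ge0 // sqr_ge0.
  have reg : regular_path_event X K 2 (2 * K) w.
    move=> i'; split=> [s s01|s s' s01 s'01 _]; first exact: hA.
    rewrite (le_trans (ler_normB _ _)) // mulr2n mulrDl mul1r lerD //; exact: hA.
  have hs : `|S j w i 0 - ((Phi t h j (t + h) - Phi t h j t) * X t w i 0 + en * Wst w)| <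
     C * (2 * K) * (t + h - t) + e.
    rewrite ltNge; apply/negP => h1; apply: hb; apply: hBd; split=> //; exists i.
    by rewrite big_ord1 /u /=.
  have hsw : `|S j w i 0| <= Z + `|en * Wst w|.
    have h1 : `|(Phi t h j (t + h) - Phi t h j t) * X t w i 0| <= a * 2 * K.
      rewrite normrM; apply: ler_pM => //; last by apply: hA => //; lra.
      by rewrite (le_trans (ler_normB _ _)) // mulr2n mulrDr mulr1 lerD.
    have h2 : C * (2 * K) * (t + h - t) <= C * (2 * K).
      have ht : t + h - t <= 1 by lra.
      have cK : 0 <= C * (2 * K) by apply: mulr_ge0 => //; apply: mulr_ge0 => //; exact: ltW.
      exact: ler_piMr.
    have h3 : C * (2 * K) + a * 2 * K + 1 <= Z.
      have y0 : 0 <= a * 2 * K by apply: mulr_ge0; [exact: mulr_ge0 | exact: ltW].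
      have y1 := ler_peMr y0 j1.
      rewrite /Z /D1 /C; move: y1; move: (a * 2 * K) (a * (pi / h)) => y x y1.
      by move: j1; lra.
    have h4 := ler_normD (S j w i 0 - ((Phi t h j (t + h) - Phi t h j t) * X t w i 0 + en * Wst w))
      ((Phi t h j (t + h) - Phi t h j t) * X t w i 0 + en * Wst w).
    rewrite subrK in h4.
    have h5 := ler_normD ((Phi t h j (t + h) - Phi t h j t) * X t w i 0) (en * Wst w).
    by move: hs h1 h2 h3 h4 h5 e1; lra.
  rewrite (_ : \1_Bd w = 0); last by rewrite indicE memNset.
  rewrite addr0 /exp_defect.
  have sq : th * S j w i 0 ^+ 2 <= th * (2 * Z ^+ 2) + th2 * Wst w ^+ 2.
    rewrite /th2 (_ : th * (2 * Z ^+ 2) + _ = th * (2 * Z ^+ 2 + 2 * `|en * Wst w| ^+ 2)); last first.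
      by rewrite real_normK ?num_real //; ring.
    rewrite ler_wpM2l ?(ltW th0) // -real_normK ?num_real //.
    have h1 : `|S j w i 0| ^+ 2 <= (Z + `|en * Wst w|) ^+ 2.
      by rewrite ler_pXn2r ?nnegrE ?normr_ge0 ?addr_ge0.
    by have := sqr_ge0 (Z - `|en * Wst w|); lra.
  have x0 : 0 <= th * (2 * Z ^+ 2) by rewrite mulr_ge0 ?(ltW th0) // mulr_ge0 // sqr_ge0.
  have y0 : 0 <= th2 * Wst w ^+ 2 by rewrite mulr_ge0 // sqr_ge0.
  have [h1|] := @one_minus_exp_le _ (th2 * Wst w ^+ 2) x0.
    by apply: le_trans h1; rewrite lerB // ler_expR lerN2.
  by rewrite ltNge expRN_le1.
have m1 : measurable_fun setT (fun w => (exp_defect th2 (Wst w))%:E).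
  by apply/measurable_EFinP; exact: measurable_exp_defect.
apply: (@le_trans _ _ (\int[P]_w ((th * (2 * Z ^+ 2))%:E + ((exp_defect th2 (Wst w))%:E + (\1_Bd w)%:E)))%E).
  rewrite integral_mkcond; apply: ge0_le_integral => //.
  - by move=> w _; rewrite patchE; case: ifP => // _; rewrite lee_fin exp_defect_ge0 // ltW.
  - apply/(measurable_restrictT _ _).1 => //; apply: measurable_funTS.
    by apply/measurable_EFinP; apply: measurable_exp_defect; exact: mS.
  - by do !apply: emeasurable_funD => //; apply/measurable_EFinP; exact: measurable_indic.
  move=> w _; rewrite patchE; case: ifPn => [/set_mem Aw|_].
    by rewrite -!EFinD lee_fin addrA; exact: key.
  rewrite -!EFinD lee_fin; apply: addr_ge0.
    by apply: mulr_ge0; [exact: ltW | apply: mulr_ge0 => //; exact: sqr_ge0].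
  by apply: addr_ge0 => //; exact: exp_defect_ge0.
have m2 : measurable_fun setT (fun w : T => (\1_Bd w)%:E : \bar R).
  by apply/measurable_EFinP; exact: measurable_indic.
rewrite (@ge0_integralD _ _ _ P setT measurableT (fun=> (th * (2 * Z ^+ 2))%:E)
  (fun w => ((exp_defect th2 (Wst w))%:E + (\1_Bd w)%:E)%E)) //; last 3 first.
- by move=> w _; rewrite lee_fin mulr_ge0 ?(ltW th0) // mulr_ge0 // sqr_ge0.
- by move=> w _; rewrite -EFinD lee_fin addr_ge0 ?exp_defect_ge0.
- exact: emeasurable_funD.
rewrite (@ge0_integralD _ _ _ P setT measurableT (fun w => (exp_defect th2 (Wst w))%:E)
  (fun w => (\1_Bd w)%:E)) //; last by move=> w _; rewrite lee_fin exp_defect_ge0.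
rewrite integral_cst //= [X in (_ * X)%E]probability_setT mule1 integral_indic // setIT.
have hW : (\int[P]_w (exp_defect th2 (Wst w))%:E <= (2 * th2 * v)%:E)%E.
  have [th2p|th2n] := ltP 0 th2.
    apply: le_trans (centered_gaussian_exp_moment gv th2p).
    rewrite le_eqVlt; apply/orP; left; apply/eqP; apply: eq_integral => w _.
    by rewrite WE.
  have z : th2 = 0 by apply/eqP; rewrite eq_le th20 th2n.
  rewrite z mulr0 mul0r; under eq_integral do rewrite /exp_defect mul0r oppr0 expR0 subrr.
  by rewrite integral0.
apply: (@le_trans _ _ ((th * (2 * Z ^+ 2))%:E + ((2 * th2 * v)%:E + e'%:E))%E).
  apply: leeD => //; apply: leeD => //; apply: (le_trans PBd).
  by rewrite lee_fin.
have -> : th * ((2 * D1 ^+ 2 + 4 * en ^+ 2 * D2) * j%:R ^+ 2) =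
   th * (2 * Z ^+ 2) + 2 * th2 * (D2 * j%:R ^+ 2) by rewrite /th2 /Z; ring.
rewrite -!EFinD lee_fin addrA lerD2r lerD2l.
by apply: ler_wpM2l => //; exact: mulr_ge0.
Qed.

Variables (wt : nat -> R) (Cw : R).
Hypothesis wt0 : forall j, 0 <= wt j.
Hypothesis Cw0 : 0 <= Cw.
Hypothesis hwt : forall N, \sum_(1 <= j < N) wt j * j%:R ^+ 2 <= Cw.

(** Subadditivity of 1 - exp(-x) sums the bounds of the single scores, and th is chosen so that the
    total is at most e / 4. A Markov argument with 1 - exp(-1) >= 1/2 bounds the event th F N >= 1
    by e / 2 uniformly in N, and these events increase with N. *)
Lemma weighted_sum_bounded i (e : R) : 0 < e ->
  outer_le P [set w | ~ exists M, forall N, \sum_(1 <= j < N) wt j * S j w i 0 ^+ 2 <= M] e.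
Proof.
move=> e0; have e20 : 0 < e / 2 by rewrite divr_gt0.
have [K [de [K0 de0 [B [mB hB PB]]]]] := path_regular P mX (@cX) ltr01 e20.
have mA : measurable (~` B) by exact: measurableC.
have hA w : (~` B) w -> forall i s, 0 <= s <= 1 -> `|X s w i 0| <= K.
  move=> nB i' s s01; apply: contrapT => hn; apply: nB; apply: hB => /(_ i')[h1 _].
  by apply: hn; exact: h1.
have [D D0 hD] := score_exp_moment K0 mA hA.
pose th := e / (4 * (D * Cw + 1)).
have DC0 : 0 < D * Cw + 1 by rewrite ltr_pwDr // mulr_ge0.
have th0 : 0 < th by rewrite divr_gt0 // mulr_gt0.
pose F N w := \sum_(1 <= j < N) wt j * S j w i 0 ^+ 2.
have mF N : measurable_fun setT (F N).
  rewrite (_ : F N = fun w => \sum_(j < N.-1) wt j.+1 * S j.+1 w i 0 ^+ 2); last first.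
    by apply/funext => w; rewrite /F big_add1 big_mkord.
  apply: measurable_sum => j; apply: measurable_funM => //.
  by apply: measurable_funX; exact: mS.
pose U N := [set w | (~` B) w /\ 1 <= th * F N w].
have mU N : measurable (U N).
  apply: measurableI => //; apply: measurable_ge_cst; exact: measurable_funM.
have F0 N w : 0 <= F N w by apply: sumr_ge0 => j _; rewrite mulr_ge0 // sqr_ge0.
have ndU : nondecreasing_seq U.
  apply/nondecreasing_seqP => N; apply/subsetPset => w [hb h1]; split=> //.
  apply: (le_trans h1); rewrite ler_wpM2l ?(ltW th0) // /F.
  case: N h1 => [|N] _; first by rewrite !big_geq.
  by rewrite [leRHS]big_nat_recr //= lerDl mulr_ge0 // sqr_ge0.
have sub N w : 1 - expR (- (th * F N w)) <= \sum_(1 <= j < N) exp_defect (th * wt j) (S j w i 0).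
  elim: N => [|[|N] IH]; try by rewrite /F !big_geq // mulr0 oppr0 expR0 subrr.
  rewrite /F !(@big_nat_recr _ _ _ N.+1) //= -/(F N.+1 w) mulrDr.
  apply: le_trans (_ : _ <= (1 - expR (- (th * F N.+1 w))) + exp_defect (th * wt N.+1) (S N.+1 w i 0)) _; last by rewrite lerD2r.
  rewrite /exp_defect opprD expRD mulrA.
  have h1 := expRN_le1 (mulr_ge0 (ltW th0) (F0 N.+1 w)).
  have h2 : expR (- (th * wt N.+1 * S N.+1 w i 0 ^+ 2)) <= 1.
    by rewrite expRN_le1 // mulr_ge0 ?sqr_ge0 // mulr_ge0 // ltW.
  move: h1 h2; move: (expR _) (expR _) => x y x1 y1.
  by nra.
have sub' N w : 1 - expR (- (th * F N w)) <= \sum_(j < N.-1) exp_defect (th * wt j.+1) (S j.+1 w i 0).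
  by apply: (le_trans (sub N w)); rewrite big_add1 big_mkord.
have PU N : (P (U N) <= (e / 2)%:E)%E.
  have h1 : ((1 / 2)%:E * P (U N) <= (th * (D * Cw))%:E)%E.
    rewrite -(setIT (U N)) -integral_indic // -ge0_integralZl //; last exact/measurable_EFinP.
    apply: (@le_trans _ _ (\int[P]_(w in ~` B) \sum_(j < N.-1) (exp_defect (th * wt j.+1) (S j.+1 w i 0))%:E)%E).
      rewrite [leRHS]integral_mkcond; apply: ge0_le_integral => //.
      - by apply: measurable_funeM; apply/measurable_EFinP; exact: measurable_indic.
      - apply/(measurable_restrictT _ _).1 => //; apply: measurable_funTS.
        apply: emeasurable_sum => j; apply/measurable_EFinP.
        by apply: measurable_exp_defect; exact: mS.
      move=> w _; rewrite patchE -EFinM; have [Uw|nU] := pselect (U N w); last first.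
        rewrite indicE memNset // mulr0; case: ifP => // _; rewrite sumEFin lee_fin.
        by apply: sumr_ge0 => j _; rewrite exp_defect_ge0 // mulr_ge0 // ltW.
      rewrite indicE mem_set // mulr1; have [hb h1] := Uw; rewrite mem_set //.
      rewrite sumEFin lee_fin (le_trans _ (sub' N w)) //.
      have h2 : expR (- (th * F N w)) <= expR (-1) by rewrite ler_expR lerN2.
      have h3 : expR (-1) <= 1 / 2 :> R.
        rewrite expRN div1r lef_pV2 ?posrE ?expR_gt0 //.
        by have := expR_ge1Dx (1 : R).
      by lra.
    rewrite ge0_integral_sum //; last 2 first.
    - move=> j; apply: measurable_funTS; apply/measurable_EFinP.
      by apply: measurable_exp_defect; exact: mS.
    - by move=> j w _; rewrite lee_fin exp_defect_ge0 // mulr_ge0 // ltW.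
    apply: (@le_trans _ _ (\sum_(j < N.-1) ((th * wt j.+1) * (D * j.+1%:R ^+ 2))%:E)%E).
      apply: lee_sum => j _.
      have [w0|w0] := ltP 0 (wt j.+1); first by apply: hD => //; exact: mulr_gt0.
      have -> : wt j.+1 = 0 by apply/eqP; rewrite eq_le wt0 w0.
      rewrite mulr0 mul0r; under eq_integral do rewrite /exp_defect mul0r oppr0 expR0 subrr.
      by rewrite integral0.
    rewrite sumEFin lee_fin.
    rewrite (eq_bigr (fun j : 'I_N.-1 => th * D * (wt j.+1 * j.+1%:R ^+ 2))); last by move=> j _; ring.
    rewrite -mulr_sumr mulrA; apply: ler_wpM2l; first by rewrite mulr_ge0 // ltW.
    by have := hwt N; rewrite big_add1 big_mkord.
  have h2 : th * (D * Cw) <= e / 4.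
    rewrite /th (_ : _ * (D * Cw) = e / 4 * (D * Cw / (D * Cw + 1))); last by field; rewrite gt_eqF.
    by rewrite ler_piMr ?divr_ge0 ?(ltW e0) // ler_pdivrMr // mul1r lerDl.
  move: h1; move: (P (U N)) => [x||]; last by rewrite leNye.
  - by rewrite -EFinM !lee_fin; lra.
  - by rewrite gt0_muley ?lte_fin.
pose V := \bigcup_N U N.
have mV : measurable V by exact: bigcup_measurable.
have PV : (P V <= (e / 2)%:E)%E.
  have hc := nondecreasing_cvg_mu (mu := P) mU mV ndU.
  rewrite -(cvg_lim _ hc) //; apply: lime_le; first by apply/cvg_ex; exists (P V).
  by apply: nearW => N; exact: PU.
exists (B `|` V); split; first exact: measurableU.
- move=> w /= hn; have [hb|hb] := pselect (B w); first by left.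
  right; apply: contrapT => nV; apply: hn; exists (1 / th) => N.
  rewrite leNgt; apply/negP => h1; apply: nV; exists N => //; split=> //.
  by move: (ltW h1); rewrite ler_pdivrMr // mulrC.
- apply: (le_trans (measureU2 P mB mV)).
  by rewrite [e]splitr EFinD; exact: leeD.
Qed.

End weighted_energy.

Section weights.
Variable R : realType.
Variables (cw M : R).
Hypotheses (cw0 : 0 < cw) (M0 : 0 < M).

Lemma weight_gt0 j : 0 < weight cw M j.
Proof.
rewrite /weight !mulr_gt0 // invr_gt0 // exprn_gt0 // ltr_pwDl //.
by rewrite divr_ge0 // sqr_ge0.
Qed.

Lemma sum_inv_sqr_le N : \sum_(1 <= j < N) (j%:R ^+ 2)^-1 <= 2 :> R.
Proof.
have H k : \sum_(1 <= j < k.+2) (j%:R ^+ 2)^-1 <= 2 - k.+1%:R^-1 :> R.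
  elim: k => [|k IH]; first by rewrite big_nat1 expr1n invr1; lra.
  rewrite big_nat_recr //=; apply: (le_trans (lerD IH (lexx _))).
  have a0 : 0 < k.+1%:R :> R by [].
  have -> : k.+2%:R = k.+1%:R + 1 :> R by rewrite natr1.
  move: (k.+1%:R : R) a0 => a a0.
  have a10 : 0 < a + 1 by lra.
  have h : ((a + 1) ^+ 2)^-1 <= a^-1 - (a + 1)^-1.
    rewrite (_ : a^-1 - (a + 1)^-1 = (a * (a + 1))^-1); last by field; rewrite !gt_eqF.
    rewrite lef_pV2 ?posrE ?exprn_gt0 ?mulr_gt0 // expr2 ler_wpM2r //; lra.
  lra.
case: N => [|[|N]]; try by rewrite big_geq.
by apply: (le_trans (H N)); rewrite gerBl invr_ge0.
Qed.

(** The weight is at most cw M^3 j^-4, which leaves the series of j^-2. *)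
Lemma weight_sqr_sum : exists2 C : R, 0 <= C & forall N,
  \sum_(1 <= j < N) weight cw M j * j%:R ^+ 2 <= C.
Proof.
exists (cw * M ^+ 3 * 2).
  by apply: mulr_ge0 => //; apply: mulr_ge0; [exact: ltW | apply: exprn_ge0; exact: ltW].
move=> N; apply: (@le_trans _ _ (\sum_(1 <= j < N) cw * M ^+ 3 * (j%:R ^+ 2)^-1)).
  rewrite big_nat [leRHS]big_nat; apply: ler_sum => j /andP[j1 _].
  have j0 : 0 < j%:R :> R by rewrite ltr0n.
  rewrite /weight; move: (j%:R : R) j0 => x x0.
  have x20 : 0 < x ^+ 2 by exact: exprn_gt0.
  have M20 : 0 < M ^+ 2 by exact: exprn_gt0.
  have h : ((1 + x ^+ 2 / M ^+ 2) ^+ 2)^-1 <= ((x ^+ 2 / M ^+ 2) ^+ 2)^-1.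
    have y0 : 0 < x ^+ 2 / M ^+ 2 by exact: divr_gt0.
    rewrite lef_pV2 ?posrE ?exprn_gt0 //; last by lra.
    by move: y0; move: (x ^+ 2 / M ^+ 2) => y y0; nra.
  have -> : cw * M ^+ 3 * (x ^+ 2)^-1 = cw * M^-1 * ((x ^+ 2 / M ^+ 2) ^+ 2)^-1 * x ^+ 2.
    by field; rewrite !gt_eqF.
  apply: ler_wpM2r; first exact: ltW.
  by apply: ler_wpM2l => //; apply: divr_ge0; exact: ltW.
rewrite -mulr_sumr; apply: ler_wpM2l; last exact: sum_inv_sqr_le.
by apply: mulr_ge0; [exact: ltW | apply: exprn_ge0; exact: ltW].
Qed.

(** The bound 200 on the dual norm times an upper bound, over j >= 1, of 1 / (w_j j^4). *)
Definition score_constant : R := 200 * (M / cw * (1 + M ^- 2) ^+ 2).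

Lemma score_constant_gt0 : 0 < score_constant.
Proof.
rewrite /score_constant mulr_gt0 // mulr_gt0 ?divr_gt0 // exprn_gt0 // ltr_pwDl //.
by rewrite invr_ge0 exprn_ge0 // ltW.
Qed.

Lemma score_cauchy_schwarz J (a x : nat -> R) :
  \sum_(j < J) (a j * j.+1%:R ^+ 2) ^+ 2 <= 200 ->
  (\sum_(j < J) a j * x j.+1) ^+ 2 <=
  score_constant * \sum_(1 <= j < J.+1) weight cw M j * x j ^+ 2.
Proof.
move=> ha; rewrite big_add1 big_mkord /=.
pose s j : R := Num.sqrt (weight cw M j).
have s0 j : 0 < s j by rewrite sqrtr_gt0 weight_gt0.
have sE j : s j ^+ 2 = weight cw M j by rewrite sqr_sqrtr // ltW // weight_gt0.
have -> : \sum_(j < J) a j * x j.+1 = \sum_(j < J) (a j / s j.+1) * (s j.+1 * x j.+1).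
  by apply: eq_bigr => j _; rewrite mulrA divfK ?gt_eqF.
apply: (le_trans (sum_cauchy_schwarz _ _)).
have -> : \sum_(j < J) (s j.+1 * x j.+1) ^+ 2 = \sum_(j < J) weight cw M j.+1 * x j.+1 ^+ 2.
  by apply: eq_bigr => j _; rewrite exprMn sE.
apply: ler_wpM2r.
  by apply: sumr_ge0 => j _; apply: mulr_ge0; [exact/ltW/weight_gt0 | exact: sqr_ge0].
pose k := M / cw * (1 + M ^- 2) ^+ 2.
have k0 : 0 <= k by have := score_constant_gt0; rewrite /score_constant -/k; lra.
apply: (@le_trans _ _ (\sum_(j < J) k * (a j * j.+1%:R ^+ 2) ^+ 2)); last first.
  by rewrite -mulr_sumr /score_constant -/k mulrC; exact: ler_wpM2r.
apply: ler_sum => j _; rewrite expr_div_n sE [leRHS](_ : _ = a j ^+ 2 * (k * j.+1%:R ^+ 4)); last by ring.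
apply: ler_wpM2l; first exact: sqr_ge0.
have j1 : 1 <= j.+1%:R ^+ 2 :> R by rewrite exprn_ege1 // ler1n.
rewrite /weight (_ : j.+1%:R ^+ 4 = (j.+1%:R ^+ 2) ^+ 2 :> R); last by rewrite -exprM.
move: (j.+1%:R ^+ 2 : R) j1 => y y1.
have M20 : 0 < M ^+ 2 by exact: exprn_gt0.
have h0 : 0 <= 1 + y / M ^+ 2 by apply: addr_ge0 => //; apply: divr_ge0; lra.
have h1 : 1 + y / M ^+ 2 <= (1 + M ^- 2) * y.
  by rewrite mulrDl mul1r (mulrC y) lerD2r.
have z0 : 0 < 1 + y / M ^+ 2 by apply: ltr_pwDl => //; apply: divr_ge0; lra.
have -> : (cw / M / (1 + y / M ^+ 2) ^+ 2)^-1 = M / cw * (1 + y / M ^+ 2) ^+ 2.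
  by move: z0; move: (1 + y / M ^+ 2) => z z0; field; rewrite !gt_eqF.
have -> : k * y ^+ 2 = M / cw * ((1 + M ^- 2) * y) ^+ 2 by rewrite /k; ring.
apply: ler_wpM2l; first by apply: divr_ge0; exact: ltW.
by rewrite !expr2; exact: ler_pM.
Qed.

End weights.

(** * Convergence of [Chat] and its domination of the test functionals *)

Section Chat_limit.
Variables (R : realType) (T : Type) (n : nat) (cw M : R) (S : nat -> T -> 'cV[R]_n) (w : T).
Hypotheses (cw0 : 0 < cw) (M0 : 0 < M).
Hypothesis bounded : forall i, exists K, forall N,
  \sum_(1 <= j < N) weight cw M j * S j w i 0 ^+ 2 <= K.

Lemma cvgn_sum (I : Type) (s : seq I) (u : I -> nat -> R) (l : I -> R) :
  (forall i, u i k @[k --> \oo] --> l i) ->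
  \sum_(i <- s) u i k @[k --> \oo] --> \sum_(i <- s) l i.
Proof.
move=> h; elim: s => [|i s IH].
  rewrite big_nil (_ : (fun k => _) = cst 0); first exact: cvg_cst.
  by apply/funext => k; rewrite big_nil.
rewrite big_cons (_ : (fun k => _) = fun k => u i k + \sum_(i <- s) u i k).
  by apply: cvgD; [exact: h | exact: IH].
by apply/funext => k; rewrite big_cons.
Qed.

Definition partial_Chat (N : nat) : 'M[R]_n :=
  \matrix_(i, k) \sum_(1 <= j < N) weight cw M j * (S j w *m (S j w)^T) i k.

Lemma weighted_square_nondecreasing (x : nat -> R) :
  nondecreasing_seq (fun N => \sum_(1 <= j < N) weight cw M j * x j ^+ 2).
Proof.
apply/nondecreasing_seqP => -[|N]; first by rewrite !big_geq.
rewrite [leRHS]big_nat_recr //= lerDl; apply: mulr_ge0; last exact: sqr_ge0.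
exact/ltW/weight_gt0.
Qed.

Lemma weighted_square_cvg (x : nat -> R) (K : R) :
  (forall N, \sum_(1 <= j < N) weight cw M j * x j ^+ 2 <= K) ->
  cvgn (fun N => \sum_(1 <= j < N) weight cw M j * x j ^+ 2).
Proof.
move=> h; apply: nondecreasing_is_cvgn; first exact: weighted_square_nondecreasing.
by exists K => _ [N _ <-].
Qed.

Lemma outer_product_entry j i k : (S j w *m (S j w)^T) i k = S j w i 0 * S j w k 0.
Proof. by rewrite mxE big_ord1 mxE. Qed.

(** Polarisation writes an entry through three series of nonnegative terms, which converge because
    they are bounded. *)
Lemma Chat_entry_cvg i k : partial_Chat N i k @[N --> \oo] --> Chat cw M S w i k.
Proof.
rewrite /Chat mxE; suff h : cvgn (fun N => partial_Chat N i k).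
  rewrite (_ : (fun N => _) = fun N => partial_Chat N i k) //.
  by apply/funext => N; rewrite mxE.
have [Ki hi] := bounded i; have [Kk hk] := bounded k.
rewrite (_ : (fun N => _) = fun N => 2^-1 * (\sum_(1 <= j < N) weight cw M j * (S j w i 0 + S j w k 0) ^+ 2
  - \sum_(1 <= j < N) weight cw M j * S j w i 0 ^+ 2 - \sum_(1 <= j < N) weight cw M j * S j w k 0 ^+ 2)); last first.
  apply/funext => N; rewrite mxE -!sumrB mulr_sumr; apply: eq_bigr => j _.
  by rewrite outer_product_entry; field.
apply: is_cvgM; first exact: is_cvg_cst.
apply: is_cvgB; last exact: weighted_square_cvg hk.
apply: is_cvgB; last exact: weighted_square_cvg hi.
apply: (@weighted_square_cvg (fun j => S j w i 0 + S j w k 0) (2 * Ki + 2 * Kk)) => N.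
apply: (@le_trans _ _ (2 * \sum_(1 <= j < N) weight cw M j * S j w i 0 ^+ 2 +
    2 * \sum_(1 <= j < N) weight cw M j * S j w k 0 ^+ 2)).
  rewrite !mulr_sumr -big_split; apply: ler_sum => j _ /=.
  have := weight_gt0 cw0 M0 j; move: (weight _ _ _) (S j w i 0) (S j w k 0) => p x y p0.
  have := mulr_ge0 (ltW p0) (sqr_ge0 (x - y)); nra.
by apply: lerD; apply: ler_wpM2l.
Qed.

Lemma qform_partial_Chat N (v : 'rV[R]_n) :
  qform (partial_Chat N) v = \sum_(1 <= j < N) weight cw M j * (\sum_i v 0 i * S j w i 0) ^+ 2.
Proof.
rewrite qformE.
under eq_bigr => i _ do (under eq_bigr => k _ do rewrite mxE mulr_sumr mulr_suml).
under eq_bigr => i _ do rewrite exchange_big /=.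
rewrite exchange_big /=; apply: eq_bigr => j _.
rewrite expr2 mulr_suml mulr_sumr; apply: eq_bigr => i _.
rewrite mulr_sumr mulr_sumr; apply: eq_bigr => k _.
by rewrite outer_product_entry; ring.
Qed.

Lemma qform_Chat_ge N (v : 'rV[R]_n) : qform (partial_Chat N) v <= qform (Chat cw M S w) v.
Proof.
have h : qform (partial_Chat N) v @[N --> \oo] --> qform (Chat cw M S w) v.
  rewrite qformE (_ : (fun N => _) = fun N => \sum_i \sum_j v 0 j * partial_Chat N j i * v 0 i); last first.
    by apply/funext => k; rewrite qformE.
  apply: cvgn_sum => i; apply: cvgn_sum => j.
  by apply: cvgM; [apply: cvgM; [exact: cvg_cst | exact: Chat_entry_cvg] | exact: cvg_cst].
rewrite -(cvg_lim _ h) //.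
apply: (@nondecreasing_cvgn_le _ (fun N => qform (partial_Chat N) v)); last first.
  by apply/cvg_ex; exists (qform (Chat cw M S w) v).
move=> a b ab; rewrite !qform_partial_Chat; exact: weighted_square_nondecreasing ab.
Qed.

Lemma Chat_sym : (Chat cw M S w)^T = Chat cw M S w.
Proof.
apply/matrixP => i k; rewrite !mxE; congr (limn _); apply/funext => N.
by apply: eq_bigr => j _; rewrite !outer_product_entry [X in _ * X]mulrC.
Qed.

Lemma Chat_nearly_dependent r (kap : R) (J : 'I_r.+1 -> nat) (a : 'I_r.+1 -> nat -> R) :
  (r < n)%N -> 0 <= kap -> eigval r.+1 (Chat cw M S w) <= kap ->
  (forall l, \sum_(j < J l) (a l j * j.+1%:R ^+ 2) ^+ 2 <= 200) ->
  nearly_dependent (\matrix_(l, i) \sum_(j < J l) a l j * S j.+1 w i 0)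
    (n%:R * (r.+1%:R * score_constant cw M * kap)).
Proof.
move=> rn kap0 hk ha; have s0 := score_constant_gt0 cw0 M0.
apply: (@eigval_nearly_dependent _ _ _ (Chat cw M S w)) => //; first exact: Chat_sym.
  by apply: mulr_ge0 => //; exact: ltW.
move=> v; rewrite nsqE -mulrA mulr_natl -[X in _ *+ X]card_ord -sumr_const; apply: ler_sum => l _.
apply: le_trans (ler_wpM2l (ltW s0) (qform_Chat_ge (J l).+1 v)).
rewrite qform_partial_Chat.
apply: le_trans (score_cauchy_schwarz cw0 M0 (fun j => \sum_i v 0 i * S j w i 0) (ha l)).
rewrite le_eqVlt; apply/orP; left; apply/eqP; congr (_ ^+ 2).
rewrite mxE; under eq_bigr => i _ do rewrite !mxE mulr_sumr.
rewrite exchange_big /=; apply: eq_bigr => j _; rewrite mulr_sumr; apply: eq_bigr => i _.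
by ring.
Qed.

End Chat_limit.

Section detection.
Variable R : realType.

Lemma continuous_dPhi (t h : R) j : continuous (derive1 (Phi t h j)).
Proof.
rewrite (_ : derive1 _ = fun s => Num.sqrt (2 / h) * (j%:R * pi / h * cos (j%:R * pi * (s - t) / h))); last first.
  by apply/funext => s; rewrite derive1E; have [_ ->] := is_derive_Phi t h j s.
move=> y; apply: cvgM; first exact: cvg_cst.
apply: cvgM; first exact: cvg_cst.
apply: (@continuous_comp _ _ _ (fun y => j%:R * pi * (y - t) / h) cos); last exact: continuous_cos.
apply: cvgM; last exact: cvg_cst.
apply: cvgM; first exact: cvg_cst.
by apply: cvgB; [exact: cvg_id | exact: cvg_cst].
Qed.

(** In the argument of the bound, [score_constant] comes from Cauchy-Schwarz for one row, r + 1 from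
    the sum over rows, and d from the number of components in [eigval_nearly_dependent]. *)
Lemma detection_bound (d r n : nat) (rho : R) (p p' c : 'I_r.+1 -> R) (eta t h cw M lam kap : R)
    (Sig : R -> 'M[R]_d) (E : experiment R d) (S : nat -> Omega E -> 'cV[R]_d) :
  0 < rho ->
  (forall l : 'I_r.+1, [/\ cos_angle (block_edge R r l.+1) <= p l, p l < p' l,
                   p' l <= cos_angle (block_edge R r l) & 0 < c l]) ->
  (forall l : 'I_r.+1, rho <= 2 * c l * (p' l - p l)) ->
  (forall (l : 'I_r.+1) x, p l <= x <= p' l ->
     c l <= wave (block_edge R r l) (block_edge R r l.+1) x ^+ 2) ->
  (r < d)%N -> 0 <= t -> 0 < h -> t + h <= 1 -> 0 < cw -> 0 < M -> 0 < lam -> 0 < kap ->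
  L1_spd Sig -> observation_model eta n Sig E ->
  (forall j, (0 < j)%N -> spectral_statistic t h j (S j)) ->
  (forall s, t <= s <= t + h -> lam <= eigval r.+1 (Sig s)) ->
  measurable [set w | kap < eigval r.+1 (Chat cw M S w)] /\
  ((1 - anticoncentration_bound r d lam rho (d%:R * (r.+1%:R * score_constant cw M * kap)))%:E
     <= Prob E [set w | (kap < eigval r.+1 (Chat cw M S w))%R])%E.
Proof.
move=> rho0 hp hrho hwave rd t0 h0 th1 cw0 M0 lam0 kap0 [hspd _] [[msig _] hSig [bmB bmW ind] [mX cX hX] [mY hY]] hS hlam.
pose P := Prob E.
have mSj j i : (0 < j)%N -> measurable_fun setT (fun w => S j w i 0).
  by move=> j0; have [] := hS j j0 i.
have apS j i : (0 < j)%N -> approximable P (fun s w => Yproc E s w i 0) t (t + h) (derive1 (Phi t h j)) (fun w => S j w i 0).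
  move=> j0; apply: stoch_integral_approximable.
  - by move=> x /andP[tx xt]; apply: mY; rewrite (le_trans t0 tx) (le_trans xt).
  - by apply: measurable_funTS; apply: continuous_measurable_fun; exact: continuous_dPhi.
  - exact: hS.
have psd s : 0 <= s <= 1 -> spd (sigma E s *m (sigma E s)^T).
  by move=> s01; rewrite -hSig //; exact: hspd.
have mW s i : 0 <= s <= 1 -> measurable_fun setT (fun w => Wproc E s w i 0).
  by have [mw _ _ _] := bmW; exact: mw.
have hlam' s : t <= s <= t + h -> lam <= eigval r.+1 (sigma E s *m (sigma E s)^T).
  move=> /andP[ts sth]; rewrite -hSig; first by apply: hlam; rewrite ts.
  by rewrite (le_trans t0 ts) (le_trans sth).
have d0 : (0 < d)%N by exact: leq_ltn_trans rd.
pose K := d%:R * (r.+1%:R * score_constant cw M * kap).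
have K0 : 0 < K.
  apply: mulr_gt0; first by rewrite ltr0n.
  by apply: mulr_gt0 => //; apply: mulr_gt0 => //; exact: score_constant_gt0.
have mC : measurable [set w | kap < eigval r.+1 (Chat cw M S w)].
  apply: measurable_lt_eigval => //; last by move=> w; exact: Chat_sym.
  move=> i k; rewrite (_ : (fun w => _) = fun w => limn ((fun N w => \sum_(j < N.-1)
      weight cw M j.+1 * (S j.+1 w i 0 * S j.+1 w k 0)) ^~ w)); last first.
    apply/funext => w; rewrite mxE; congr (limn _); apply/funext => N.
    rewrite big_add1 big_mkord; apply: eq_bigr => j _.
    by rewrite outer_product_entry.
  apply: measurable_limn => N; apply: measurable_sum => j.
  by apply: measurable_funM => //; apply: measurable_funM; exact: mSj.
split=> //.
have [Cw Cw0 hCw] := weight_sqr_sum cw0 M0.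
(* The coefficients of the sine polynomials depend on e, the event does not; so e can tend to 0
   afterwards. Possible divergence of the series [Chat] is part of the exceptional set. *)
have key e : 0 < e -> outer_le P [set w | eigval r.+1 (Chat cw M S w) <= kap] (anticoncentration_bound r d lam rho K + e).
  move=> e0; have e20 : 0 < e / 2 by rewrite divr_gt0.
  have [J [a [ha hJ]]] := core_anticoncentration mX cX mW ind bmB hY t0 h0 th1 apS msig hX rd psd
     lam0 rho0 hp hrho hwave hlam' K0 e20.
  have hb : outer_le P [set w | exists i, ~ exists K', forall N,
       \sum_(1 <= j < N) weight cw M j * S j w i 0 ^+ 2 <= K'] (\sum_(i < d) e / (2 * d%:R)).
    apply: outer_le_bigcup => i.
    apply: (weighted_sum_bounded mX cX bmW hY t0 h0 th1 mSj apS _ Cw0 hCw).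
      by move=> j; exact/ltW/weight_gt0.
    by rewrite divr_gt0 // mulr_gt0 // ltr0n.
  apply: outer_le_sub (outer_leU hb hJ); last first.
    rewrite sumr_const card_ord -[_ *+ d]mulr_natr (_ : e / (2 * d%:R) * d%:R = e / 2); first by lra.
    by field; rewrite pnatr_eq0 -lt0n.
  move=> w /= hw; have [hb'|hb'] := pselect (exists i, ~ exists K', forall N,
       \sum_(1 <= j < N) weight cw M j * S j w i 0 ^+ 2 <= K'); first by left.
  right; apply: (Chat_nearly_dependent cw0 M0 _ rd (ltW kap0) hw ha).
  by move=> i; apply: contrapT => hn; apply: hb'; exists i.
have PC : (P (~` [set w | (kap < eigval r.+1 (Chat cw M S w))%R]) <= (anticoncentration_bound r d lam rho K)%:E)%E.
  apply/lee_addgt0Pr => e e0; rewrite -EFinD; apply: outer_le_measure; first exact: measurableC.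
  by apply: outer_le_sub (key e e0) => // w /= /negP; rewrite -leNgt.
move: PC; rewrite probability_setC // -/P; set x := P _ => h1.
have xf : x \is a fin_num by exact: fin_num_measure.
move: h1; rewrite -(fineK xf) -EFinB !lee_fin => h1; lra.
Qed.

End detection.

(** * Rates *)

Section scaling.
Variable R : realType.

Lemma powR_le_base (x p C : R) : 0 < x -> 1 <= p -> 1 <= C -> x `^ p <= C -> x <= C.
Proof.
move=> x0 p1 C1 h; rewrite leNgt; apply/negP => Cx.
have x1 : 1 <= x by rewrite (le_trans C1) // ltW.
by have := ler_powR x1 p1; rewrite powRr1 ?(ltW x0) // => h1; have := le_trans h1 h; rewrite leNgt Cx.
Qed.

Lemma powR_ge_base (x p C : R) : 0 < x -> 1 <= p -> 1 <= C -> C^-1 <= x `^ p -> C^-1 <= x.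
Proof.
move=> x0 p1 C1 h; have C0 : 0 < C by exact: lt_le_trans C1.
rewrite -[leRHS]invrK lef_pV2 ?posrE ?invr_gt0 //.
apply: (powR_le_base _ p1) => //; first by rewrite invr_gt0.
have -> : x^-1 `^ p = (x `^ p)^-1.
  by rewrite -(powR_inv1 (ltW x0)) -powRrM mulN1r powRN.
by rewrite -[leRHS]invrK lef_pV2 ?posrE ?invr_gt0 // powR_gt0.
Qed.

Lemma powR_le_four (x p C : R) : 0 < x -> 0 <= p <= 4 -> 1 <= C -> x <= C -> x `^ p <= C ^+ 4.
Proof.
move=> x0 /andP[p0 p4] C1 xC; have C0 : 0 < C by exact: lt_le_trans C1.
apply: (@le_trans _ _ (C `^ p)).
  by apply: ge0_ler_powR => //; rewrite nnegrE ltW.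
by rewrite -(powR_mulrn 4 (ltW C0)); exact: ler_powR.
Qed.

Lemma powR_ge_four (x p C : R) : 0 < x -> 0 <= p <= 4 -> 1 <= C -> C^-1 <= x -> (C ^+ 4)^-1 <= x `^ p.
Proof.
move=> x0 p04 C1 Cx; have C0 : 0 < C by exact: lt_le_trans C1.
rewrite -[leRHS]invrK lef_pV2 ?posrE ?invr_gt0 ?exprn_gt0 ?powR_gt0 //.
have -> : (x `^ p)^-1 = x^-1 `^ p.
  by rewrite -(powR_inv1 (ltW x0)) -powRrM mulN1r powRN.
apply: powR_le_four => //; first by rewrite invr_gt0.
by rewrite -[leRHS]invrK lef_pV2 ?posrE ?invr_gt0.
Qed.

Lemma scale_power (h A p : R) : 0 < h -> 0 < A -> 0 < p ->
  (h * A `^ p^-1) `^ p = h `^ p * A.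
Proof.
move=> h0 A0 p0; rewrite powRM ?(ltW h0) ?powR_ge0 //.
by rewrite -powRrM mulVf ?gt_eqF // powRr1 // ltW.
Qed.

Lemma scale_square (h A n p : R) : 0 < h -> 0 < A -> 0 < n -> 0 < p ->
  A `^ (2 / p) * n `^ (2 / p - 1) * (h ^+ 2 * n) = (h * (A * n) `^ p^-1) ^+ 2.
Proof.
move=> h0 A0 n0 p0; rewrite exprMn -(powR_mulrn 2 (powR_ge0 _ _)) -powRrM.
rewrite (mulrC p^-1) powRM ?(ltW A0) ?(ltW n0) //.
have -> : n `^ (2 / p) = n `^ (2 / p - 1) * n.
  by rewrite -{3}(powRr1 (ltW n0)) -powRD ?subrK // (gt_eqF n0) implybT.
by ring.
Qed.

(** Multiplying by h^2 n makes everything dimensionless: x1 and x2 are h divided by the two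
    candidate bandwidths, and eps^2 becomes the constant (pi eta)^2. All comparisons of orders then
    reduce to bounds on min(x1, x2). *)
Lemma scale_facts (r n : nat) (beta L lam h : R) : 0 < beta <= 1 -> (0 < n)%N ->
  0 < L -> 0 <= lam -> 0 < h -> exists x1 x2 : R, [/\ 0 < x1, 0 < x2,
    bias0 r beta L lam h * (h ^+ 2 * n%:R) =
      Num.min (2 * x1 `^ (beta + 2)) ((r%:R + 4) * x2 `^ (2 * beta + 2)),
    bandwidth beta L lam n = Num.max (h / x1) (h / x2) &
    rate beta L lam n * (h ^+ 2 * n%:R) = Num.min (x1 ^+ 2) (x2 ^+ 2)].
Proof.
move=> /andP[b0 b1] n0 L0 lam0 h0; pose N : R := n%:R.
have N0 : 0 < N by rewrite ltr0n.
have LN0 : 0 < L * N by exact: mulr_gt0.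
have hN0 : 0 <= h ^+ 2 * N by apply: mulr_ge0; [exact: sqr_ge0 | exact: ltW].
have p1 : 0 < beta + 2 by lra.
have p2 : 0 < 2 * beta + 2 by lra.
have r0 : 0 <= r%:R :> R by [].
pose x1 := h * (L * N) `^ (beta + 2)^-1.
have x10 : 0 < x1 by rewrite mulr_gt0 ?powR_gt0.
have hD (a : R) : h `^ (a + 2) = h `^ a * h ^+ 2.
  by rewrite powRD ?(gt_eqF h0) ?implybT // (powR_mulrn 2 (ltW h0)).
have e1 : 2 * L * h `^ beta * (h ^+ 2 * N) = 2 * x1 `^ (beta + 2).
  by rewrite scale_power // hD; ring.
have e2 : (L * N) `^ (- (beta + 2)^-1) = h / x1.
  by rewrite powRN /x1 invfM mulrA divff ?gt_eqF // mul1r.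
have e3 : L `^ (2 / (beta + 2)) * N `^ (- (beta / (beta + 2))) * (h ^+ 2 * N) = x1 ^+ 2.
  rewrite -scale_square // (_ : - (beta / (beta + 2)) = 2 / (beta + 2) - 1) //.
  by field; rewrite gt_eqF.
rewrite /bias0 /bandwidth /rate -/N; case: eqP => [_|/eqP lamn].
  (* For lam = 0 there is no second candidate. This x2 is so large that x1 decides both minima and
     the maximum. *)
  pose x2 := Num.max x1 (Num.max 1 (x1 `^ (beta + 2))).
  have x21 : x1 <= x2 by rewrite le_max lexx.
  have x22 : 1 <= x2 by rewrite !le_max lexx !orbT.
  have x23 : x1 `^ (beta + 2) <= x2 by rewrite !le_max lexx !orbT.
  have x20 : 0 < x2 by exact: lt_le_trans x21.
  exists x1, x2; split=> //.
  - rewrite e1 min_l //.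
    have h1 : x2 <= x2 `^ (2 * beta + 2).
      by rewrite -{1}(powRr1 (ltW x20)); apply: ler_powR => //; lra.
    have h2 := le_trans x23 h1.
    have := powR_ge0 x2 (2 * beta + 2); move: (x2 `^ _) (x1 `^ _) h2 => u v vu u0.
    have := mulr_ge0 r0 u0; nra.
  - rewrite e2 max_l //; apply: ler_wpM2l; first exact: ltW.
    by rewrite lef_pV2.
  - rewrite e3 min_l // !expr2; apply: ler_pM => //; exact: ltW.
have lamp : 0 < lam by rewrite lt_neqAle eq_sym lamn.
pose A := lam^-1 * L ^+ 2.
have A0 : 0 < A by rewrite mulr_gt0 ?invr_gt0 ?exprn_gt0.
have AN0 : 0 < A * N by exact: mulr_gt0.
pose x2 := h * (A * N) `^ (2 * beta + 2)^-1.
have x20 : 0 < x2 by rewrite mulr_gt0 ?powR_gt0.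
exists x1, x2; split=> //.
- rewrite minr_pMl // e1; congr (Num.min _ _).
  by rewrite scale_power // hD /A; ring.
- rewrite maxC e2; congr (Num.max _ _).
  by rewrite -/A powRN /x2 invfM mulrA divff ?gt_eqF // mul1r.
- rewrite minr_pMl // minC e3; congr (Num.min _ _).
  rewrite -scale_square // -/A (_ : (beta + 1)^-1 = 2 / (2 * beta + 2)); last by field; rewrite !gt_eqF //; lra.
  rewrite (_ : - (beta * (2 / (2 * beta + 2))) = 2 / (2 * beta + 2) - 1) //.
  by field; rewrite !gt_eqF //; lra.
Qed.

Variables (r : nat) (eta beta : R) (L lam h : nat -> R).
Hypotheses (heta : 0 < eta) (hbeta : 0 < beta <= 1).
Hypothesis hL : forall n, (0 < n)%N -> 0 < L n.
Hypothesis hlam : forall n, (0 < n)%N -> 0 <= lam n.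
Hypothesis hh : forall n, (0 < n)%N -> 0 < h n.

Let k : R := (pi * eta) ^+ 2.

Lemma epsE n : (0 < n)%N -> eps eta n (h n) ^+ 2 * (h n ^+ 2 * n%:R) = k.
Proof.
move=> n0; have N0 : 0 < n%:R :> R by rewrite ltr0n.
have h0 := hh n0.
have s0 : 0 < Num.sqrt n%:R :> R by rewrite sqrtr_gt0.
rewrite /eps -[in X in _ * X](sqr_sqrtr (ltW N0)) /k.
generalize (pi : R) => q; move: (Num.sqrt n%:R) s0 => s s0.
by field; rewrite !gt_eqF.
Qed.

Lemma pi_eta_gt0 : 0 < k. Proof. by rewrite /k exprn_gt0 // mulr_gt0 // pi_gt0. Qed.

(** The bias condition bounds min(2 x1^(beta + 2), (r + 4) x2^(2 beta + 2)) from above and below.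
    Both exponents are at least 1, so the same kind of bound passes to min(x1, x2), uniformly in L
    and lam. *)
Lemma bandwidth_order :
  same_order (fun n => bias0 r beta (L n) (lam n) (h n)) (fun n => eps eta n (h n) ^+ 2) ->
  same_order h (fun n => bandwidth beta (L n) (lam n) n).
Proof.
move=> [C C0 hC]; have k0 := pi_eta_gt0; have /andP[b0 b1] := hbeta.
have r0 : 0 <= r%:R :> R by [].
pose D : R := (r%:R + 4) * (C * k + C / k + 1).
have Ck0 : 0 < C * k by exact: mulr_gt0.
have Ck'0 : 0 < C / k by exact: divr_gt0.
have D1 : C * k + C / k + 1 <= D by rewrite /D; apply: ler_peMl; lra.
have D2 : 4 * (C * k + C / k + 1) <= D by rewrite /D; apply: ler_wpM2r; lra.
have D1' : 1 <= D by lra.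
have D0 : 0 < D by lra.
exists D => // n n0; have h0 := hh n0; have [c1 c2] := hC n n0.
have [x1 [x2 [x10 x20 be bw _]]] := scale_facts r hbeta n0 (hL n0) (hlam n0) h0.
have N0 : 0 < n%:R :> R by rewrite ltr0n.
have hN0 : 0 < h n ^+ 2 * n%:R by rewrite mulr_gt0 // exprn_gt0.
have q1 : bias0 r beta (L n) (lam n) (h n) * (h n ^+ 2 * n%:R) <= C * k.
  by rewrite -(epsE n0) [leRHS]mulrA ler_pM2r.
have q2 : k <= C * (bias0 r beta (L n) (lam n) (h n) * (h n ^+ 2 * n%:R)).
  by rewrite -(epsE n0) [leRHS]mulrA ler_pM2r.
have q3 : k / C <= bias0 r beta (L n) (lam n) (h n) * (h n ^+ 2 * n%:R) by rewrite ler_pdivrMr // mulrC.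
rewrite be in q1 q3; have p1 : 1 <= beta + 2 by lra.
have p2 : 1 <= 2 * beta + 2 by lra.
have kC : (C / k + C * k + 1)^-1 <= k / C.
  rewrite -[leRHS]invrK lef_pV2 ?posrE ?invr_gt0 ?divr_gt0 //; last by lra.
  by rewrite invf_div; lra.
have E : D = (r%:R + 4) * (C / k + C * k + 1) by rewrite /D; ring.
have Dinv : D^-1 = (r%:R + 4)^-1 * (C / k + C * k + 1)^-1 by rewrite E invfM.
have s0 : 0 < C / k + C * k + 1 by lra.
have sc x : 0 < x -> x <= D -> h n <= D * (h n / x).
  by move=> x0 xD; rewrite mulrCA ler_peMr ?(ltW h0) // ler_pdivlMr // mul1r.
rewrite bw; split.
- move: q1; rewrite ge_min => /orP[] q1.
    have : x1 <= D by apply: (powR_le_base x10 p1) => //; have := powR_ge0 x1 (beta + 2); lra.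
    by move=> /(sc _ x10) h1; apply: (le_trans h1); apply: ler_wpM2l; [exact: ltW | rewrite le_max lexx].
  have : x2 <= D.
    apply: (powR_le_base x20 p2) => //; have h1 := powR_ge0 x2 (2 * beta + 2).
    by have := mulr_ge0 r0 h1; lra.
  by move=> /(sc _ x20) h1; apply: (le_trans h1); apply: ler_wpM2l; [exact: ltW | rewrite le_max lexx orbT].
- have {q3} := le_trans kC q3; rewrite le_min => /andP[q3 q4].
  have aux x : 0 < x -> D^-1 <= x -> h n / x <= D * h n.
    move=> x0 Dx; rewrite mulrC; apply: ler_wpM2r; first exact: ltW.
    by rewrite -[leRHS]invrK lef_pV2 ?posrE ?invr_gt0.
  rewrite ge_max; apply/andP; split; apply: aux => //.
    apply: (powR_ge_base x10 p1) => //; rewrite Dinv mulrC ler_pdivrMr; last by lra.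
    apply: (le_trans q3); rewrite mulrC; apply: ler_wpM2l; [exact: powR_ge0 | lra].
  apply: (powR_ge_base x20 p2) => //; rewrite Dinv mulrC ler_pdivrMr; last by lra.
  by rewrite [leRHS]mulrC.
Qed.

(** The converse: both exponents are at most 4, so bounds C and 1 / C on the scaled variables become
    C^4 and C^-4 on the powers. *)
Lemma bias_order :
  same_order h (fun n => bandwidth beta (L n) (lam n) n) ->
  same_order (fun n => bias0 r beta (L n) (lam n) (h n)) (fun n => eps eta n (h n) ^+ 2).
Proof.
move=> [C' C'0 hC]; have k0 := pi_eta_gt0; have /andP[b0 b1] := hbeta.
have r0 : 0 <= r%:R :> R by [].
pose C := C' + 1; have C1 : 1 <= C by rewrite /C; lra.
have C0 : 0 < C by lra.
pose D := (r%:R + 4) * C ^+ 4.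
have C40 : 0 < C ^+ 4 by exact: exprn_gt0.
have D0 : 0 < D by rewrite mulr_gt0 //; lra.
exists (D / k + D * k); first by apply: addr_gt0; [exact: divr_gt0 | exact: mulr_gt0].
move=> n n0; have h0 := hh n0; have [c1 c2] := hC n n0.
have [x1 [x2 [x10 x20 be bw _]]] := scale_facts r hbeta n0 (hL n0) (hlam n0) h0.
have N0 : 0 < n%:R :> R by rewrite ltr0n.
have hN0 : 0 < h n ^+ 2 * n%:R by rewrite mulr_gt0 // exprn_gt0.
rewrite bw in c1 c2.
have p1 : 0 <= beta + 2 <= 4 by lra.
have p2 : 0 <= 2 * beta + 2 <= 4 by lra.
have up x : 0 < x -> h n <= C' * (h n / x) -> x <= C.
  move=> x0; rewrite mulrCA -[X in X <= _]mulr1 ler_pM2l // ler_pdivlMr // mul1r /C; lra.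
have lo x : 0 < x -> h n / x <= C' * h n -> C^-1 <= x.
  move=> x0 hx; rewrite -[leRHS]invrK lef_pV2 ?posrE ?invr_gt0 //.
  have : x^-1 <= C' by rewrite -(ler_pM2l h0) [leRHS]mulrC.
  by rewrite /C; lra.
set q := Num.min _ _ in be.
have qD : q <= D.
  have : x1 <= C \/ x2 <= C.
    by move: c1; case: (leP (h n / x1) (h n / x2)) => _ h1; [right; exact: (up _ x20 h1) | left; exact: (up _ x10 h1)].
  have r4 : 0 <= r%:R * C ^+ 4 by apply: mulr_ge0 => //; exact: ltW.
  case=> hx; rewrite /q ge_min; apply/orP; [left | right].
    have := powR_le_four x10 p1 C1 hx; rewrite /D; lra.
  by rewrite /D; apply: ler_wpM2l; [lra | exact: powR_le_four].
have Dq : D^-1 <= q.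
  move: c2; rewrite ge_max => /andP[/(lo _ x10) h1 /(lo _ x20) h2].
  have h3 := powR_ge_four x10 p1 C1 h1; have h4 := powR_ge_four x20 p2 C1 h2.
  have h5 : D^-1 <= (C ^+ 4)^-1.
    by rewrite lef_pV2 ?posrE // /D; apply: ler_peMl; [exact: ltW | lra].
  have h6 := le_trans h5 h3; have h7 := le_trans h5 h4.
  have i0 : 0 < D^-1 by rewrite invr_gt0.
  rewrite /q le_min; apply/andP; split; first by lra.
  apply: (le_trans h7); apply: ler_peMl; [exact: powR_ge0 | lra].
have Dk0 : 0 < D * k by exact: mulr_gt0.
have Dk'0 : 0 < D / k by exact: divr_gt0.
split.
- rewrite -(ler_pM2r hN0) -[leRHS]mulrA (epsE n0) be.
  apply: (le_trans qD); rewrite mulrDl divfK ?gt_eqF // lerDl.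
  by apply: mulr_ge0; exact: ltW.
- rewrite -(ler_pM2r hN0) (epsE n0) -[leRHS]mulrA be.
  have q0 : 0 < q by apply: lt_le_trans Dq; rewrite invr_gt0.
  apply: (@le_trans _ _ (D * k * q)); last first.
    by apply: ler_wpM2r; [exact: ltW | lra].
  rewrite mulrAC -[leLHS]mul1r; apply: ler_wpM2r; first exact: ltW.
  by rewrite -ler_pdivrMl // mulr1.
Qed.

(** Both x1 and x2 are at least 1 / C, and the scaled rate is min(x1^2, x2^2); hence a critical
    value of order eps^2 is at most of the order of the rate. *)
Lemma eps_le_rate :
  same_order h (fun n => bandwidth beta (L n) (lam n) n) ->
  exists2 C : R, 0 < C & forall n, (0 < n)%N ->
    eps eta n (h n) ^+ 2 <= C * rate beta (L n) (lam n) n /\ 0 < rate beta (L n) (lam n) n.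
Proof.
move=> [C C0 hC]; have k0 := pi_eta_gt0.
exists (k * C ^+ 2); first by rewrite mulr_gt0 // exprn_gt0.
move=> n n0; have h0 := hh n0; have [_ c2] := hC n n0.
have [x1 [x2 [x10 x20 _ bw rt]]] := scale_facts r hbeta n0 (hL n0) (hlam n0) h0.
have N0 : 0 < n%:R :> R by rewrite ltr0n.
have hN0 : 0 < h n ^+ 2 * n%:R by rewrite mulr_gt0 // exprn_gt0.
have lo x : 0 < x -> h n / x <= C * h n -> 1 <= C ^+ 2 * x ^+ 2.
  move=> x0 hx; have h1 : x^-1 <= C by rewrite -(ler_pM2l h0) [leRHS]mulrC.
  have h2 : 1 <= C * x by rewrite -ler_pdivrMr // div1r.
  by rewrite -exprMn exprn_ege1.
have rt0 : 0 < rate beta (L n) (lam n) n * (h n ^+ 2 * n%:R).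
  by rewrite rt lt_min !exprn_gt0.
split; last by move: rt0; rewrite pmulr_lgt0.
rewrite -(ler_pM2r hN0) (epsE n0) -[leRHS]mulrA rt -[leRHS]mulrA.
rewrite -[leLHS]mulr1; apply: ler_wpM2l; first exact: ltW.
move: c2; rewrite bw ge_max => /andP[/(lo _ x10) h1 /(lo _ x20) h2].
by rewrite minr_pMr ?sqr_ge0 // le_min h1 h2.
Qed.

End scaling.

(** * Uniform power of the test *)

Section final_estimates.
Variable R : realType.

(** The alternative is nonempty; the infimum over an empty set would be +oo rather than at most
    1. *)
Lemma scalar_in_H1 (d r : nat) (t h c : R) : (r < d)%N -> 0 <= c ->
  H1 r t h c (fun=> c%:M : 'M[R]_d).
Proof.
move=> rd c0; split; last by move=> s _; rewrite (eigval_scalar (Ordinal rd)).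
split.
  move=> s _; split; first by rewrite tr_scalar_mx.
  by move=> x; rewrite mul_mx_scalar -scalemxAl mxE; apply: mulr_ge0 => //; exact: nsq_ge0.
move=> i j; apply/integrableP; split; first exact: measurable_cst.
under eq_integral do rewrite abse_EFin.
rewrite integral_cst //= lebesgue_measure_itv /= lte_fin ltr01 -EFinB subr0 mule1.
by rewrite ltry.
Qed.

(** The bound is homogeneous of degree 1/2 in K / lam, which separates a constant free of n from the
    ratio that tends to 0. *)
Lemma anticoncentration_bound_scale (r d : nat) (lam rho K c : R) : (r < d)%N ->
  0 < lam -> 0 < rho -> 0 <= c -> 0 <= K ->
  anticoncentration_bound r d lam rho (c * K) =
  anticoncentration_bound r d 1 rho c * Num.sqrt (K / lam).
Proof.
move=> rd lam0 rho0 c0 K0; rewrite /anticoncentration_bound mul1r.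
have dr0 : 0 < (d - r)%:R :> R by rewrite ltr0n subn_gt0.
have -> : 16 * r.+1%:R * (16 * r.+1%:R * (c * K)) / (lam * rho / (4 * (d - r)%:R)) =
   16 * r.+1%:R * (16 * r.+1%:R * c) / (rho / (4 * (d - r)%:R)) * (K / lam).
  by field; rewrite !gt_eqF.
rewrite sqrtrM ?mulrA //.
by do ?[apply: divr_ge0 => // | apply: mulr_ge0 => // | exact: ltW].
Qed.

Lemma kappa0_le (d r n : nat) (eta alpha beta M L lam h C : R) : (r < d)%N -> 0 < M ->
  0 < alpha < 1 -> 0 < bias0 r beta L lam h -> bias0 r beta L lam h <= C * eps eta n h ^+ 2 ->
  0 < kappa0 d r eta alpha beta M L lam h n <=
  (4 * C + M ^+ 2 / 2) * (1 + ln (4 * (d - r)%:R) * calW (6 * d%:R / M) + 21 * ln (2 * alpha^-1) / M) *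
    eps eta n h ^+ 2.
Proof.
move=> rd M0 /andP[a0 a1] b0 bC; rewrite /kappa0.
set F := 1 + _ + _; set e := eps eta n h ^+ 2 in bC *.
have e0 : 0 <= e by exact: sqr_ge0.
have F0 : 0 < F.
  have dr1 : 1 <= (d - r)%:R :> R by rewrite ler1n subn_gt0.
  have h1 : 0 <= ln (4 * (d - r)%:R) :> R by apply: ln_ge0; lra.
  have h2 : 0 <= calW (6 * d%:R / M).
    by rewrite /calW le_max; apply/orP; right; exact: sqrtr_ge0.
  have ai1 : 1 <= alpha^-1 by rewrite -invr1 lef_pV2 ?posrE // ltW.
  have h3 : 0 <= ln (2 * alpha^-1) :> R by apply: ln_ge0; lra.
  have h4 := mulr_ge0 h1 h2.
  have h5 : 0 <= 21 * ln (2 * alpha^-1) / M by apply: divr_ge0; [exact: mulr_ge0 | exact: ltW].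
  by rewrite /F; lra.
have M20 : 0 <= M ^+ 2 / 2 by apply: divr_ge0 => //; exact: sqr_ge0.
have eM : 0 <= e * (M ^+ 2 / 2) by exact: mulr_ge0.
apply/andP; split; first by apply: mulr_gt0 => //; lra.
rewrite [leRHS]mulrAC; apply: ler_wpM2r; first exact: ltW.
by rewrite mulrDl (mulrC e); lra.
Qed.

Lemma cvg_one_minus_sqrt (Rn : nat -> R) (C : R) : Rn n @[n --> \oo] --> +oo ->
  (1 - C * Num.sqrt (Rn n)^-1)%:E @[n --> \oo] --> 1%E.
Proof.
move=> hR.
have h0 : (Rn n)^-1 @[n --> \oo] --> (0 : R).
  have pos : \forall n \near \oo, 0 < Rn n by move/cvgryPgt : hR => /(_ 0).
  by apply/(gtr0_cvgV0 pos).
apply: cvg_EFin; first exact: nearW.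
rewrite [X in _ --> X](_ : _ = 1 - C * Num.sqrt 0); last by rewrite sqrtr0 mulr0 subr0.
apply: cvgB; first exact: cvg_cst.
apply: cvgM; first exact: cvg_cst.
exact: (continuous_cvg _ (@sqrt_continuous R 0) h0).
Qed.

End final_estimates.

Theorem corollary4p3 (R : realType) (d r : nat)
  (eta beta M alpha t cw : R) (L lam h Rn : nat -> R)
  (E : nat -> (R -> 'M[R]_d) -> experiment R d)
  (S : forall (n : nat) (Sig : R -> 'M[R]_d), nat -> Omega (E n Sig) -> 'cV[R]_d)
  (hr : (r < d)%N) (heta : 0 < eta) (hbeta : 0 < beta <= 1)
  (hM : r.+1%:R <= M) (halpha : 0 < alpha < 1) (ht : 0 <= t < 1)
  (hcw : 0 < cw)
  (hcw1 : (\sum_(1 <= j < N) weight cw M j) @[N --> \oo] --> (1 : R))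
  (hL : forall n, (0 < n)%N -> 0 < L n)
  (hlam : forall n, (0 < n)%N -> 0 <= lam n)
  (hE : forall n Sig, (0 < n)%N -> L1_spd Sig ->
          observation_model eta n Sig (E n Sig))
  (hS : forall n Sig j, (0 < n)%N -> L1_spd Sig -> (0 < j)%N ->
          spectral_statistic t (h n) j (S n Sig j))
  (hh : forall n, (0 < n)%N -> 0 < h n <= 1 - t)
  (hh0 : h n @[n --> \oo] --> (0 : R))
  (hRn : Rn n @[n --> \oo] --> +oo) :
  (same_order (fun n => bias0 r beta (L n) (lam n) (h n))
              (fun n => eps eta n (h n) ^+ 2)
   <-> same_order h (fun n => bandwidth beta (L n) (lam n) n)) /\
  (same_order (fun n => bias0 r beta (L n) (lam n) (h n))
              (fun n => eps eta n (h n) ^+ 2) ->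
   ereal_inf
     [set Prob (E n Sig)
        [set w | phi0 r eta alpha beta cw M (L n) (lam n) (h n) n (S n Sig) w]
     | Sig in H1 r t (h n) (Rn n * rate beta (L n) (lam n) n)]
   @[n --> \oo] --> 1%E).
Proof.
have [p [p' [c [rho [rho0 hp hrho hwave]]]]] := @wave_blocks R r.
have /andP[t0 t1] := ht.
have M0 : 0 < M by apply: lt_le_trans hM.
have hh1 n : (0 < n)%N -> 0 < h n by move=> /hh/andP[].
split.
  by split; [exact: (@bandwidth_order R r eta beta L lam h heta hbeta hL hlam hh1)
            | exact: (@bias_order R r eta beta L lam h heta hbeta hL hlam hh1)].
move=> hso; have hbw := @bandwidth_order R r eta beta L lam h heta hbeta hL hlam hh1 hso.
have [C2 C20 hC2] := @eps_le_rate R r eta beta L lam h heta hbeta hL hlam hh1 hbw.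
have [C1 C10 hC1] := hso.
pose F := (4 * C1 + M ^+ 2 / 2) * (1 + ln (4 * (d - r)%:R) * calW (6 * d%:R / M) + 21 * ln (2 * alpha^-1) / M).
pose c0 := d%:R * (r.+1%:R * score_constant cw M).
have c00 : 0 <= c0.
  by apply: mulr_ge0 => //; apply: mulr_ge0 => //; exact/ltW/score_constant_gt0.
pose A := anticoncentration_bound r d 1 rho c0.
have A0 : 0 <= A.
  by do 3 (apply: mulr_ge0 => //); exact: sqrtr_ge0.
pose CC := A * Num.sqrt (F * C2).
have pos : \forall n \near \oo, 0 < Rn n by move/cvgryPgt : hRn => /(_ 0).
(* Here kap <= F eps^2 <= F C2 rate, so kap divided by Rn * rate is at most F C2 / Rn and the rate
   cancels. [CC] depends neither on n nor on Sig, so the bound passes to the infimum. *)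
have det n Sig : (0 < n)%N -> 0 < Rn n -> H1 r t (h n) (Rn n * rate beta (L n) (lam n) n) Sig ->
    measurable [set w | phi0 r eta alpha beta cw M (L n) (lam n) (h n) n (@S n Sig) w] /\
    ((1 - CC * Num.sqrt (Rn n)^-1)%:E <= Prob (E n Sig)
        [set w | phi0 r eta alpha beta cw M (L n) (lam n) (h n) n (@S n Sig) w])%E.
  move=> n0 R0 [hSig hlow]; have h0 := hh1 n n0.
  have th1 : t + h n <= 1 by have /andP[_] := hh n n0; lra.
  have [he rt0] := hC2 n n0; have lam10 : 0 < Rn n * rate beta (L n) (lam n) n by exact: mulr_gt0.
  have [hb1 hb2] := hC1 n n0.
  have e0 : 0 < eps eta n (h n) ^+ 2.
    rewrite exprn_gt0 // /eps; apply: divr_gt0; last by rewrite sqrtr_gt0 ltr0n.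
    by apply: mulr_gt0 => //; apply: mulr_gt0; [exact: pi_gt0 | rewrite invr_gt0].
  have bias0_gt0 : 0 < bias0 r beta (L n) (lam n) (h n).
    by rewrite -(pmulr_rgt0 _ C10); exact: lt_le_trans hb2.
  have /andP[kap0 kapF] := kappa0_le hr M0 halpha bias0_gt0 hb1.
  rewrite -/F in kapF; set kap := kappa0 _ _ _ _ _ _ _ _ _ _ in kap0 kapF.
  have F0 : 0 < F by rewrite -(pmulr_lgt0 _ e0); exact: lt_le_trans kapF.
  have [mC hdet] := detection_bound rho0 hp hrho hwave hr t0 h0 th1 hcw M0 lam10 kap0 hSig
     (hE n Sig n0 hSig) (fun j j0 => hS n Sig j n0 hSig j0) hlow.
  split; first exact: mC.
  apply: le_trans hdet; rewrite lee_fin lerD2l lerN2.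
  rewrite (_ : d%:R * (r.+1%:R * score_constant cw M * kap) = c0 * kap); last by rewrite /c0; ring.
  rewrite anticoncentration_bound_scale ?(ltW kap0) // -/A /CC -mulrA; apply: ler_wpM2l => //.
  rewrite -sqrtrM; last by apply: mulr_ge0; exact: ltW.
  apply: ler_wsqrtr; rewrite ler_pdivrMr //.
  rewrite [leRHS]mulrA divfK ?gt_eqF // -[leRHS]mulrA.
  by apply: (le_trans kapF); apply: ler_wpM2l => //; exact: ltW.
apply: (@squeeze_cvge _ \oo _ R (fun n => (1 - CC * Num.sqrt (Rn n)^-1)%:E) _ (fun=> 1%E)); last 2 first.
- exact: cvg_one_minus_sqrt.
- exact: cvg_cst.
near=> n.
have n0 : (0 < n)%N by near: n; exact: nbhs_infty_gt.
have R0 : 0 < Rn n by near: n.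
apply/andP; split.
  by apply/ereal_infP => _ [Sig hSig <-]; have [] := det n Sig n0 R0 hSig.
have [_ rt0] := hC2 n n0.
have hc : H1 r t (h n) (Rn n * rate beta (L n) (lam n) n)
    (fun=> (Rn n * rate beta (L n) (lam n) n)%:M : 'M[R]_d).
  by apply: scalar_in_H1 => //; exact/ltW/mulr_gt0.
have [mC _] := det n _ n0 R0 hc.
apply: le_trans (probability_le1 (Prob (E n _)) mC).
by apply: ereal_inf_lbound; exists (fun=> (Rn n * rate beta (L n) (lam n) n)%:M).
Unshelve. all: by end_near. Qed.
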